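(* Let $A$ be a finite dimensional algebra over a field and $U\in2\text{-}\mathsf{psilt}\,A$. Then there exist unique piecewise linear maps $\lambda_U,\lambda'_U\colon D(U)\to D(U)$ such that any $\theta\in D(U)$ satisfies $\lambda_U(\theta)+\lambda'_U(\theta)=\theta$ and $$\{\eta\in\mathbb R C(U)\mid\theta-\eta\in D(U)\}=\lambda_U(\theta)+(-C(U)),\qquad(\theta+\mathbb R C(U))\cap D(U)=\lambda'_U(\theta)+C(U).$$
   Context: Let $K$ be a field and $A$ a finite dimensional $K$-algebra. $\mathsf{mod}\,A$, $\mathsf{proj}\,A$, $\mathsf{inj}\,A$ are the categories of finitely generated (f.g.), f.g. projective, f.g. injective right $A$-modules; $\mathsf K^{\mathrm b}(\mathsf{proj}\,A)$ is the homotopy category of bounded complexes; $\nu\colon\mathsf K^{\mathrm b}(\mathsf{proj}\,A)\to\mathsf K^{\mathrm b}(\mathsf{inj}\,A)$ is the Nakayama functor. $n:=|A|$ is the number of isoclasses of indecomposable projective $A$-modules. $U\in\mathsf K^{\mathrm b}(\mathsf{proj}\,A)$ is presilting if $\mathrm{Hom}(U,U[\ell])=0$ for all $\ell\ge1$, and 2-term if it is isomorphic to a complex concentrated in degrees $-1,0$. $2\text{-}\mathsf{psilt}\,A$ is the set of isoclasses of basic 2-term presilting complexes. We write $U=\bigoplus_{i=1}^mU_i$ with each $U_i$ indecomposable. $K_0(\mathsf{proj}\,A)_{\mathbb R}:=K_0(\mathsf{proj}\,A)\otimes_{\mathbb Z}\mathbb R\cong\mathbb R^n$; complexes in $\mathsf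 K^{\mathrm b}(\mathsf{proj}\,A)$ have classes in it. Each $\theta\in K_0(\mathsf{proj}\,A)_{\mathbb R}$ is a linear form on $K_0(\mathsf{mod}\,A)_{\mathbb R}$ via the Euler bilinear form, determined by $\langle[P],[M]\rangle=\dim_K\mathrm{Hom}_A(P,M)$ for $P\in\mathsf{proj}\,A$, $M\in\mathsf{mod}\,A$; write $\theta(M):=\langle\theta,[M]\rangle$. Define subcategories of $\mathsf{mod}\,A$: $M\in\overline{\mathcal T}_\theta$ iff $\theta(X)\ge0$ for all factor modules $X$ of $M$; $M\in\overline{\mathcal F}_\theta$ iff $\theta(Y)\le0$ for all submodules $Y$ of $M$. $C(U):=\sum_{i=1}^m\mathbb R_{\ge0}[U_i]$, $\mathbb R C(U)$ is the vector subspace spanned by $C(U)$, and $D(U):=\{\theta\in K_0(\mathsf{proj}\,A)_{\mathbb R}\mid H^0(U)\in\overline{\mathcal T}_\theta,\ H^{-1}(\nu U)\in\overline{\mathcal F}_\theta\}$, a rational polyhedral cone. For subsets, $X+Y:=\{x+y\mid x\in X,\ y\in Y\}$ and $-X:=\{-x\mid x\in X\}$. *)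

(* Defs.v *)
From HB Require Import structures.
From mathcomp Require Import all_boot all_order all_algebra all_field.
From mathcomp Require Import all_classical all_reals.
From mathcomp.multinomials Require Import freeg.

Set Implicit Arguments.
Unset Strict Implicit.
Unset Printing Implicit Defensive.

Import passmx.
Import Order.TTheory GRing.Theory Num.Theory.
Local Open Scope classical_set_scope.
Local Open Scope ring_scope.

Definition lfE :=
  (comp_lfunE, add_lfunE, opp_lfunE, scale_lfunE, id_lfunE, zero_lfunE).

(** * Finitely generated right modules *)

Section Modules.
Variables (K : fieldType) (A : falgType K).

Definition is_right_action (V : vectType K) (act : V -> A -> V) : Prop :=
  [/\ forall a, linear (act^~ a), forall x, linear (act x),
      forall x, act x 1 = x &
      forall x a b, act x (a * b) = act (act x a) b].

(* As [A] is finite dimensional, a right [A]-module is finitely generated iff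
   it is finite dimensional over [K]. *)
Record fdmod := FdMod {
  carrier :> vectType K;
  act : carrier -> A -> carrier;
  actP : is_right_action act
}.

Definition ract (M : fdmod) (a : A) : 'End(M) := linfun (@act M ^~ a).

Lemma ractE (M : fdmod) a x : ract M a x = act x a.
Proof.
have h : forall b, linear (@act M ^~ b) by case: (actP M).
pose L : {linear M -> M} :=
  HB.pack (@act M ^~ a) (GRing.isLinear.Build _ _ _ _ _ (h a)).
exact: (lfunE L x).
Qed.

Definition is_zero_mod (M : fdmod) : Prop := \dim {: M} = 0%N.

Definition is_modhom (M N : fdmod) (f : 'Hom(M, N)) : Prop :=
  forall x a, f (act x a) = act (f x) a.

Section HomSpace.
Variables M N : fdmod.

Definition hom_defect (a : A) (f : 'Hom(M, N)) : 'Hom(M, N) :=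
  ((f \o ract M a) - (ract N a \o f))%VF.

Lemma hom_defect_is_linear a : linear (hom_defect a).
Proof.
move=> k f g; apply/lfunP => x; rewrite /hom_defect.
rewrite !lfE linearP.
by rewrite scalerBr opprD addrACA.
Qed.
HB.instance Definition _ a :=
  GRing.isLinear.Build K _ _ _ (hom_defect a) (hom_defect_is_linear a).

(* [Hom_A(M, N)] as a subspace of [Hom_K(M, N)]; see [modhomP]. *)
Definition modhom : {vspace 'Hom(M, N)} :=
  (\bigcap_(i < \dim {: A}) lker (linfun (hom_defect (vbasis {: A})`_i)))%VS.

Lemma modhomP f : reflect (is_modhom f) (f \in modhom).
Proof.
apply: (iffP idP) => [|hf].
  rewrite memvE => /subv_bigcapP h x a.
  have [_ lM _ _] := actP M; have [_ lN _ _] := actP N.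
  pose LM : {linear A -> M} :=
    HB.pack (act x) (GRing.isLinear.Build _ _ _ _ _ (lM x)).
  pose LN : {linear A -> N} :=
    HB.pack (act (f x)) (GRing.isLinear.Build _ _ _ _ _ (lN (f x))).
  rewrite -[act x a]/(LM a) -[RHS]/(LN a) (coord_vbasis (memvf a)).
  rewrite !linear_sum; apply: eq_bigr => i _; rewrite !linearZ /=.
  congr (_ *: _); have := h i isT; rewrite -memvE memv_ker lfunE /=.
  move=> /eqP/lfunP/(_ x); rewrite /hom_defect !lfE.
  by rewrite !ractE => /eqP; rewrite subr_eq0 => /eqP.
rewrite memvE; apply/subv_bigcapP => i _; rewrite -memvE memv_ker lfunE /=.
apply/eqP/lfunP => x; rewrite /hom_defect !lfE.
by rewrite !ractE hf subrr.
Qed.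

End HomSpace.

Definition is_projective (P : fdmod) : Prop :=
  forall (M N : fdmod) (g : 'Hom(M, N)) (f : 'Hom(P, N)),
    is_modhom g -> limg g = fullv -> is_modhom f ->
    exists2 h : 'Hom(P, M), is_modhom h & (g \o h)%VF = f.

Definition is_dsum_mod (E P Q : fdmod) : Prop :=
  exists (i1 : 'Hom(P, E)) (i2 : 'Hom(Q, E)) (p1 : 'Hom(E, P)) (p2 : 'Hom(E, Q)),
    [/\ is_modhom i1, is_modhom i2, is_modhom p1 & is_modhom p2] /\
    [/\ (p1 \o i1 = \1)%VF, (p2 \o i2 = \1)%VF, (p1 \o i2)%VF = 0,
        (p2 \o i1)%VF = 0 & ((i1 \o p1) + (i2 \o p2) = \1)%VF].

(** ** Submodules and factor modules *)

Definition is_submod (M : fdmod) (W : {vspace M}) : Prop :=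
  forall x a, x \in W -> act x a \in W.

Section SubQuot.
Variables (M : fdmod) (W : {vspace M}) (stW : is_submod W).

Definition sub_act (x : subvs_of W) (a : A) : subvs_of W :=
  vsproj W (act (vsval x) a).

Lemma sub_actE x a : vsval (sub_act x a) = act (vsval x) a.
Proof. by rewrite vsprojK // stW // subvsP. Qed.

Lemma sub_actP : is_right_action sub_act.
Proof.
have [l1 l2 h1 h2] := actP M; split.
- by move=> a k x y; apply: subvs_inj; rewrite linearP /= !sub_actE linearP l1.
- by move=> x k a b; apply: subvs_inj; rewrite linearP /= !sub_actE l2.
- by move=> x; apply: subvs_inj; rewrite sub_actE h1.
- by move=> x a b; apply: subvs_inj; rewrite !sub_actE h2.
Qed.

Definition sub_mod : fdmod := FdMod sub_actP.

(* The factor module [M / W] is realised on a complement [W^C] of [W] in [M],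
   the projection [M -> M / W] being the one along [W]. *)
Definition quot_proj (x : M) : subvs_of (W^C)%VS :=
  vsproj (W^C)%VS (daddv_pi (W^C)%VS W x).

Lemma quot_proj_is_linear : linear quot_proj.
Proof. by move=> k x y; rewrite /quot_proj !linearP. Qed.
HB.instance Definition _ :=
  GRing.isLinear.Build K _ _ _ quot_proj quot_proj_is_linear.

Let capWC : (W^C :&: W = 0)%VS. Proof. by rewrite capvC capv_compl. Qed.
Let capWW : (W :&: W^C = 0)%VS. Proof. exact: capv_compl. Qed.

Lemma quot_projE x : vsval (quot_proj x) = daddv_pi (W^C)%VS W x.
Proof. by rewrite vsprojK // memv_pi. Qed.

Lemma quot_projB x : x - vsval (quot_proj x) \in W.
Proof.
rewrite quot_projE.
have xWW : x \in (W^C + W)%VS by rewrite addvC addv_complf memvf.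
by rewrite -[X in X - _](daddv_pi_add capWC xWW) addrC addKr memv_pi.
Qed.

Lemma quot_proj_eq0 x : (quot_proj x == 0) = (x \in W).
Proof.
apply/eqP/idP => [h|xW]; first by have := quot_projB x; rewrite h subr0.
have := quot_projB x; have := subvsP (quot_proj x); set y := vsval _ => yC xyW.
have : y \in (W :&: W^C)%VS.
  by rewrite memv_cap yC andbT -[y](subKr x) rpredB.
by rewrite capWW memv0 => /eqP y0; apply: subvs_inj; rewrite -/y y0.
Qed.

Lemma quot_projK (x : subvs_of (W^C)%VS) : quot_proj (vsval x) = x.
Proof.
apply: subvs_inj; have := quot_projB (vsval x).
set y := quot_proj _ => h; apply/eqP; rewrite eq_sym -subr_eq0 -memv0 -capWW.
by rewrite memv_cap h -linearB subvsP.
Qed.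

Definition quot_act (x : subvs_of (W^C)%VS) (a : A) : subvs_of (W^C)%VS :=
  quot_proj (act (vsval x) a).

Lemma quot_act_proj x a : quot_act (quot_proj x) a = quot_proj (act x a).
Proof.
apply/eqP; rewrite -subr_eq0 -linearB quot_proj_eq0 -2!ractE.
rewrite -linearB [X in X \in _]ractE; apply: stW.
by rewrite -opprB rpredN quot_projB.
Qed.

Lemma quot_actP : is_right_action quot_act.
Proof.
have [l1 l2 h1 h2] := actP M; split.
- by move=> a k x y; rewrite /quot_act linearP l1 linearP.
- by move=> x k a b; rewrite /quot_act l2 linearP.
- by move=> x; rewrite /quot_act h1 quot_projK.
- by move=> x a b; rewrite {1}/quot_act h2 -quot_act_proj.
Qed.

Definition quot_mod : fdmod := FdMod quot_actP.

End SubQuot.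

(** ** The Nakayama functor [nu = D Hom_A(-, A)] on modules *)

Lemma reg_actP : is_right_action (fun x a : A => x * a).
Proof.
split; [| |exact: mulr1|exact: mulrA] => [a|x] k u v /=.
- by rewrite mulrDl scalerAl.
- by rewrite mulrDr scalerAr.
Qed.
Definition reg_mod : fdmod := FdMod reg_actP.

Section Nakayama.
Variable P : fdmod.

Let H := modhom P reg_mod.

(* the left action of [A] on [Hom_A(P, A)] *)
Definition dual_lact (a : A) (f : subvs_of H) : subvs_of H :=
  vsproj H (amull a \o vsval f)%VF.

Lemma dual_lactE a f x : vsval (dual_lact a f) x = a * vsval f x.
Proof.
rewrite vsprojK ?lfE ?lfunE //.
apply/modhomP => y b; rewrite !lfE !lfunE /=.
by have /modhomP -> := subvsP f; rewrite /= mulrA.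
Qed.

Lemma dual_lact_is_linear a : linear (dual_lact a).
Proof.
move=> k f g; apply: subvs_inj; apply/lfunP => x.
by rewrite linearP !lfE !dual_lactE linearP !lfE mulrDr scalerAr.
Qed.
HB.instance Definition _ a :=
  GRing.isLinear.Build K _ _ _ (dual_lact a) (dual_lact_is_linear a).

Definition nu_act (phi : 'Hom(subvs_of H, K^o)) (a : A) : 'Hom(subvs_of H, K^o) :=
  (phi \o linfun (dual_lact a))%VF.

Lemma nu_actE phi a f : nu_act phi a f = phi (dual_lact a f).
Proof. by rewrite lfunE /= lfunE. Qed.

Lemma nu_actP : is_right_action nu_act.
Proof.
split.
- by move=> a k f g; apply/lfunP => x; rewrite !(lfE, nu_actE).
- move=> phi k a b; apply/lfunP => f; rewrite !(lfE, nu_actE).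
  rewrite -linearP; congr (phi _); apply: subvs_inj; apply/lfunP => x.
  by rewrite linearP /= !lfE !lfunE /= !dual_lactE mulrDl scalerAl.
- move=> phi; apply/lfunP => f; rewrite nu_actE; congr (phi _).
  by apply: subvs_inj; apply/lfunP => x; rewrite dual_lactE mul1r.
- move=> phi a b; apply/lfunP => f; rewrite !nu_actE; congr (phi _).
  by apply: subvs_inj; apply/lfunP => x; rewrite !dual_lactE mulrA.
Qed.

Definition nu_mod : fdmod := FdMod nu_actP.

End Nakayama.

Definition dual_map (P Q : fdmod) (f : 'Hom(P, Q))
    (e : subvs_of (modhom Q reg_mod)) : subvs_of (modhom P reg_mod) :=
  vsproj (modhom P reg_mod) (vsval e \o f)%VF.

Lemma dual_map_is_linear (P Q : fdmod) (f : 'Hom(P, Q)) : linear (dual_map f).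
Proof.
move=> k e e'; rewrite /dual_map.
suff -> : (vsval (k *: e + e') \o f = k *: (vsval e \o f) + (vsval e' \o f))%VF.
  exact: linearP.
by apply/lfunP => x; rewrite !lfE.
Qed.
HB.instance Definition _ (P Q : fdmod) (f : 'Hom(P, Q)) :=
  GRing.isLinear.Build K _ _ _ (dual_map f) (dual_map_is_linear f).

Definition nu_map_fun (P Q : fdmod) (f : 'Hom(P, Q)) (phi : nu_mod P) : nu_mod Q :=
  (phi \o linfun (dual_map f))%VF.

Lemma nu_map_fun_is_linear (P Q : fdmod) (f : 'Hom(P, Q)) : linear (nu_map_fun f).
Proof.
by move=> k e e'; apply/lfunP => x; rewrite !lfE.
Qed.
HB.instance Definition _ (P Q : fdmod) (f : 'Hom(P, Q)) :=
  GRing.isLinear.Build K _ _ _ (nu_map_fun f) (nu_map_fun_is_linear f).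

Definition nu_map (P Q : fdmod) (f : 'Hom(P, Q)) : 'Hom(nu_mod P, nu_mod Q) :=
  linfun (nu_map_fun f).

Lemma dual_mapE (P Q : fdmod) (f : 'Hom(P, Q)) e x :
  is_modhom f -> vsval (dual_map f e) x = vsval e (f x).
Proof.
move=> hf; rewrite vsprojK ?lfE //; apply/modhomP => y b; rewrite !lfE hf.
by have /modhomP -> := subvsP e.
Qed.

Lemma nu_mapE (P Q : fdmod) (f : 'Hom(P, Q)) (phi : nu_mod P) e :
  nu_map f phi e = phi (dual_map f e).
Proof. by rewrite lfunE /= comp_lfunE lfunE. Qed.

Lemma nu_map_modhom (P Q : fdmod) (f : 'Hom(P, Q)) :
  is_modhom f -> is_modhom (nu_map f).
Proof.
move=> hf phi a; apply/lfunP => e; rewrite nu_mapE !nu_actE nu_mapE.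
congr (phi _); apply: subvs_inj; apply/lfunP => x.
by rewrite dual_lactE !dual_mapE // dual_lactE.
Qed.

Lemma nu_map0 (P Q : fdmod) : nu_map (0 : 'Hom(P, Q)) = 0.
Proof.
apply/lfunP => phi; apply/lfunP => e; rewrite nu_mapE !lfE.
rewrite [X in phi X](_ : _ = 0) ?linear0 //.
apply: subvs_inj; apply/lfunP => x.
have h0 : is_modhom (0 : 'Hom(P, Q)).
  by move=> y b; rewrite !lfE -ractE linear0.
by rewrite dual_mapE // zero_lfunE !linear0 lfE.
Qed.

Lemma nu_map_comp (P Q S : fdmod) (g : 'Hom(Q, S)) (f : 'Hom(P, Q)) :
  is_modhom g -> is_modhom f -> nu_map (g \o f)%VF = (nu_map g \o nu_map f)%VF.
Proof.
move=> hg hf; apply/lfunP => phi; apply/lfunP => e; rewrite comp_lfunE !nu_mapE.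
congr (phi _); apply: subvs_inj; apply/lfunP => x.
by rewrite !dual_mapE ?comp_lfunE // => y b; rewrite !comp_lfunE hf hg.
Qed.

(** ** Homomorphism spaces and direct sums *)

Definition precomp (P Q M : fdmod) (i : 'Hom(P, Q)) (f : 'Hom(Q, M)) :
  'Hom(P, M) := (f \o i)%VF.

Lemma precomp_is_linear (P Q M : fdmod) (i : 'Hom(P, Q)) :
  linear (@precomp P Q M i).
Proof. by move=> k f g; apply/lfunP => x; rewrite /precomp !lfE. Qed.
HB.instance Definition _ (P Q M : fdmod) (i : 'Hom(P, Q)) :=
  GRing.isLinear.Build K _ _ _ (@precomp P Q M i) (@precomp_is_linear P Q M i).

Lemma modhom_comp (P Q M : fdmod) (g : 'Hom(Q, M)) (f : 'Hom(P, Q)) :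
  is_modhom g -> is_modhom f -> is_modhom (g \o f)%VF.
Proof. by move=> hg hf x a; rewrite !comp_lfunE hf hg. Qed.

Lemma dim_modhom_dsum (E P Q M : fdmod) : is_dsum_mod E P Q ->
  \dim (modhom E M) = (\dim (modhom P M) + \dim (modhom Q M))%N.
Proof.
move=> [i1 [i2 [p1 [p2 [[hi1 hi2 hp1 hp2] [e11 e22 e12 e21 eE]]]]]].
pose F1 := linfun (@precomp P E M i1); pose F2 := linfun (@precomp Q E M i2).
have F1E f : F1 f = (f \o i1)%VF by rewrite lfunE.
have F2E f : F2 f = (f \o i2)%VF by rewrite lfunE.
rewrite -(limg_ker_dim F1 (modhom E M)) addnC; congr (_ + _)%N.
  congr (\dim _); apply/vspaceP => g; apply/memv_imgP/idP => [[f fH ->]|gH].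
    by apply/modhomP; rewrite F1E; apply: modhom_comp => //; apply/modhomP.
  exists (g \o p1)%VF; last by rewrite F1E -comp_lfunA e11 comp_lfun1r.
  by apply/modhomP/modhom_comp => //; apply/modhomP.
rewrite -(@limg_dim_eq _ _ _ F2).
  congr (\dim _); apply/vspaceP => g; apply/memv_imgP/idP => [[f fH ->]|gH].
    apply/modhomP; rewrite F2E; apply: modhom_comp => //; apply/modhomP.
    by move: fH; rewrite memv_cap => /andP[].
  exists (g \o p2)%VF; last by rewrite F2E -comp_lfunA e22 comp_lfun1r.
  rewrite memv_cap memv_ker F1E -comp_lfunA e21 comp_lfun0r eqxx andbT.
  by apply/modhomP/modhom_comp => //; apply/modhomP.
apply/eqP; rewrite -subv0; apply/subvP => f; rewrite !memv_cap !memv_ker memv0.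
rewrite F1E F2E => /andP[/andP[_ /eqP f1] /eqP f2].
by rewrite -[f]comp_lfun1r -eE comp_lfunDr !comp_lfunA f1 f2 !comp_lfun0l addr0.
Qed.

(** ** Modules with underlying space [K^n] *)

(* Every module is isomorphic to one on a space of row vectors.  The latter form
   a small type; [fdmod A] is too large a type to generate a vector space. *)
Section Coord.
Variable M : fdmod.

Let e := vbasis {: M}.
Let eP : basis_of {: M} e. Proof. exact: vbasisP. Qed.

Definition coord_act (x : 'rV[K]_(\dim {: M})) (a : A) : 'rV[K]_(\dim {: M}) :=
  rVof e (act (vecof e x) a).

Lemma coord_actP : is_right_action coord_act.
Proof.
have [l1 l2 h1 h2] := actP M; split.
- by move=> a k x y; rewrite /coord_act linearP l1 linearP.
- by move=> x k a b; rewrite /coord_act l2 linearP.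
- by move=> x; rewrite /coord_act h1 vecofK.
- by move=> x a b; rewrite /coord_act rVofK // h2.
Qed.

Definition coord_mod : fdmod := FdMod coord_actP.

Definition to_coord : 'Hom(M, coord_mod) := linfun (rVof e).
Definition of_coord : 'Hom(coord_mod, M) := linfun (vecof e).

Lemma to_coordK : (of_coord \o to_coord = \1)%VF.
Proof. by apply/lfunP => x; rewrite !lfE !lfunE /= rVofK. Qed.

Lemma of_coordK : (to_coord \o of_coord = \1)%VF.
Proof. by apply/lfunP => x; rewrite !lfE !lfunE /= vecofK. Qed.

Lemma to_coord_modhom : is_modhom to_coord.
Proof. by move=> x a; rewrite !lfunE /= /coord_act rVofK. Qed.

Lemma of_coord_modhom : is_modhom of_coord.
Proof. by move=> x a; rewrite !lfunE /= /coord_act rVofK. Qed.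

Lemma coord_projective : is_projective M -> is_projective coord_mod.
Proof.
move=> pM X Y g f hg sg hf.
have [h hh gh] := pM X Y g (f \o to_coord)%VF hg sg
  (modhom_comp hf to_coord_modhom).
exists (h \o of_coord)%VF; first exact: modhom_comp hh of_coord_modhom.
by rewrite comp_lfunA gh -comp_lfunA of_coordK comp_lfun1r.
Qed.

Lemma dim_modhom_coord (X : fdmod) :
  \dim (modhom coord_mod X) = \dim (modhom M X).
Proof.
pose F := linfun (@precomp M coord_mod X to_coord).
rewrite -(@limg_dim_eq _ _ _ F).
  congr (\dim _); apply/vspaceP => g; apply/memv_imgP/idP => [[f fH ->]|gH].
    apply/modhomP; rewrite lfunE; apply: modhom_comp => //; first exact/modhomP.
    exact: to_coord_modhom.
  exists (g \o of_coord)%VF.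
    by apply/modhomP/modhom_comp; [apply/modhomP | apply: of_coord_modhom].
  by rewrite lfunE /= /precomp -comp_lfunA to_coordK comp_lfun1r.
apply/eqP; rewrite -subv0; apply/subvP => f; rewrite memv_cap memv_ker memv0.
rewrite lfunE => /andP[_ /eqP f1].
by rewrite -[f]comp_lfun1r -of_coordK comp_lfunA [(f \o _)%VF]f1 comp_lfun0l.
Qed.

End Coord.

Record coord_proj := CoordProj {
  cp_dim : nat;
  cp_act : 'rV[K]_cp_dim -> A -> 'rV[K]_cp_dim;
  cp_actP : is_right_action cp_act;
  cp_projective : is_projective (FdMod cp_actP)
}.

Definition cp_mod (P : coord_proj) : fdmod := FdMod (cp_actP P).

Definition to_coord_proj (P : fdmod) (hP : is_projective P) : coord_proj :=
  @CoordProj _ _ (coord_actP P) (coord_projective hP).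

End Modules.

HB.instance Definition _ (K : fieldType) (A : falgType K) :=
  gen_eqMixin (coord_proj A).
HB.instance Definition _ (K : fieldType) (A : falgType K) :=
  gen_choiceMixin (coord_proj A).

(** * The real Grothendieck group of projective modules *)

Section LinearSpan.
Variables (R : realType) (V : lmodType R).

Definition lspan (S : set V) : set V :=
  [set v | exists s : seq (R * V),
     (forall p, p \in s -> S p.2) /\ v = \sum_(p <- s) p.1 *: p.2].

Lemma lspan_sub (S : set V) v : S v -> lspan S v.
Proof.
move=> Sv; exists [:: (1, v)]; rewrite big_seq1 scale1r.
by split => // p /[!inE] /eqP ->.
Qed.

Lemma lspan_submod (S : set V) : submod_closed [pred v | `[< lspan S v >]].
Proof.
split; first by apply/asboolP; exists [::]; rewrite big_nil.
move=> k u v /asboolP[s [sS ->]] /asboolP[t [tS ->]]; apply/asboolP.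
exists ([seq (k * p.1, p.2) | p <- s] ++ t); split.
  by move=> p; rewrite mem_cat => /orP[/mapP[q qs ->]|]; [exact: (sS q)|exact: tS].
rewrite big_cat big_map scaler_sumr /=; congr (_ + _).
by apply: eq_bigr => p _; rewrite scalerA.
Qed.

End LinearSpan.

Section K0.
Local Open Scope quotient_scope.
Variables (R : realType) (K : fieldType) (A : falgType K).

Local Notation free := {freeg (coord_proj A) / R}.

Definition K0_relation : set free :=
  [set r | exists E P Q : coord_proj A, is_dsum_mod (cp_mod E) (cp_mod P) (cp_mod Q)
     /\ r = << E >> - << P >> - << Q >>].

Definition K0_null : {pred free} := fun v => `[< lspan K0_relation v >].

HB.instance Definition _ :=
  GRing.isSubmodClosed.Build R free K0_null (lspan_submod K0_relation).

(* [K_0(proj A)] tensored with the reals: the real vector space generated by the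
   projective modules, modulo [E] = [P] + [Q] for E isomorphic to the direct sum
   of P and Q. *)
Definition K0R : Type := Quotient.quot (K0_null : zmodClosed free).
HB.instance Definition _ := GRing.Zmodule.on K0R.
HB.instance Definition _ := Quotient.on K0R.


Lemma K0_eqP (v w : free) :
  reflect (\pi_K0R v = \pi_K0R w) (v - w \in (K0_null : zmodClosed _)).
Proof. by rewrite Quotient.idealrBE; apply: eqP. Qed.

Definition K0_scale (c : R) (x : K0R) : K0R := \pi_K0R (c *: repr x).

Lemma pi_K0_scale c v : K0_scale c (\pi_K0R v) = \pi_K0R (c *: v).
Proof.
apply/K0_eqP; rewrite -scalerBr rpredZ //.
by apply/K0_eqP; rewrite reprK.
Qed.

Lemma pi_K0D v w : \pi_K0R (v + w) = \pi_K0R v + \pi_K0R w.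
Proof. exact: raddfD. Qed.

Fact K0_scaleA c d x : K0_scale c (K0_scale d x) = K0_scale (c * d) x.
Proof. by rewrite -[x]reprK !pi_K0_scale scalerA reprK. Qed.
Fact K0_scale1 x : K0_scale 1 x = x.
Proof. by rewrite -[x]reprK pi_K0_scale scale1r. Qed.
Fact K0_scaleDr c x y : K0_scale c (x + y) = K0_scale c x + K0_scale c y.
Proof.
by rewrite -[x]reprK -[y]reprK -pi_K0D !pi_K0_scale scalerDr pi_K0D.
Qed.
Fact K0_scaleDl x c d : K0_scale (c + d) x = K0_scale c x + K0_scale d x.
Proof. by rewrite -[x]reprK !pi_K0_scale scalerDl pi_K0D. Qed.
HB.instance Definition _ := GRing.Zmodule_isLmodule.Build R K0R
  K0_scaleA K0_scale1 K0_scaleDr K0_scaleDl.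

Definition K0_class (P : fdmod A) (hP : is_projective P) : K0R :=
  \pi_K0R << to_coord_proj hP >>.

(** ** The Euler form *)

Definition hom_dim (M : fdmod A) (P : coord_proj A) : R^o :=
  (\dim (modhom (cp_mod P) M))%:R.

Definition euler_free (M : fdmod A) (v : free) : R^o := fglift (hom_dim M) v.

Lemma euler_free_is_linear M : linear (euler_free M).
Proof.
pose F : {additive free -> R^o} := HB.pack (fglift (hom_dim M))
  (GRing.isZmodMorphism.Build _ _ _ (lift_is_additive (hom_dim M))).
have FZ c v : F (c *: v) = c *: F v.
  rewrite -[in RHS](freeg_sumE v) [_ *: v]/(fgscale c v) /fgscale.
  rewrite (raddf_sum F) (raddf_sum F) scaler_sumr; apply: eq_bigr => x _. 
  by rewrite /F /= !liftU scalerA.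
move=> c v w; rewrite -[LHS]/(F (c *: v + w)) raddfD FZ //.
Qed.
HB.instance Definition _ M :=
  GRing.isLinear.Build R free R^o _ (euler_free M) (euler_free_is_linear M).

Lemma euler_free_null M v : v \in K0_null -> euler_free M v = 0.
Proof.
move=> /asboolP[s [sR ->]]; rewrite linear_sum big_seq big1 // => p ps.
rewrite linearZ /=; have [E [P [Q [hE ->]]]] := sR p ps.
rewrite !linearB /= /euler_free !liftU !scale1r /hom_dim (dim_modhom_dsum M hE).
by rewrite natrD scalerDr -addrA -opprD subrr.
Qed.

(* [euler theta M] is the value <theta, [M]> of the Euler form; it is the linear
   form in [theta] determined by [euler_class]. *)
Definition euler (theta : K0R) (M : fdmod A) : R := euler_free M (repr theta).

Lemma euler_pi M v : euler (\pi_K0R v) M = euler_free M v.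
Proof.
apply/eqP; rewrite -subr_eq0 -linearB; apply/eqP/euler_free_null.
by apply/K0_eqP; rewrite reprK.
Qed.

Lemma euler_class M P (hP : is_projective P) :
  euler (K0_class hP) M = (\dim (modhom P M))%:R.
Proof. by rewrite euler_pi /euler_free liftU scale1r /hom_dim dim_modhom_coord. Qed.

Lemma euler_is_linear M : linear (euler ^~ M : K0R -> R^o).
Proof.
move=> c x y; rewrite -[x]reprK -[y]reprK.
by rewrite -[c *: _]/(K0_scale c _) pi_K0_scale -pi_K0D !euler_pi linearP.
Qed.

Lemma K0_class_dsum (E P Q : fdmod A) (hE : is_projective E)
    (hP : is_projective P) (hQ : is_projective Q) :
  is_dsum_mod E P Q -> K0_class hE = K0_class hP + K0_class hQ.
Proof.
move=> [i1 [i2 [p1 [p2 [[hi1 hi2 hp1 hp2] [e11 e22 e12 e21 eE]]]]]].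
rewrite -pi_K0D; apply/K0_eqP/asboolP/lspan_sub.
exists (to_coord_proj hE), (to_coord_proj hP), (to_coord_proj hQ).
split; last by rewrite opprD addrA.
have tm M := to_coord_modhom (M := M); have om M := of_coord_modhom (M := M).
exists (to_coord E \o i1 \o of_coord P)%VF, (to_coord E \o i2 \o of_coord Q)%VF.
exists (to_coord P \o p1 \o of_coord E)%VF, (to_coord Q \o p2 \o of_coord E)%VF.
split.
  by split; apply: modhom_comp (om _ _ _); apply: modhom_comp (tm _ _ _) _.
have cut (X Y Z : fdmod A) (f : 'Hom(Y, Z)) (g : 'Hom(X, Y)) :
    ((to_coord Z \o f \o of_coord Y) \o (to_coord Y \o g \o of_coord X) =
     to_coord Z \o (f \o g) \o of_coord X)%VF.
  by rewrite !comp_lfunA -(comp_lfunA _ (of_coord Y)) to_coordK comp_lfun1r.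
rewrite !cut e11 e22 e12 e21; split.
- by rewrite comp_lfun1r of_coordK.
- by rewrite comp_lfun1r of_coordK.
- by rewrite comp_lfun0r comp_lfun0l.
- by rewrite comp_lfun0r comp_lfun0l.
- by rewrite -comp_lfunDl -comp_lfunDr eE comp_lfun1r of_coordK.
Qed.

Lemma K0_class_zero (P : fdmod A) (hP : is_projective P) :
  is_zero_mod P -> K0_class hP = 0.
Proof.
move=> P0; have z (f g : 'Hom(P, P)) : f = g.
  apply/lfunP => x; have : x \in fullv by exact: memvf.
  have /eqP -> : {: P}%VS == 0%VS by rewrite -dimv_eq0 P0.
  by rewrite memv0 => /eqP ->; rewrite !linear0.
apply: (addrI (K0_class hP)); rewrite addr0 -(K0_class_dsum hP hP hP) //.
exists \1%VF, \1%VF, \1%VF, \1%VF; split.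
  by split=> x a; rewrite !id_lfunE.
by split; apply: z.
Qed.

End K0.

(** * Complexes *)

Section Complexes.
Variables (K : fieldType) (A : falgType K).

(* Cochain complexes.  The differential is given between any two degrees and
   vanishes outside (i, i+1), so that no equality of degrees occurs in types. *)
Record cplx := Cplx {
  cobj :> int -> fdmod A;
  cdiff : forall i j, 'Hom(cobj i, cobj j);
  cdiff_modhom : forall i j, is_modhom (cdiff i j);
  cdiff_shape : forall i j, j != i + 1 -> cdiff i j = 0;
  cdiff_comp : forall i j k, (cdiff j k \o cdiff i j)%VF = 0
}.

Section Shift.
Variables (X : cplx) (l : int).

Definition shift_diff (i j : int) : 'Hom(X (i + l), X (j + l)) :=
  (-1) ^+ `|l|%N *: cdiff X (i + l) (j + l).

Lemma shift_diff_modhom i j : is_modhom (shift_diff i j).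
Proof.
move=> x a; rewrite !lfE cdiff_modhom.
by rewrite -!ractE linearZ.
Qed.

Lemma shift_diff_shape i j : j != i + 1 -> shift_diff i j = 0.
Proof.
move=> ij; rewrite /shift_diff cdiff_shape ?scaler0 //.
by rewrite addrAC (inj_eq (addIr l)).
Qed.

Lemma shift_diff_comp i j k : (shift_diff j k \o shift_diff i j)%VF = 0.
Proof.
by rewrite /shift_diff -comp_lfunZl -comp_lfunZr cdiff_comp !scaler0.
Qed.

(* the complex [X[l]] *)
Definition shift : cplx :=
  Cplx shift_diff_modhom shift_diff_shape shift_diff_comp.

End Shift.

Definition grmap (X Y : cplx) := forall i, 'Hom(X i, Y i).

Definition is_chain_map (X Y : cplx) (f : grmap X Y) : Prop :=
  (forall i, is_modhom (f i)) /\
  (forall i j, (f j \o cdiff X i j = cdiff Y i j \o f i)%VF).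

Definition homotopic (X Y : cplx) (f g : grmap X Y) : Prop :=
  exists2 s : forall i j, 'Hom(X i, Y j),
    forall i j, is_modhom (s i j) &
    forall i, f i - g i = ((cdiff Y (i - 1) i \o s i (i - 1)%R) +
                           (s (i + 1)%R i \o cdiff X i (i + 1)))%VF.

Definition gr0 (X Y : cplx) : grmap X Y := fun i => 0.
Definition gr1 (X : cplx) : grmap X X := fun i => \1%VF.
Definition grcomp (X Y Z : cplx) (g : grmap Y Z) (f : grmap X Y) : grmap X Z :=
  fun i => (g i \o f i)%VF.
Definition grsum (m : nat) (X Y : cplx) (f : 'I_m -> grmap X Y) : grmap X Y :=
  fun i => \sum_(k < m) f k i.

(* vanishing of [Hom(X, Y)] in the homotopy category *)
Definition Khom_zero (X Y : cplx) : Prop :=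
  forall f : grmap X Y, is_chain_map f -> homotopic f (gr0 X Y).

Definition Kzero (X : cplx) : Prop := homotopic (gr1 X) (gr0 X X).

Definition Kiso (X Y : cplx) : Prop :=
  exists (f : grmap X Y) (g : grmap Y X),
    [/\ is_chain_map f, is_chain_map g, homotopic (grcomp g f) (gr1 X) &
        homotopic (grcomp f g) (gr1 Y)].

(* [X] is the direct sum of the [Y k] in the homotopy category. *)
Definition Kdsum (m : nat) (X : cplx) (Y : 'I_m -> cplx) : Prop :=
  exists (iota : forall k, grmap (Y k) X) (pi : forall k, grmap X (Y k)),
    [/\ forall k, is_chain_map (iota k), forall k, is_chain_map (pi k),
        forall k, homotopic (grcomp (pi k) (iota k)) (gr1 (Y k)),
        forall k l, k != l -> homotopic (grcomp (pi l) (iota k)) (gr0 (Y k) (Y l)) &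
        homotopic (grsum (fun k => grcomp (iota k) (pi k))) (gr1 X)].

(** ** Cohomology *)

Section Cohomology.
Variables (X : cplx) (i : int).

Lemma cycles_submod : is_submod (lker (cdiff X i (i + 1))).
Proof.
move=> x a; rewrite !memv_ker cdiff_modhom => /eqP ->.
by rewrite -ractE linear0.
Qed.

Definition cycles : fdmod A := sub_mod cycles_submod.

Definition boundaries : {vspace cycles} :=
  (linfun (vsval : cycles -> X i) @^-1: limg (cdiff X (i - 1) i))%VS.

Lemma boundariesE (x : cycles) :
  (x \in boundaries) = (vsval x \in limg (cdiff X (i - 1) i)).
Proof. by rewrite -memv_preim lfunE. Qed.

Lemma boundaries_submod : is_submod boundaries.
Proof.
move=> x a; rewrite !boundariesE sub_actE; last exact: cycles_submod.
move=> /memv_imgP[y _ ->]; rewrite -cdiff_modhom; apply: memv_img.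
exact: memvf.
Qed.

Definition cohomology : fdmod A := quot_mod boundaries_submod.

End Cohomology.

Section NuComplex.
Variable X : cplx.

Lemma nu_cplx_modhom i j : is_modhom (nu_map (cdiff X i j)).
Proof. exact/nu_map_modhom/cdiff_modhom. Qed.

Lemma nu_cplx_shape i j : j != i + 1 -> nu_map (cdiff X i j) = 0.
Proof. by move=> ij; rewrite cdiff_shape // nu_map0. Qed.

Lemma nu_cplx_comp i j k :
  (nu_map (cdiff X j k) \o nu_map (cdiff X i j))%VF = 0.
Proof.
rewrite -nu_map_comp ?cdiff_comp ?nu_map0 //; exact: cdiff_modhom.
Qed.

Definition nu_cplx : cplx :=
  @Cplx (fun i => nu_mod (X i)) _ nu_cplx_modhom nu_cplx_shape nu_cplx_comp.

End NuComplex.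

(** ** Bounded complexes of projective modules *)

Record Kbproj := KbProj {
  kb_cplx :> cplx;
  kb_projective : forall i, is_projective (kb_cplx i);
  kb_bounded : exists n : nat, forall i, (n < `|i|)%N -> is_zero_mod (kb_cplx i)
}.

Definition two_term (U : Kbproj) : Prop :=
  exists2 T : Kbproj, Kiso U T &
    forall i : int, i != -1 -> i != 0 -> is_zero_mod (T i).

Definition presilting (U : Kbproj) : Prop :=
  forall l : int, 1 <= l -> Khom_zero U (shift U l).

Definition indecomposable (X : Kbproj) : Prop :=
  ~ Kzero X /\
  forall Y : 'I_2 -> Kbproj, Kdsum X Y -> exists k, Kzero (Y k).

Definition is_decomposition (U : Kbproj) (m : nat) (Us : 'I_m -> Kbproj) : Prop :=
  Kdsum U Us /\ forall k, indecomposable (Us k).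

Definition basic (U : Kbproj) : Prop :=
  forall (m : nat) (Us : 'I_m -> Kbproj), is_decomposition U Us ->
    forall k l, Kiso (Us k) (Us l) -> k = l.

Definition two_psilt (U : Kbproj) : Prop :=
  [/\ two_term U, presilting U & basic U].

End Complexes.

Arguments kb_projective {K A} U i : rename.

(** * Cones in [K_0(proj A)_R] *)

Section Cones.
Variables (R : realType) (K : fieldType) (A : falgType K).
Local Notation K0 := (K0R R A).

Definition Kb_class (U : Kbproj A) : K0 :=
  \sum_(i \in [set: int]) (-1) ^+ `|i|%N *: K0_class R (kb_projective U i).

(* The support of the sum defining [Kb_class] is finite. *)
Lemma Kb_class_finite (U : Kbproj A) :
  finite_set [set i : int | (-1) ^+ `|i|%N *: K0_class R (kb_projective U i) != 0].
Proof.
have [n nU] := kb_bounded U.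
pose s := [seq k%:Z | k <- iota 0 n.+1] ++ [seq - k%:Z | k <- iota 0 n.+1].
apply: (sub_finite_set _ (finite_seq s)) => i /= nz.
have : (`|i| <= n)%N.
  rewrite leqNgt; apply/negP => /nU Ui0; move/eqP: nz; apply.
  by rewrite K0_class_zero ?scaler0.
move=> ilen; rewrite mem_cat; apply/orP.
have [i0|i0] := leP 0 i; [left|right]; apply/mapP; exists `|i|%N.
- by rewrite mem_iota add0n ltnS.
- by rewrite gez0_abs.
- by rewrite mem_iota add0n ltnS.
- by rewrite ltz0_abs // opprK.
Qed.

Definition in_Tbar (theta : K0) (M : fdmod A) : Prop :=
  forall (W : {vspace M}) (stW : is_submod W), 0 <= euler theta (quot_mod stW).

Definition in_Fbar (theta : K0) (M : fdmod A) : Prop :=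
  forall (W : {vspace M}) (stW : is_submod W), euler theta (sub_mod stW) <= 0.

Definition coneD (U : Kbproj A) : set K0 :=
  [set theta | in_Tbar theta (cohomology U 0) /\
               in_Fbar theta (cohomology (nu_cplx U) (-1))].

Definition coneC (m : nat) (Us : 'I_m -> Kbproj A) : set K0 :=
  [set theta | exists2 c : 'I_m -> R, forall k, 0 <= c k &
     theta = \sum_(k < m) c k *: Kb_class (Us k)].

End Cones.

Arguments coneD R {K A} U _ : rename.
Arguments coneC R {K A m} Us _ : rename.

Section PiecewiseLinear.
Variables (R : realType) (V W : lmodType R).

Definition polyhedral_cone (S : set V) : Prop :=
  exists (n : nat) (phi : 'I_n -> {linear V -> R^o}),
    S = [set x | forall k, 0 <= phi k x].

(* [D] is covered by finitely many polyhedral cones on each of which [f] is the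
   restriction of a linear map. *)
Definition piecewise_linear (D : set V) (f : {x | D x} -> W) : Prop :=
  exists (n : nat) (S : 'I_n -> set V) (L : 'I_n -> {linear V -> W}),
    [/\ forall k, polyhedral_cone (S k), D = \bigcup_(k in [set: 'I_n]) S k &
        forall k (x : {x | D x}), S k (sval x) -> f x = L k (sval x)].

Definition set_add (X Y : set V) : set V := [set x + y | x in X & y in Y].
Definition set_opp (X : set V) : set V := [set - x | x in X].

End PiecewiseLinear.

(* Main.v *)
From HB Require Import structures.
From mathcomp Require Import all_boot all_order all_algebra all_field.
From mathcomp Require Import all_classical all_reals.
From mathcomp.multinomials Require Import freeg.
From mathcomp Require Import zify.
Require Import Defs.

Set Implicit Arguments.
Unset Strict Implicit.
Unset Printing Implicit Defensive.

Import Order.TTheory GRing.Theory Num.Theory.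
Local Open Scope classical_set_scope.
Local Open Scope ring_scope.

(** Write [M] for H^0(U) and [N] for H^-1(nu U), let [d_k : P1_k -> P0_k] be a
    model of the summand U_k concentrated in degrees -1 and 0, and put
    g_k(X) = <[U_k], X> = dim Hom(U_k, X) - dim Hom(U_k, X[1]).

    By definition D(U) is cut out by the forms theta |-> theta(X), for X a factor
    module of [M], and theta |-> - theta(Y), for Y a submodule of [N].  Only
    finitely many different forms occur ([finite_factors], [finite_subobjects]).
    As U is presilting, Hom(U_k, X[1]) = 0 for the factors X of [M]; dually,
    through the isomorphism of Hom(Y, nu P) with the dual of Hom(P, Y), one has
    Hom(U_k, Y) = 0 for the submodules Y of [N].  Hence all these forms are
    nonnegative on every [U_k].

    The point is that D(U) is already cut out by those of the forms that are
    positive on at most one [U_k] ([dissection]).  In terms of t-structures: X and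
    Y[1] lie in the heart of a silting completion of U, where U_k gives a projective
    object with simple top L_k and g_k counts the composition factors L_k, weighted
    by dim End(L_k); one decomposes X and Y[1] into pieces with only one of the L_k.
    The argument can be carried out with modules.  A nonzero map U_k -> X either splits the
    class of X into smaller classes of the same kind, or every other map
    U_l -> X factors through it.  If this second case occurs for two indices k and
    l, the two maps factor through each other, and so a nonzero map is fixed by an
    endomorphism of U_k that passes through U_l.  Such an endomorphism is nilpotent
    up to homotopy, because U_k and U_l are indecomposable and not isomorphic
    ([indecomposable_radical]); this is a contradiction.  So if X cannot be split,
    then g_k(X) is nonzero for at most one k.

    Once the inequalities are decoupled, the rest is elementary
    ([decoupled_cone_retractions]).  For theta in D(U), the vector
    theta - sum_k c_k [U_k] is in D(U) if and only if c_k <= lambda_k(theta) for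
    all k, where lambda_k(theta) is the minimum of l(theta) / l([U_k]) over the
    decoupled forms l that are positive on [U_k].  Such forms exist for each k
    ([presilting_summand_seen]).  So lambda_U(theta) = sum_k lambda_k(theta) [U_k]
    and lambda'_U(theta) = theta - lambda_U(theta); both are piecewise linear, and
    they are unique since the cone C(U) is pointed. *)

(** * Linear maps *)

Lemma linear_bundle (R : pzRingType) (V W : lmodType R) (f : V -> W) :
  linear f -> exists F : {linear V -> W}, F =1 f.
Proof.
move=> lf; pose F : {linear V -> W} :=
  HB.pack f (GRing.isLinear.Build _ _ _ _ _ lf).
by exists F.
Qed.

Section LinearMaps.
Variables (K : fieldType) (V W : vectType K).

Lemma linear_lfun (f : V -> W) : linear f -> exists g : 'Hom(V, W), g =1 f.
Proof.
move=> lf; pose L : {linear V -> W} :=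
  HB.pack f (GRing.isLinear.Build _ _ _ _ _ lf).
by exists (linfun L) => x; rewrite (lfunE L).
Qed.

Lemma limg_full (f : 'Hom(V, W)) :
  limg f = fullv <-> forall y, exists x, f x = y.
Proof.
split=> [ff y|h].
  have : y \in limg f by rewrite ff memvf.
  by case/memv_imgP=> x _ ->; exists x.
apply/vspaceP => y; rewrite memvf; apply/memv_imgP.
by have [x <-] := h y; exists x; rewrite ?memvf.
Qed.

Lemma mem_limg (f : 'Hom(V, W)) x : f x \in limg f.
Proof. exact/memv_img/memvf. Qed.

Lemma lker_inj (f : 'Hom(V, W)) :
  lker f = 0%VS <-> forall x, f x = 0 -> x = 0.
Proof.
split=> [f0 x fx|h].
  by apply/eqP; rewrite -memv0 -f0 memv_ker fx.
by apply/eqP; rewrite -subv0; apply/subvP => x; rewrite memv_ker memv0 => /eqP/h ->.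
Qed.

End LinearMaps.

Lemma zero_space (K : fieldType) (V : vectType K) :
  \dim {: V} = 0%N -> forall x : V, x = 0.
Proof.
move=> /eqP; rewrite dimv_eq0 => /eqP V0 x.
by apply/eqP; rewrite -memv0 -V0 memvf.
Qed.

(** * Exact sequences of modules *)

Section Exact.
Variables (K : fieldType) (A : falgType K).
Implicit Types (M N X Y Z P : fdmod A).

Lemma modhom0 M N : is_modhom (0 : 'Hom(M, N)).
Proof. by move=> x a; rewrite !zero_lfunE -ractE linear0. Qed.

Lemma modhom1 M : is_modhom (\1%VF : 'Hom(M, M)).
Proof. by move=> x a; rewrite !id_lfunE. Qed.

Lemma modhomD M N (f g : 'Hom(M, N)) :
  is_modhom f -> is_modhom g -> is_modhom (f + g).
Proof. by move=> hf hg; apply/modhomP/memvD; apply/modhomP. Qed.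

Lemma modhomN M N (f : 'Hom(M, N)) : is_modhom f -> is_modhom (- f).
Proof. by move=> hf; apply/modhomP; rewrite memvN; apply/modhomP. Qed.

Lemma modhomB M N (f g : 'Hom(M, N)) :
  is_modhom f -> is_modhom g -> is_modhom (f - g).
Proof. by move=> hf hg; apply: modhomD => //; apply: modhomN. Qed.

Lemma modhom_sum M N I (r : seq I) (P : pred I) (f : I -> 'Hom(M, N)) :
  (forall i, P i -> is_modhom (f i)) -> is_modhom (\sum_(i <- r | P i) f i).
Proof. by move=> hf; apply/modhomP/memv_suml => i Pi; apply/modhomP/hf. Qed.

Lemma act0 M a : act (0 : M) a = 0.
Proof. by rewrite -ractE linear0. Qed.

Lemma lker_submod M N (f : 'Hom(M, N)) : is_modhom f -> is_submod (lker f).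
Proof. by move=> hf x a; rewrite !memv_ker hf => /eqP ->; rewrite act0. Qed.

Lemma limg_submod M N (f : 'Hom(M, N)) : is_modhom f -> is_submod (limg f).
Proof. by move=> hf x a /memv_imgP[y _ ->]; rewrite -hf mem_limg. Qed.

Lemma quot_factor M (W : {vspace M}) (stW : is_submod W) X (g : 'Hom(M, X)) :
  is_modhom g -> (W <= lker g)%VS ->
  exists2 h : 'Hom(quot_mod stW, X), is_modhom h &
    forall x, h (quot_proj W x) = g x.
Proof.
move=> hg gW; have gE x : g (vsval (quot_proj W x)) = g x.
  have := subvP gW _ (quot_projB W x).
  by rewrite memv_ker linearB subr_eq0 => /eqP.
have [h hE] := @linear_lfun _ (quot_mod stW) X (g \o vsval)
  (fun k x y => linearP (g \o vsval) k x y).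
exists h => [x a|x]; last by rewrite hE /= gE.
by rewrite !hE /= gE hg.
Qed.

Lemma quot_projP M (W : {vspace M}) (stW : is_submod W) :
  exists2 p : 'Hom(M, quot_mod stW), is_modhom p & p =1 quot_proj W.
Proof.
exists (linfun (quot_proj W)); last by move=> x; rewrite lfunE.
by move=> x a; rewrite !lfunE /= -quot_act_proj.
Qed.

Lemma sub_inclP M (W : {vspace M}) (stW : is_submod W) :
  exists2 i : 'Hom(sub_mod stW, M), is_modhom i & i =1 vsval.
Proof.
exists (linfun (vsval : sub_mod stW -> M)); last by move=> x; rewrite lfunE.
by move=> x a; rewrite !lfunE /= sub_actE.
Qed.

Lemma sub_factor M (W : {vspace M}) (stW : is_submod W) X (g : 'Hom(X, M)) :
  is_modhom g -> (limg g <= W)%VS ->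
  exists2 h : 'Hom(X, sub_mod stW), is_modhom h & forall x, vsval (h x) = g x.
Proof.
move=> hg gW; exists (linfun (vsproj W \o g)).
  move=> x a; rewrite !lfunE /= hg; apply: subvs_inj; rewrite sub_actE //.
  by rewrite !vsprojK //; [|rewrite -hg]; apply: (subvP gW); rewrite mem_limg.
by move=> x; rewrite lfunE /= vsprojK //; apply: (subvP gW); rewrite mem_limg.
Qed.

Definition short_exact X Y Z (i : 'Hom(X, Y)) (p : 'Hom(Y, Z)) : Prop :=
  [/\ is_modhom i, is_modhom p, lker i = 0%VS, limg i = lker p & limg p = fullv].

Lemma ker_exact Y Z (p : 'Hom(Y, Z)) : is_modhom p -> limg p = fullv ->
  exists (X : fdmod A) (i : 'Hom(X, Y)), short_exact i p.
Proof.
move=> hp sp; exists (sub_mod (lker_submod hp)).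
have [i hi iE] := sub_inclP (lker_submod hp).
exists i; split=> //; first by apply/lker_inj => x; rewrite iE => x0; apply: subvs_inj.
apply/vspaceP => y; apply/memv_imgP/idP => [[x _ ->]|yk].
  by rewrite iE subvsP.
by exists (vsproj _ y); rewrite ?memvf // iE vsprojK.
Qed.

Lemma coker_exact X Y (i : 'Hom(X, Y)) : is_modhom i ->
  exists (Z : fdmod A) (p : 'Hom(Y, Z)),
    [/\ is_modhom p, limg i = lker p & limg p = fullv].
Proof.
move=> hi; exists (quot_mod (limg_submod hi)).
have [p hp pE] := quot_projP (limg_submod hi).
exists p; split=> //.
  by apply/vspaceP => y; rewrite memv_ker pE quot_proj_eq0.
by apply/limg_full => y; exists (vsval y); rewrite pE quot_projK.
Qed.

Lemma image_exact X Z (f : 'Hom(X, Z)) : is_modhom f ->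
  exists (I : fdmod A) (p : 'Hom(X, I)) (i : 'Hom(I, Z)),
    [/\ is_modhom p, is_modhom i, limg p = fullv, lker i = 0%VS & (i \o p)%VF = f].
Proof.
move=> hf; have st := limg_submod hf.
have [i hi iE] := sub_inclP st.
have [p hp pE] := sub_factor st hf (subvv _).
exists (sub_mod st), p, i; split=> //.
- apply/limg_full => y; have /memv_imgP[x _ xy] := subvsP y.
  by exists x; apply: subvs_inj; rewrite pE -xy.
- by apply/lker_inj => x; rewrite iE => x0; apply: subvs_inj.
- by apply/lfunP => x; rewrite comp_lfunE iE pE.
Qed.

Lemma epi_factor X Y Z (p : 'Hom(X, Y)) (g : 'Hom(X, Z)) :
  is_modhom p -> limg p = fullv -> is_modhom g -> (lker p <= lker g)%VS ->
  exists2 h : 'Hom(Y, Z), is_modhom h & (h \o p)%VF = g.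
Proof.
move=> hp sp hg pg.
have E x : (g \o p^-1)%VF (p x) = g x.
  rewrite comp_lfunE; apply/eqP; rewrite -subr_eq0 -linearB -memv_ker.
  by apply: (subvP pg); rewrite memv_ker linearB /= limg_lfunVK ?subrr // mem_limg.
exists (g \o p^-1)%VF; last by apply/lfunP => x; rewrite comp_lfunE E.
move=> y a; have [x <-] := (limg_full p).1 sp y.
by rewrite -hp !E hg.
Qed.

Lemma mono_factor X Y Z (i : 'Hom(X, Y)) (g : 'Hom(Z, Y)) :
  is_modhom i -> lker i = 0%VS -> is_modhom g -> (limg g <= limg i)%VS ->
  exists2 h : 'Hom(Z, X), is_modhom h & (i \o h)%VF = g.
Proof.
move=> hi ki hg gi.
have E z : i ((i^-1 \o g)%VF z) = g z.
  by rewrite comp_lfunE limg_lfunVK // (subvP gi) // mem_limg.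
exists (i^-1 \o g)%VF; last by apply/lfunP => z; rewrite comp_lfunE E.
move=> z a; apply/eqP; rewrite -subr_eq0; apply/eqP.
apply: (iffLR (lker_inj i) ki).
by rewrite linearB /= hi !E hg subrr.
Qed.

(** Lifting along a homomorphism that need not be onto. *)
Lemma proj_lift P Y Z (g : 'Hom(Y, Z)) (f : 'Hom(P, Z)) :
  is_projective P -> is_modhom g -> is_modhom f -> (limg f <= limg g)%VS ->
  exists2 h : 'Hom(P, Y), is_modhom h & (g \o h)%VF = f.
Proof.
move=> pP hg hf fg; have [I [p [i [hp hi sp ki ip]]]] := image_exact hg.
have sub : (limg f <= limg i)%VS.
  by rewrite (subv_trans fg) // -ip limg_comp limgS // subvf.
have [f' hf' f'E] := mono_factor hi ki hf sub.
have [h hh hE] := pP _ _ p f' hp sp hf'.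
by exists h => //; rewrite -ip -comp_lfunA hE.
Qed.

Lemma dim_modhom_exact P X Y Z (i : 'Hom(X, Y)) (p : 'Hom(Y, Z)) :
  is_projective P -> short_exact i p ->
  \dim (modhom P Y) = (\dim (modhom P X) + \dim (modhom P Z))%N.
Proof.
move=> pP [hi hp ki ip sp].
have [F FE] : exists F : 'Hom('Hom(P, Y), 'Hom(P, Z)), forall f, F f = (p \o f)%VF.
  have l : linear (fun f : 'Hom(P, Y) => (p \o f)%VF).
    by move=> k f g; rewrite comp_lfunDr -comp_lfunZr.
  by have [F FE] := linear_lfun l; exists F.
have [G GE] : exists G : 'Hom('Hom(P, X), 'Hom(P, Y)), forall f, G f = (i \o f)%VF.
  have l : linear (fun f : 'Hom(P, X) => (i \o f)%VF).
    by move=> k f g; rewrite comp_lfunDr -comp_lfunZr.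
  by have [G GE] := linear_lfun l; exists G.
rewrite -(limg_ker_dim F (modhom P Y)); congr (_ + _)%N.
  rewrite -(@limg_dim_eq _ _ _ G (modhom P X)).
    congr (\dim _); apply/vspaceP => f; rewrite memv_cap memv_ker FE.
    apply/andP/memv_imgP => [[/modhomP hf /eqP pf]|[g /modhomP hg ->]].
      have sub : (limg f <= limg i)%VS.
        rewrite ip; apply/subvP => _ /memv_imgP[x _ ->].
        by rewrite memv_ker -comp_lfunE pf zero_lfunE.
      have [g hg gE] := mono_factor hi ki hf sub.
      by exists g; rewrite ?GE //; apply/modhomP.
    rewrite GE; split; first by apply/modhomP/modhom_comp.
    rewrite comp_lfunA; suff -> : (p \o i)%VF = 0 by rewrite comp_lfun0l.
    apply/lfunP => x; rewrite comp_lfunE zero_lfunE; apply/eqP.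
    by rewrite -memv_ker -ip mem_limg.
  apply/eqP; rewrite -subv0; apply/subvP => g.
  rewrite memv_cap memv_ker GE memv0 => /andP[_ /eqP ig].
  apply/eqP/lfunP => x; rewrite zero_lfunE; apply: (iffLR (lker_inj i) ki).
  by rewrite -comp_lfunE ig zero_lfunE.
congr (\dim _); apply/vspaceP => f; apply/memv_imgP/idP => [[g /modhomP hg ->]|/modhomP hf].
  by rewrite FE; apply/modhomP/modhom_comp.
have [g hg gE] := pP _ _ p f hp sp hf.
by exists g; rewrite ?FE //; apply/modhomP.
Qed.

Variable R : realType.

Lemma euler_exact (theta : K0R R A) X Y Z (i : 'Hom(X, Y)) (p : 'Hom(Y, Z)) :
  short_exact i p -> euler theta Y = euler theta X + euler theta Z.
Proof.
move=> ex; rewrite -[theta]reprK !euler_pi -[repr theta]freeg_sumE !linear_sum.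
rewrite -big_split; apply: eq_bigr => P _; rewrite /= /euler_free !liftU /hom_dim.
by rewrite (dim_modhom_exact (@cp_projective _ _ P) ex) natrD scalerDr.
Qed.

End Exact.

(** * Two-term presentations *)

Section Presentations.
Variables (K : fieldType) (A : falgType K).
Implicit Types (M N X Y Z P : fdmod A).

Record presentation := Presentation {
  pr1 : fdmod A;
  pr0 : fdmod A;
  prd : 'Hom(pr1, pr0);
  pr1_projective : is_projective pr1;
  pr0_projective : is_projective pr0;
  prd_modhom : is_modhom prd
}.
Implicit Types p q : presentation.

Arguments pr0_projective : clear implicits.
Arguments pr1_projective : clear implicits.
Arguments prd_modhom : clear implicits.

Definition is_pres_map p q (b1 : 'Hom(pr1 p, pr1 q)) (b0 : 'Hom(pr0 p, pr0 q)) :=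
  [/\ is_modhom b1, is_modhom b0 & (b0 \o prd p = prd q \o b1)%VF].

(** These maps represent zero in Hom(p, X[1]), where [p] is seen as a complex in
    degrees -1 and 0. *)
Definition null_map p X (u : 'Hom(pr1 p, X)) : Prop :=
  exists2 s : 'Hom(pr0 p, X), is_modhom s & u = (s \o prd p)%VF.

(** Hom(p, X) = 0 in the homotopy category. *)
Definition hom_free p X : Prop :=
  forall f : 'Hom(pr0 p, X), is_modhom f -> (f \o prd p)%VF = 0 -> f = 0.

(** Hom(p, X[1]) = 0 in the homotopy category. *)
Definition ext_free p X : Prop :=
  forall u : 'Hom(pr1 p, X), is_modhom u -> null_map u.

(** The value on [X] of the class of [p], by the Euler form. *)
Definition gdim p X : int :=
  (\dim (modhom (pr0 p) X))%:Z - (\dim (modhom (pr1 p) X))%:Z.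

Definition additive_fun (G : zmodType) (chi : fdmod A -> G) : Prop :=
  forall X Y Z (i : 'Hom(X, Y)) (p : 'Hom(Y, Z)),
    short_exact i p -> chi Y = chi X + chi Z.

Lemma gdim_additive p : additive_fun (gdim p).
Proof.
move=> X Y Z i q ex; rewrite /gdim.
rewrite (dim_modhom_exact (pr0_projective p) ex).
rewrite (dim_modhom_exact (pr1_projective p) ex).
by rewrite !PoszD opprD addrACA.
Qed.

(** The two numbers are the dimensions of the kernel and of the cokernel of the
    composition with the differential, that is of Hom(p, X) and Hom(p, X[1]). *)
Lemma gdimE p X : exists h e : nat,
  [/\ gdim p X = h%:Z - e%:Z, h = 0%N <-> hom_free p X & e = 0%N <-> ext_free p X].
Proof.
have [F FE] : exists F : 'Hom('Hom(pr0 p, X), 'Hom(pr1 p, X)),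
    forall f, F f = (f \o prd p)%VF.
  by exists (linfun (precomp (prd p))) => f; rewrite lfunE.
have FS : (F @: modhom (pr0 p) X <= modhom (pr1 p) X)%VS.
  apply/subvP => _ /memv_imgP[f /modhomP hf ->]; rewrite FE.
  exact/modhomP/modhom_comp/prd_modhom.
exists (\dim (modhom (pr0 p) X :&: lker F)).
exists (\dim (modhom (pr1 p) X) - \dim (F @: modhom (pr0 p) X))%N.
split.
- rewrite /gdim -(limg_ker_dim F (modhom (pr0 p) X)) -subzn ?dimvS //.
  by rewrite PoszD opprB addrA.
- split=> [/eqP|h].
    rewrite dimv_eq0 => /eqP h f hf fd.
    apply/eqP; rewrite -memv0 -h memv_cap memv_ker FE fd eqxx andbT.
    exact/modhomP.
  apply/eqP; rewrite dimv_eq0 -subv0; apply/subvP => f.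
  rewrite memv_cap memv_ker FE => /andP[/modhomP hf /eqP fd].
  by rewrite (h f hf fd) mem0v.
- split=> [/eqP|h].
    rewrite subn_eq0 => le u /modhomP hu.
    have /eqP E : (F @: modhom (pr0 p) X == modhom (pr1 p) X)%VS by rewrite eqEdim FS le.
    move: hu; rewrite -E => /memv_imgP[s /modhomP hs ->].
    by exists s; rewrite ?FE.
  apply/eqP; rewrite subn_eq0; apply/dimvS/subvP => u /modhomP /h[s hs ->].
  by rewrite -FE; apply/memv_img/modhomP.
Qed.

Lemma gdim_ext_free p X : ext_free p X ->
  0 <= gdim p X /\ (gdim p X = 0 <-> hom_free p X).
Proof.
have [h [e [-> <- <-]]] := gdimE p X => ->; rewrite subr0; split=> //.
by split=> [[]|->].
Qed.

Lemma gdim_hom_free p X : hom_free p X ->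
  gdim p X <= 0 /\ (gdim p X = 0 <-> ext_free p X).
Proof.
have [h [e [-> <- <-]]] := gdimE p X => ->; rewrite sub0r oppr_le0; split=> //.
by split=> [/eqP|->//]; rewrite oppr_eq0 => /eqP[].
Qed.

Lemma null_mapD p X (u v : 'Hom(pr1 p, X)) :
  null_map u -> null_map v -> null_map (u + v).
Proof.
move=> [s hs ->] [t ht ->]; exists (s + t); first exact: modhomD.
by rewrite comp_lfunDl.
Qed.

Lemma null_map_pres p q X (u : 'Hom(pr1 q, X)) b1 b0 :
  is_pres_map b1 b0 -> null_map u -> null_map (u \o (b1 : 'Hom(pr1 p, pr1 q)))%VF.
Proof.
move=> [_ h0 bd] [s hs ->]; exists (s \o b0)%VF; first exact: modhom_comp.
by rewrite -!comp_lfunA bd.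
Qed.

(** Every endomorphism of [p] that passes through [q] is nilpotent up to homotopy:
    in both degrees, the same map [s] is a homotopy from a power of it to zero. *)
Definition hom_nilpotent p q : Prop :=
  forall a1 a0 b1 b0, @is_pres_map p q a1 a0 -> @is_pres_map q p b1 b0 ->
  exists n (s : 'Hom(pr0 p, pr1 p)),
    [/\ is_modhom s,
        iter n (comp_lfun (b0 \o a0)) \1%VF = (prd p \o s)%VF &
        iter n (comp_lfun (b1 \o a1)) \1%VF = (s \o prd p)%VF].

End Presentations.

Arguments pr0_projective {K A} p.
Arguments pr1_projective {K A} p.
Arguments prd_modhom {K A} p.

Lemma iter_comp_lfun (K : fieldType) (V : vectType K) (h : 'End(V)) n :
  (iter n (comp_lfun h) \1 \o h = iter n.+1 (comp_lfun h) \1)%VF.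
Proof.
elim: n => [|n IH] /=; first by rewrite comp_lfun1l comp_lfun1r.
by rewrite -comp_lfunA IH.
Qed.

Section Products.
Variables (K : fieldType) (A : falgType K) (X Y : fdmod A).

Definition prod_act (z : (X * Y)%type) (a : A) : (X * Y)%type :=
  (act z.1 a, act z.2 a).

Lemma prod_actP : is_right_action prod_act.
Proof.
have [l1 l2 h1 h2] := actP X; have [l1' l2' h1' h2'] := actP Y; split.
- by move=> a k [x y] [x' y']; rewrite /prod_act /= l1 l1'.
- by move=> [x y] k a b; rewrite /prod_act /= l2 l2'.
- by move=> [x y]; rewrite /prod_act /= h1 h1'.
- by move=> [x y] a b; rewrite /prod_act /= h2 h2'.
Qed.

Definition prod_mod : fdmod A := FdMod prod_actP.

Lemma prod_modP : exists (i1 : 'Hom(X, prod_mod)) (i2 : 'Hom(Y, prod_mod))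
    (p1 : 'Hom(prod_mod, X)) (p2 : 'Hom(prod_mod, Y)),
  [/\ is_modhom i1, is_modhom i2, is_modhom p1 & is_modhom p2] /\
  [/\ forall x, i1 x = (x, 0), forall y, i2 y = (0, y),
      forall z, p1 z = z.1 & forall z, p2 z = z.2].
Proof.
have [i1 i1E] := @linear_lfun _ X prod_mod (fun x => (x, 0)) (fun k x y =>
  congr1 (pair (k *: x + y)) (esym (etrans (addr0 _) (scaler0 _ k)))).
have [i2 i2E] := @linear_lfun _ Y prod_mod (fun y => (0, y)) (fun k x y =>
  congr1 (pair^~ (k *: x + y)) (esym (etrans (addr0 _) (scaler0 _ k)))).
have [p1 p1E] := @linear_lfun _ prod_mod X fst (fun _ _ _ => erefl).
have [p2 p2E] := @linear_lfun _ prod_mod Y snd (fun _ _ _ => erefl).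
exists i1, i2, p1, p2; split; split=> // z a.
- by rewrite !i1E /= /prod_act /= act0.
- by rewrite !i2E /= /prod_act /= act0.
- by rewrite !p1E.
- by rewrite !p2E.
Qed.

End Products.

(** The pushout of [u] and [d] is the cokernel of [X -> Y + Z]; the last property
    is the exactness of [X -> Y + Z -> Q], tested against projective modules. *)
Lemma pushout (K : fieldType) (A : falgType K) (X Y Z : fdmod A)
    (u : 'Hom(X, Y)) (d : 'Hom(X, Z)) : is_modhom u -> is_modhom d ->
  exists (Q : fdmod A) (j : 'Hom(Y, Q)) (k : 'Hom(Z, Q)),
  [/\ is_modhom j, is_modhom k, (j \o u = k \o d)%VF,
      forall q, exists y z, q = j y + k z &
      forall (P : fdmod A) (v : 'Hom(P, Y)) (w : 'Hom(P, Z)), is_projective P ->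
        is_modhom v -> is_modhom w -> ((j \o v) + (k \o w))%VF = 0 ->
        exists b : 'Hom(P, X), [/\ is_modhom b, (u \o b)%VF = v & (d \o b)%VF = - w]].
Proof.
move=> hu hd.
have [i1 [i2 [p1 [p2 [[hi1 hi2 hp1 hp2] [i1E i2E p1E p2E]]]]]] := prod_modP Y Z.
pose r := ((i1 \o u) - (i2 \o d))%VF.
have hr : is_modhom r by apply: modhomB; apply: modhom_comp.
have [Q [c [hc rc sc]]] := coker_exact hr.
exists Q, (c \o i1)%VF, (c \o i2)%VF; split; try exact: modhom_comp.
- apply/lfunP => x; rewrite !comp_lfunE; apply/eqP; rewrite -subr_eq0 -linearB.
  rewrite -memv_ker -rc; have := mem_limg r x.
  by rewrite /r add_lfunE opp_lfunE !comp_lfunE.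
- move=> q; have [z <-] := (limg_full c).1 sc q; exists z.1, z.2.
  rewrite !comp_lfunE -linearD i1E i2E; congr (c _).
  by case: z => y z; congr (_, _); rewrite /= ?addr0 ?add0r.
- move=> P v w pP hv hw vw.
  have hs : is_modhom ((i1 \o v) + (i2 \o w))%VF by apply: modhomD; apply: modhom_comp.
  have [|b hb bE] := proj_lift pP hr hs.
    rewrite rc; apply/subvP => _ /memv_imgP[x _ ->].
    have /lfunP/(_ x) := vw; rewrite add_lfunE !comp_lfunE zero_lfunE -linearD.
    by rewrite memv_ker add_lfunE !comp_lfunE => ->.
  exists b; split=> //; apply/lfunP => x; have /lfunP/(_ x) := bE.
    move=> /(congr1 p1); rewrite /r !(lfE) !p1E i1E i2E i1E i2E /=.
    by rewrite oppr0 !addr0.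
  move=> /(congr1 p2); rewrite /r !(lfE) !p2E i1E i2E i1E i2E /=.
  by rewrite !add0r => <-; rewrite opprK.
Qed.

(** * Dissection of the factors of M and the submodules of N *)

Section Dissection.
Variables (K : fieldType) (A : falgType K) (m : nat).
Variables (p : 'I_m -> presentation A) (M N : fdmod A).
Implicit Types (W X Y Z P : fdmod A).

Definition is_factor X : Prop :=
  exists2 q : 'Hom(M, X), is_modhom q & limg q = fullv.

Definition is_subobject Y : Prop :=
  exists2 i : 'Hom(Y, N), is_modhom i & lker i = 0%VS.

Definition nonzero X : Prop := exists x : X, x != 0.

Definition simple_gdim X : Prop :=
  forall k l, gdim (p k) X != 0 -> gdim (p l) X != 0 -> k = l.

Lemma nonzeroP X Y (f : 'Hom(X, Y)) : f != 0 -> nonzero X /\ nonzero Y.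
Proof.
move=> /lfunPn[x]; rewrite zero_lfunE => fx; split; last by exists (f x).
by exists x; apply: contraNneq fx => ->; rewrite linear0.
Qed.

Lemma epi_neq0 X Y (f : 'Hom(X, Y)) : limg f = fullv -> nonzero Y -> f != 0.
Proof.
move=> sf [y]; have [x <-] := (limg_full f).1 sf y.
by apply: contraNneq => ->; rewrite zero_lfunE.
Qed.

Lemma mono_neq0 X Y (f : 'Hom(X, Y)) : lker f = 0%VS -> nonzero X -> f != 0.
Proof.
move=> kf [x]; apply: contraNneq => f0; apply/eqP.
by apply: (iffLR (lker_inj f) kf); rewrite f0 zero_lfunE.
Qed.

Lemma factor_epi X Y (f : 'Hom(X, Y)) :
  is_factor X -> is_modhom f -> limg f = fullv -> is_factor Y.
Proof.
move=> [q hq sq] hf sf; exists (f \o q)%VF; first exact: modhom_comp.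
by rewrite limg_comp sq.
Qed.

Lemma subobject_mono X Y (f : 'Hom(X, Y)) :
  is_subobject Y -> is_modhom f -> lker f = 0%VS -> is_subobject X.
Proof.
move=> [i hi ki] hf kf; exists (i \o f)%VF; first exact: modhom_comp.
apply/lker_inj => x; rewrite comp_lfunE => ifx.
by apply: (iffLR (lker_inj f) kf); apply: (iffLR (lker_inj i) ki).
Qed.

(** What is used about [M] = H^0(U) and [N] = H^-1(nu U) when [p] runs through the
    summands of a two-term presilting complex U.  The kernels of the differentials
    after applying nu, of which [N] is the sum, only enter through the dual of
    Hom(Y, N), which is the sum of the spaces Hom(p k, Y[1]). *)
Hypothesis factor_ext_free : forall X k, is_factor X -> ext_free (p k) X.
Hypothesis coker_factor : forall X k (f : 'Hom(pr0 (p k), X)), is_modhom f ->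
  limg f = fullv -> (f \o prd (p k))%VF = 0 -> is_factor X.
Hypothesis factor_generated : forall X (q : 'Hom(M, X)), is_modhom q -> q != 0 ->
  exists k (f : 'Hom(pr0 (p k), X)),
    [/\ is_modhom f, (f \o prd (p k))%VF = 0 & f != 0].
Hypothesis ext_detects : forall Y (i : 'Hom(Y, N)), is_modhom i -> i != 0 ->
  exists k, ~ ext_free (p k) Y.
Hypothesis ext_detected : forall W k, ~ ext_free (p k) W ->
  exists2 i : 'Hom(W, N), is_modhom i & i != 0.
Hypothesis nilpotent : forall i j, i != j -> hom_nilpotent (p j) (p i).

(** The image of a nonzero map from the cokernel of [p k] to [Y] would be a factor
    of [M] and a submodule of [N]; the former has no extensions by any [p l], the
    latter has some. *)
Lemma subobject_hom_free Y k : is_subobject Y -> hom_free (p k) Y.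
Proof.
move=> sY f hf fd; apply/eqP/negP => /negP f0.
have [V [q [i [hq hi sq ki iq]]]] := image_exact hf.
have qd : (q \o prd (p k))%VF = 0.
  apply/lfunP => x; rewrite zero_lfunE; apply: (iffLR (lker_inj i) ki).
  by rewrite -comp_lfunE comp_lfunA iq fd zero_lfunE.
have [j hj kj] := subobject_mono sY hi ki.
have [|l] := ext_detects hj; last by apply; exact/factor_ext_free/(coker_factor hq sq qd).
apply: mono_neq0 kj _; apply: (nonzeroP (f := i) _).1.
by apply: contra_neq f0 => i0; rewrite -iq i0 comp_lfun0l.
Qed.

(** The measure for the induction: it is positive on the nonzero factors of [M] and
    negative on the nonzero submodules of [N]. *)
Definition gsize X : int := \sum_k gdim (p k) X.

Lemma gsize_additive : additive_fun gsize.
Proof.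
move=> X Y Z i q ex; rewrite /gsize -big_split; apply: eq_bigr => k _.
exact: gdim_additive ex.
Qed.

Lemma factor_gdim_ge0 X k : is_factor X -> 0 <= gdim (p k) X.
Proof. by move=> fX; case: (gdim_ext_free (@factor_ext_free X k fX)). Qed.

Lemma subobject_gdim_le0 Y k : is_subobject Y -> gdim (p k) Y <= 0.
Proof. by move=> sY; case: (gdim_hom_free (subobject_hom_free (k := k) sY)). Qed.

Lemma factor_gsize_ge0 X : is_factor X -> 0 <= gsize X.
Proof. by move=> fX; apply: sumr_ge0 => k _; apply: factor_gdim_ge0. Qed.

Lemma subobject_gsize_le0 Y : is_subobject Y -> gsize Y <= 0.
Proof. by move=> sY; apply: sumr_le0 => k _; apply: subobject_gdim_le0. Qed.

Lemma factor_gsize_gt0 X : is_factor X -> nonzero X -> 0 < gsize X.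
Proof.
move=> fX nX; rewrite lt0r factor_gsize_ge0 // andbT; apply/negP.
rewrite psumr_eq0 => [/allP g0|k _]; last exact: factor_gdim_ge0.
have [q hq sq] := fX; have q0 := epi_neq0 sq nX.
have [k [f [hf fd]]] := factor_generated hq q0; apply/negP/negPn/eqP.
have [_ [h _]] := gdim_ext_free (@factor_ext_free X k fX); apply: h => //.
by apply/eqP/g0; rewrite mem_index_enum.
Qed.

Lemma subobject_gsize_lt0 Y : is_subobject Y -> nonzero Y -> gsize Y < 0.
Proof.
move=> sY nY; rewrite lt_neqAle subobject_gsize_le0 // andbT; apply/negP.
rewrite -oppr_eq0 /gsize -sumrN psumr_eq0 => [/allP g0|k _]; last first.
  by rewrite oppr_ge0 subobject_gdim_le0.
have [i hi ki] := sY; have i0 := mono_neq0 ki nY.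
have [k] := ext_detects hi i0; apply.
have [_ [h _]] := gdim_hom_free (subobject_hom_free (k := k) sY); apply: h.
by apply/eqP; rewrite -oppr_eq0; apply: g0; rewrite mem_index_enum.
Qed.

(** Let C be the cokernel of [p j] and W the kernel of the map C -> X induced by
    [f].  If [f] is not onto, its image splits X.  If [f] is onto and W has a nonzero
    map to [N] with image Y and kernel V, then X = C / W has the class of C / V
    minus that of Y.  If W has no nonzero map to [N], then Hom(p i, W[1]) = 0, and
    maps to X can be lifted to C, and further to chain maps to [p j]. *)
Lemma factor_case X j (f : 'Hom(pr0 (p j), X)) :
  is_factor X -> is_modhom f -> (f \o prd (p j))%VF = 0 -> f != 0 ->
  [\/ exists X1 X2, [/\ is_factor X1, is_factor X2, nonzero X1, nonzero X2 &
        forall (G : zmodType) (chi : fdmod A -> G), additive_fun chi ->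
          chi X = chi X1 + chi X2],
      exists T Y, [/\ is_factor T, is_subobject Y, nonzero T, nonzero Y &
        forall (G : zmodType) (chi : fdmod A -> G), additive_fun chi ->
          chi X = chi T - chi Y] |
      forall i (f' : 'Hom(pr0 (p i), X)), is_modhom f' -> (f' \o prd (p i))%VF = 0 ->
        exists b1 b0, @is_pres_map _ _ (p i) (p j) b1 b0 /\ (f \o b0)%VF = f'].
Proof.
move=> fX hf fd f0.
have [I [q [i [hq hi sq ki iq]]]] := image_exact hf.
have qd : (q \o prd (p j))%VF = 0.
  apply/lfunP => x; rewrite zero_lfunE; apply: (iffLR (lker_inj i) ki).
  by rewrite -comp_lfunE comp_lfunA iq fd zero_lfunE.
have fI := coker_factor hq sq qd.
have nI : nonzero I.
  by apply: (nonzeroP (f := i) _).1; apply: contra_neq f0 => i0; rewrite -iq i0 comp_lfun0l.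
have [Z [c [hc ic sc]]] := coker_exact hi.
have [c0|c0] := eqVneq c 0; last first.
  constructor 1; exists I, Z; split=> //; first exact: factor_epi fX hc sc.
    exact: (nonzeroP c0).2.
  by move=> G chi; apply; split; eassumption.
(* now [f] is onto *)
have sf : limg f = fullv.
  rewrite -iq limg_comp sq ic c0; apply/vspaceP => x.
  by rewrite memv_ker zero_lfunE eqxx memvf.
have [C [g [hg dg sg]]] := coker_exact (prd_modhom (p j)).
have [fb hfb fbE] : exists2 h : 'Hom(C, X), is_modhom h & (h \o g)%VF = f.
  apply: epi_factor => //; rewrite -dg; apply/subvP => _ /memv_imgP[x _ ->].
  by rewrite memv_ker -comp_lfunE fd zero_lfunE.
have sfb : limg fb = fullv.
  apply/limg_full => x; have [y <-] := (limg_full f).1 sf x.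
  by exists (g y); rewrite -comp_lfunE fbE.
have [W [w exW]] := ker_exact hfb sfb; have [hw _ kw wfb _] := exW.
have [[i' ext_i']|ext] := pselect (exists i', ~ ext_free (p i') W).
  have [phi hphi phi0] := ext_detected ext_i'.
  have [Y [y [k [hy hk sy kk ky]]]] := image_exact hphi.
  have [V [v exV]] := ker_exact hy sy; have [hv _ kv _ _] := exV.
  have hwv : is_modhom (w \o v)%VF by apply: modhom_comp.
  have kwv : lker (w \o v)%VF = 0%VS.
    apply/lker_inj => x; rewrite comp_lfunE => wvx.
    by apply: (iffLR (lker_inj v) kv); apply: (iffLR (lker_inj w) kw).
  have [T [t [ht wvt st]]] := coker_exact hwv.
  have nY : nonzero Y.
    apply: (nonzeroP (f := y) _).2.
    by apply: contra_neq phi0 => y0; rewrite -ky y0 comp_lfun0r.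
  have [T' fT'] : exists h : 'Hom(T, X), limg h = fullv.
    have [|h _ hE] := epi_factor ht st hfb.
      rewrite -wvt -wfb; apply/subvP => _ /memv_imgP[x _ ->].
      by rewrite comp_lfunE mem_limg.
    by exists h; rewrite -(limg_full h).2 // => x; have [z <-] := (limg_full fb).1 sfb x;
       exists (t z); rewrite -comp_lfunE hE.
  constructor 2; exists T, Y; split=> //.
  - apply: (@coker_factor T j (t \o g)%VF); first exact: modhom_comp.
      by rewrite limg_comp sg st.
    apply/lfunP => x; rewrite !comp_lfunE zero_lfunE.
    have /eqP -> : g (prd (p j) x) == 0 by rewrite -memv_ker -dg mem_limg.
    by rewrite linear0.
  - by exists k.
  - have nX : nonzero X by apply: (nonzeroP (f := f) _).2.
    exact: (nonzeroP (epi_neq0 fT' nX)).1.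
  - move=> G chi addchi.
    have e1 := addchi _ _ _ _ _ exW; have e2 := addchi _ _ _ _ _ exV.
    have e3 : chi C = chi V + chi T by apply: (addchi _ _ _ (w \o v)%VF t); split.
    have -> : chi X = chi C - chi W by rewrite e1 addrC addKr.
    by rewrite e3 e2 opprD addrACA subrr add0r.
constructor 3 => i' f' hf' f'd.
have extW : ext_free (p i') W.
  by apply: contrapT => nW; apply: ext; exists i'.
have [b0 hb0 fb0] : exists2 b0, is_modhom b0 & (f \o b0)%VF = f'.
  by apply: proj_lift => //; [exact: pr0_projective | rewrite sf subvf].
have hgbd : is_modhom (g \o (b0 \o prd (p i')))%VF.
  by apply: modhom_comp => //; apply: modhom_comp (prd_modhom _).
have [|u hu uE] := mono_factor hw kw hgbd.
  rewrite wfb; apply/subvP => _ /memv_imgP[x _ ->].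
  by rewrite memv_ker -comp_lfunE !comp_lfunA fbE fb0 f'd zero_lfunE.
have [s hs us] := extW u hu.
have hws : is_modhom (w \o s)%VF by apply: modhom_comp.
have [|s' hs' s'E] := proj_lift (pr0_projective (p i')) hg hws; first by rewrite sg subvf.
have hb0' : is_modhom (b0 - s') by apply: modhomB.
have hb0d : is_modhom ((b0 - s') \o prd (p i'))%VF.
  exact: modhom_comp (prd_modhom _).
have [|b1 hb1 b1E] := proj_lift (pr1_projective (p i')) (prd_modhom (p j)) hb0d.
  rewrite dg; apply/subvP => _ /memv_imgP[x _ ->].
  rewrite memv_ker -comp_lfunE comp_lfunA comp_lfunDr comp_lfunNr s'E.
  by rewrite comp_lfunDl comp_lfunNl -!comp_lfunA -us uE subrr zero_lfunE.
exists b1, (b0 - s'); split; first by split.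
rewrite comp_lfunDr comp_lfunNr fb0 -fbE -comp_lfunA s'E.
suff -> : (fb \o (w \o s))%VF = 0 by rewrite subr0.
apply/lfunP => x; rewrite !comp_lfunE zero_lfunE; apply/eqP.
by rewrite -memv_ker -wfb mem_limg.
Qed.

(** The dual case analysis, for a class [u] in Hom(p j, Y[1]).  Let Q be the
    pushout of [u] along the differential of [p j].  If Q has a nonzero map to [N]
    with image Y1, then Y -> Y1 has a submodule of [N] as kernel and a factor of the
    cokernel of [p j] as cokernel.  Otherwise Hom(p i, Q[1]) = 0, which allows to
    factor any class in Hom(p i, Y[1]) through [u]. *)
Lemma subobject_case Y j (u : 'Hom(pr1 (p j), Y)) :
  is_subobject Y -> is_modhom u -> ~ null_map u ->
  (exists Y' Y1 X', [/\ is_subobject Y', is_subobject Y1, is_factor X', nonzero Y1 &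
        nonzero Y' \/ nonzero X'] /\
        (forall (G : zmodType) (chi : fdmod A -> G), additive_fun chi ->
          chi Y = chi Y' + chi Y1 - chi X')) \/
  (forall i (u' : 'Hom(pr1 (p i), Y)), is_modhom u' ->
        exists b1 b0, @is_pres_map _ _ (p i) (p j) b1 b0 /\ null_map (u' - (u \o b1)%VF)).
Proof.
move=> sY hu nu.
have [Q [jY [j0 [hjY hj0 ju jQ jlift]]]] := pushout hu (prd_modhom (p j)).
have [[i ext_i]|ext] := pselect (exists i, ~ ext_free (p i) Q); last first.
  right=> i u' hu'.
  have extQ : ext_free (p i) Q.
    by apply: contrapT => nW; apply: ext; exists i.
  have hju' : is_modhom (jY \o u')%VF by apply: modhom_comp.
  have [s hs sE] := extQ _ hju'.
  have [i1 [i2 [q1 [q2 [[hi1 hi2 hq1 hq2] [i1E i2E q1E q2E]]]]]] := prod_modP Y (pr0 (p j)).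
  have hc : is_modhom ((jY \o q1) + (j0 \o q2))%VF.
    by apply: modhomD; apply: modhom_comp.
  have [|t ht tE] := proj_lift (pr0_projective (p i)) hc hs.
    apply/subvP => q _; have [y [z ->]] := jQ q; apply/memv_imgP.
    by exists (y, z); rewrite ?memvf // !lfE q1E q2E.
  have hq1t : is_modhom (q1 \o t)%VF by apply: modhom_comp.
  have hq2t : is_modhom (q2 \o t)%VF by apply: modhom_comp.
  have hd := prd_modhom (p i).
  have [|||b1 [hb1 ub1 db1]] := jlift _ (u' - (q1 \o t \o prd (p i)))%VF
      (- (q2 \o t \o prd (p i)))%VF (pr1_projective (p i)).
  - by apply: modhomB => //; apply: modhom_comp.
  - by apply: modhomN; apply: modhom_comp.
  - rewrite comp_lfunDr !comp_lfunNr sE -tE !comp_lfunDl !comp_lfunA.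
    by rewrite addrAC addrK subrr.
  exists b1, (q2 \o t)%VF; split; first by split; rewrite // db1 opprK.
  by rewrite ub1 subKr; exists (q1 \o t)%VF.
left; have [psi hpsi psi0] := ext_detected ext_i.
have [Y1 [y [k [hy hk sy kk ky]]]] := image_exact hpsi.
have nY1 : nonzero Y1.
  apply: (nonzeroP (f := y) _).2.
  by apply: contra_neq psi0 => y0; rewrite -ky y0 comp_lfun0r.
have hyj : is_modhom (y \o jY)%VF by apply: modhom_comp.
have [I [q [i' [hq hi' sq ki' iq]]]] := image_exact hyj.
have [Y' [v exY']] := ker_exact hq sq; have [hv _ kv vq _] := exY'.
have [X' [c [hc ic sc]]] := coker_exact hi'.
exists Y', Y1, X'; split; first split=> //.
- exact: subobject_mono sY hv kv.
- by exists k.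
- apply: (@coker_factor X' j (c \o (y \o j0))%VF).
  + by apply: modhom_comp => //; apply: modhom_comp.
  + apply/limg_full => x; have [x1 <-] := (limg_full c).1 sc x.
    have [x2 <-] := (limg_full y).1 sy x1; have [a [b ->]] := jQ x2.
    exists b; rewrite !linearD !comp_lfunE /=.
    have /eqP -> : c (y (jY a)) == 0; last by rewrite add0r.
    by rewrite -memv_ker -ic -[y _]comp_lfunE -iq comp_lfunE mem_limg.
  + apply/lfunP => x; rewrite !comp_lfunE zero_lfunE -[j0 _]comp_lfunE -ju.
    apply/eqP; rewrite comp_lfunE -memv_ker -ic -[y _]comp_lfunE -iq comp_lfunE.
    exact: mem_limg.
(* if both vanish, [Y -> Y1] is an isomorphism that makes [u] null *)
- apply: contrapT => /not_orP[nY' nX']; apply: nu.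
  have v0 : v = 0.
    apply/eqP; apply: contrapT => /negP h; apply: nY'; exact: (nonzeroP h).1.
  have c0 : c = 0.
    apply/eqP; apply: contrapT => /negP h; apply: nX'; exact: (nonzeroP h).2.
  have kyj : lker (y \o jY)%VF = 0%VS.
    apply/lker_inj => x; rewrite -iq comp_lfunE => /(iffLR (lker_inj i') ki') qx.
    apply/eqP; have : x \in lker q by rewrite memv_ker qx.
    by rewrite -vq v0 => /memv_imgP[z _ ->]; rewrite zero_lfunE.
  have hyj0 : is_modhom (y \o j0)%VF by apply: modhom_comp.
  have [|s hs sE] := mono_factor hyj kyj hyj0.
    rewrite -iq [X in (_ <= X)%VS]limg_comp sq ic c0; apply/subvP => x _.
    by rewrite memv_ker zero_lfunE.
  exists s => //; apply/lfunP => x; apply/eqP; rewrite -subr_eq0; apply/eqP.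
  apply: (iffLR (lker_inj _) kyj); rewrite linearB /=.
  have /lfunP/(_ (prd (p j) x)) := sE; rewrite comp_lfunE [_ (s _)]comp_lfunE.
  rewrite [(_ \o prd _)%VF x]comp_lfunE [(y \o jY)%VF (s _)]comp_lfunE => ->.
  rewrite !comp_lfunE; have /lfunP/(_ x) := ju; rewrite !comp_lfunE => ->.
  by rewrite subrr.
- move=> G chi addchi; rewrite (addchi _ _ _ _ _ exY').
  have -> : chi Y1 = chi I + chi X' by apply: (addchi _ _ _ i' c); split.
  by rewrite -addrA addrK.
Qed.

Lemma additive_zero (G : zmodType) (chi : fdmod A -> G) X :
  additive_fun chi -> ~ nonzero X -> chi X = 0.
Proof.
move=> addchi zX; have z (x : X) : x = 0.
  by apply/eqP; apply: contrapT => /negP x0; apply: zX; exists x.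
have ex : short_exact (\1%VF : 'Hom(X, X)) (\1%VF : 'Hom(X, X)).
  split; try exact: modhom1.
  - by apply/lker_inj => x _; apply: z.
  - by apply/vspaceP => x; rewrite (z x) !mem0v.
  - by rewrite lim1g.
by apply: (addrI (chi X)); rewrite addr0 -(addchi _ _ _ _ _ ex).
Qed.

Lemma hom_nilpotent_fixed X i j (f : 'Hom(pr0 (p j), X)) a1 a0 b1 b0 : i != j ->
  @is_pres_map _ _ (p j) (p i) a1 a0 -> @is_pres_map _ _ (p i) (p j) b1 b0 ->
  (f \o prd (p j))%VF = 0 -> (f \o (b0 \o a0))%VF = f -> f = 0.
Proof.
move=> ij ha hb fd fba; have [n [s [_ E _]]] := nilpotent ij ha hb.
have : (f \o iter n (comp_lfun (b0 \o a0)) \1)%VF = f.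
  by elim: n {E} => [|n IH] /=; [rewrite comp_lfun1r | rewrite comp_lfunA fba].
by rewrite E comp_lfunA fd comp_lfun0l.
Qed.

Lemma hom_nilpotent_null Y i j (u : 'Hom(pr1 (p j), Y)) a1 a0 b1 b0 : i != j ->
  is_modhom u ->
  @is_pres_map _ _ (p j) (p i) a1 a0 -> @is_pres_map _ _ (p i) (p j) b1 b0 ->
  null_map (u - (u \o (b1 \o a1)))%VF -> null_map u.
Proof.
move=> ij hu ha hb uba; have [n [s [hs _ E]]] := nilpotent ij ha hb.
have hba : @is_pres_map _ _ (p j) (p j) (b1 \o a1)%VF (b0 \o a0)%VF.
  have [ha1 ha0 ad] := ha; have [hb1 hb0 bd] := hb.
  split; try exact: modhom_comp.
  by rewrite -comp_lfunA ad !comp_lfunA bd.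
have : null_map (u - (u \o iter n (comp_lfun (b1 \o a1)) \1))%VF.
  elim: n {E} => [|n IH].
    exists 0; first exact: modhom0.
    by rewrite comp_lfun1r subrr comp_lfun0l.
  rewrite -iter_comp_lfun; set h := iter n _ _ in IH *.
  have -> : u - (u \o (h \o (b1 \o a1)))%VF =
      (u - (u \o (b1 \o a1))%VF) + ((u - (u \o h)%VF) \o (b1 \o a1))%VF :> 'Hom(_, _).
    by rewrite comp_lfunDl comp_lfunNl !comp_lfunA subrKA.
  apply: null_mapD => //; exact: null_map_pres hba IH.
rewrite E => h; rewrite -[u](subrK (u \o (s \o prd (p j)))%VF).
apply: null_mapD => //; exists (u \o s)%VF; last by rewrite comp_lfunA.
exact: modhom_comp.
Qed.

(** By induction on the absolute value of [gsize]: an object with two nonzero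
    [gdim] has generators for two indices.  If one of them dissects the object, the
    pieces are strictly smaller since [gsize] is additive and all its contributions
    have the same sign.  If neither does, each generator factors through the other,
    which contradicts [nilpotent]. *)
Theorem dissection (F : numDomainType) (psi : fdmod A -> F) : additive_fun psi ->
  (forall X, is_factor X -> simple_gdim X -> 0 <= psi X) ->
  (forall Y, is_subobject Y -> simple_gdim Y -> psi Y <= 0) ->
  (forall X, is_factor X -> 0 <= psi X) /\ (forall Y, is_subobject Y -> psi Y <= 0).
Proof.
move=> addpsi psiX psiY.
suff H (n : nat) : (forall X, is_factor X -> gsize X < n%:Z -> 0 <= psi X) /\
    (forall Y, is_subobject Y -> - gsize Y < n%:Z -> psi Y <= 0).
  split=> Z hZ; have [H1 H2] := H (`|gsize Z|.+1)%N; [apply: H1|apply: H2] => //; lia.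
elim: n => [|n [IHX IHY]].
  split=> [X fX|Y sY].
    by move=> lt0; have := factor_gsize_ge0 fX; rewrite leNgt lt0.
  by move=> lt0; have := subobject_gsize_le0 sY; lia.
split=> [X fX ltn|Y sY ltn].
  apply: contrapT => neg.
  have /existsNP[k /existsNP[l /not_implyP[gk /not_implyP[gl kl]]]] : ~ simple_gdim X.
    by move=> /(psiX X fX).
  have gen i : gdim (p i) X != 0 -> exists f : 'Hom(pr0 (p i), X),
      [/\ is_modhom f, (f \o prd (p i))%VF = 0, f != 0 &
      forall i' (f' : 'Hom(pr0 (p i'), X)), is_modhom f' -> (f' \o prd (p i'))%VF = 0 ->
        exists b1 b0, @is_pres_map _ _ (p i') (p i) b1 b0 /\ (f \o b0)%VF = f'].
    move=> gi; have : ~ hom_free (p i) X.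
      move=> h; move/eqP: gi; apply.
      by have [_ [_ ->]] := gdim_ext_free (@factor_ext_free X i fX).
    move=> /existsNP[f /not_implyP[hf /not_implyP[fd /eqP f0]]]; exists f; split=> //.
    have [[X1 [X2 [f1 f2 n1 n2 E]]]|[T [Y [fT sY nT nY E]]]|//] := factor_case fX hf fd f0.
      exfalso; apply: neg; rewrite (E _ _ addpsi).
      have := E _ _ gsize_additive.
      have := factor_gsize_gt0 f1 n1; have := factor_gsize_gt0 f2 n2 => g2 g1 gE.
      by apply: addr_ge0; apply: IHX => //; lia.
    exfalso; apply: neg; rewrite (E _ _ addpsi).
    have := E _ _ gsize_additive.
    have := factor_gsize_gt0 fT nT; have := subobject_gsize_lt0 sY nY => g2 g1 gE.
    by apply: addr_ge0; [apply: IHX|rewrite oppr_ge0; apply: IHY] => //; lia.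
  have [f [hf fd f0 fgen]] := gen k gk; have [f' [hf' fd' f0' fgen']] := gen l gl.
  have [b1 [b0 [hb fb]]] := fgen _ _ hf' fd'.
  have [a1 [a0 [ha fa]]] := fgen' _ _ hf fd.
  move/eqP: f0; apply; apply: (hom_nilpotent_fixed _ ha hb fd); last first.
    by rewrite comp_lfunA fb fa.
  by rewrite eq_sym; apply/eqP.
apply: contrapT => neg.
have /existsNP[k /existsNP[l /not_implyP[gk /not_implyP[gl kl]]]] : ~ simple_gdim Y.
  by move=> /(psiY Y sY).
have gen i : gdim (p i) Y != 0 -> exists u : 'Hom(pr1 (p i), Y),
    [/\ is_modhom u, ~ null_map u &
    forall i' (u' : 'Hom(pr1 (p i'), Y)), is_modhom u' ->
      exists b1 b0, @is_pres_map _ _ (p i') (p i) b1 b0 /\ null_map (u' - (u \o b1)%VF)].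
  move=> gi; have : ~ ext_free (p i) Y.
    move=> h; move/eqP: gi; apply.
    by have [_ [_ ->]] := gdim_hom_free (subobject_hom_free (k := i) sY).
  move=> /existsNP[u /not_implyP[hu nu]]; exists u; split=> //.
  have [[Y' [Y1 [X' [[s' s1 fX' n1 nz] E]]]]|//] := subobject_case sY hu nu.
  exfalso; apply: neg; rewrite (E _ _ addpsi).
  have gE := E _ _ gsize_additive.
  have g1 := subobject_gsize_lt0 s1 n1.
  have g' := subobject_gsize_le0 s'; have gx := factor_gsize_ge0 fX'.
  have gz : gsize Y' < 0 \/ 0 < gsize X'.
    by case: nz => h; [left; apply: subobject_gsize_lt0|right; apply: factor_gsize_gt0].
  rewrite -oppr_ge0 !opprD opprK; apply: addr_ge0; [apply: addr_ge0|]; rewrite ?oppr_ge0.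
  - by apply: IHY => //; case: gz; lia.
  - by apply: IHY => //; case: gz; lia.
  - by apply: IHX => //; case: gz; lia.
have [u [hu nu ugen]] := gen k gk; have [u' [hu' nu' ugen']] := gen l gl.
have [b1 [b0 [hb ub]]] := ugen _ _ hu'.
have [a1 [a0 [ha ua]]] := ugen' _ _ hu.
apply: nu; apply: (hom_nilpotent_null _ hu ha hb); first by rewrite eq_sym; apply/eqP.
rewrite comp_lfunA.
have -> : u - (u \o b1 \o a1)%VF =
    (u - (u' \o a1)%VF) + ((u' - (u \o b1)%VF) \o a1)%VF :> 'Hom(_, _).
  by rewrite comp_lfunDl comp_lfunNl subrKA.
by apply: null_mapD => //; apply: null_map_pres ha ub.
Qed.

End Dissection.

(** * Cones cut out by forms that are each positive on at most one generator *)

Section DecoupledCone.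
Variables (R : realType) (V : lmodType R) (m p : nat).
Variables (g : 'I_m -> V) (l : 'I_p -> {linear V -> R^o}) (D : set V).

Definition decoupled i := forall k k', l i (g k) != 0 -> l i (g k') != 0 -> k = k'.

Hypothesis D_forms : forall x, D x <-> forall i, 0 <= l i x.
Hypothesis D_decoupled : forall x, (forall i, decoupled i -> 0 <= l i x) -> D x.
Hypothesis l_ge0 : forall i k, 0 <= l i (g k).
Hypothesis l_gt0 : forall k, exists i, 0 < l i (g k).

Definition span_cone : set V :=
  [set x | exists2 c : 'I_m -> R, forall k, 0 <= c k & x = \sum_(k < m) c k *: g k].

Let comb (c : 'I_m -> R) : V := \sum_(k < m) c k *: g k.

Let combD c c' : comb c + comb c' = comb (fun k => c k + c' k).
Proof. by rewrite -big_split; apply: eq_bigr => k _; rewrite scalerDl. Qed.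

Let combN c : - comb c = comb (fun k => - c k).
Proof. by rewrite -sumrN; apply: eq_bigr => k _; rewrite scaleNr. Qed.

Lemma lspan_cone x : lspan span_cone x <-> exists c, x = comb c.
Proof.
split=> [[s [sC ->]]|[c ->]].
  elim: s sC => [|y s IH] sC.
    exists (fun=> 0); rewrite big_nil /comb big1 // => k _; exact: scale0r.
  have [|c cE] := IH; first by move=> z zs; apply: sC; rewrite inE zs orbT.
  have [b _ bE] := sC y (mem_head _ _).
  exists (fun k => y.1 * b k + c k); rewrite big_cons cE bE -combD scaler_sumr.
  by congr (_ + _); apply: eq_bigr => k _; rewrite scalerA.
exists [seq (c k, g k) | k <- enum 'I_m]; split; last first.
  by rewrite big_map big_enum.
move=> _ /mapP[k _ ->] /=; exists (fun k' => (k' == k)%:R) => [k'|].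
  exact: ler0n.
rewrite (bigD1 k) //= eqxx scale1r big1 ?addr0 // => k' /negPf ->.
exact: scale0r.
Qed.

Let lcomb i c : l i (comb c) = \sum_(k < m) c k * l i (g k).
Proof. by rewrite linear_sum; apply: eq_bigr => k _; rewrite linearZ. Qed.

Let lcomb_decoupled i c k : decoupled i -> l i (g k) != 0 ->
  l i (comb c) = c k * l i (g k).
Proof.
move=> di nk; rewrite lcomb (bigD1 k) //= big1 ?addr0 // => k' k'k.
have [->|nk'] := eqVneq (l i (g k')) 0; first exact: mulr0.
by move/eqP: k'k; case; apply: di.
Qed.

(** The forms that limit how much of [g k] can be subtracted inside the cone. *)
Definition bounding k i := decoupled i /\ 0 < l i (g k).

(** Otherwise [- g k] would satisfy all the decoupled inequalities, hence all of
    them, although some form is positive on [g k]. *)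
Lemma bounding_exists k : exists i, bounding k i.
Proof.
apply: contrapT => nb; have Dg : D (- g k).
  apply: D_decoupled => i di; rewrite linearN oppr_ge0 leNgt; apply/negP => lt0.
  by apply: nb; exists i.
have [i igt0] := l_gt0 k; have := (D_forms _).1 Dg i.
by rewrite linearN oppr_ge0 leNgt igt0.
Qed.

Let bnd k : 'I_p := sval (cid (bounding_exists k)).
Let bndP k : bounding k (bnd k). Proof. exact: svalP (cid _). Qed.

(* the other indices are reset to a bounding one, so that all [k] share ['I_p] *)
Let reset k i : 'I_p := if `[< bounding k i >] then i else bnd k.
Let resetP k i : bounding k (reset k i).
Proof. by rewrite /reset; case: asboolP => // _; apply: bndP. Qed.

Definition bound k i (x : V) : R := l (reset k i) x / l (reset k i) (g k).

Let bound_linear k i a x y : bound k i (a *: x + y) = a * bound k i x + bound k i y.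
Proof. by rewrite /bound linearP mulrDl /GRing.scale /= mulrA. Qed.

Let least x k : 'I_p := [arg min_(i < bnd k) bound k i x]%O.
Let leastP x k i : bound k (least x k) x <= bound k i x.
Proof. by rewrite /least; case: arg_minP => // j _ /(_ i isT). Qed.

Definition cap x k : R := bound k (least x k) x.

(** A decoupled inequality on [x - comb c] involves a single coefficient of [c],
    and so it is an upper bound for that coefficient. *)
Lemma cap_max x c : D x -> D (x - comb c) <-> forall k, c k <= cap x k.
Proof.
move=> Dx; split=> [Dc k|ccap].
  rewrite /cap /bound; set i := reset k _; have [di gt0] : bounding k i by apply: resetP.
  rewrite ler_pdivlMr // -lcomb_decoupled ?gt_eqF //.
  by rewrite -subr_ge0 -linearB; apply: (D_forms _).1.
apply: D_decoupled => i di; rewrite linearB subr_ge0.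
have [[k nk]|n] := pselect (exists k, l i (g k) != 0).
  have gt0 : 0 < l i (g k) by rewrite lt0r nk l_ge0.
  rewrite (lcomb_decoupled _ di nk) -ler_pdivlMr //.
  have iE : reset k i = i by rewrite /reset asboolT.
  by have := leastP x k i; rewrite {2}/bound iE; apply: le_trans; apply: ccap.
rewrite lcomb big1 => [|k _]; first exact: (D_forms _).1.
by have [->|nk] := eqVneq (l i (g k)) 0; [rewrite mulr0|case: n; exists k].
Qed.

(** All forms vanish on a vector of the cone whose opposite is in the cone; as each
    [g k] is seen by some form, the coefficients vanish. *)
Lemma span_cone_pointed x : span_cone x -> span_cone (- x) -> x = 0.
Proof.
move=> [c c0 xE] [c' c'0 xE'].
have lx0 i : l i x = 0.
  apply/eqP; rewrite eq_le; apply/andP; split.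
    rewrite -oppr_ge0 -linearN xE' lcomb; apply: sumr_ge0 => k _.
    exact: mulr_ge0.
  by rewrite xE lcomb; apply: sumr_ge0 => k _; apply: mulr_ge0.
rewrite xE big1 // => k _; have [i igt0] := l_gt0 k.
suff -> : c k = 0 by exact: scale0r.
have := lx0 i; rewrite xE lcomb => /eqP; rewrite psumr_eq0.
  move=> /allP/(_ k); rewrite mem_index_enum mulf_eq0 (gt_eqF igt0) orbF.
  by move=> /(_ isT)/eqP.
by move=> k' _; apply: mulr_ge0.
Qed.

Lemma polyhedral_fin (T : finType) (phi : T -> {linear V -> R^o}) :
  polyhedral_cone [set x | forall t, 0 <= phi t x].
Proof.
exists #|T|, (fun i => phi (enum_val i)); apply/seteqP; split=> x /= h k.
  exact: h.
by rewrite -[k](enum_rankK); apply: h.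
Qed.

(* the region where the minima that define [cap] are attained at [s] *)
Let chart (s : {ffun 'I_m -> 'I_p}) : set V :=
  [set x | D x /\ forall k i, bound k (s k) x <= bound k i x].

Let chart_polyhedral s : polyhedral_cone (chart s).
Proof.
have lin (t : 'I_p + 'I_m * 'I_p) : exists f : {linear V -> R^o}, forall x,
    f x = match t with inl i => l i x
                     | inr (k, i) => bound k i x - bound k (s k) x end.
  case: t => [i|[k i]]; first by exists (l i).
  have lf : linear (fun x => bound k i x - bound k (s k) x : R^o).
    by move=> a x y /=; rewrite !bound_linear scalerBr opprD addrACA.
  by have [F FE] := linear_bundle lf; exists F.
have [f fE] := choice lin.
suff -> : chart s = [set x | forall t, 0 <= f t x] by apply: polyhedral_fin.
apply/seteqP; split=> x /=.
  move=> [Dx sx] [i|[k i]]; rewrite fE; first exact: (D_forms _).1.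
  by rewrite subr_ge0.
move=> h; split=> [|k i].
  by apply/D_forms => i; have := h (inl i); rewrite fE.
by have := h (inr (k, i)); rewrite fE subr_ge0.
Qed.

Let selection (j : 'I_#|{ffun 'I_m -> 'I_p}|) : {ffun 'I_m -> 'I_p} := enum_val j.

Let charts_cover : D = \bigcup_(j in setT) chart (selection j).
Proof.
apply/seteqP; split=> x; last by case=> j _ [].
move=> Dx; exists (enum_rank [ffun k => least x k]) => //; rewrite /selection enum_rankK.
by split=> // k i; rewrite ffunE.
Qed.

Lemma cap_chart s x k : chart s x -> cap x k = bound k (s k) x.
Proof.
move=> [_ sx]; apply/eqP; rewrite eq_le /cap leastP /=; exact: sx.
Qed.

Theorem decoupled_cone_retractions :
  exists! lam : ({x | D x} -> {x | D x}) * ({x | D x} -> {x | D x}),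
    [/\ piecewise_linear (fun x => sval (lam.1 x)),
        piecewise_linear (fun x => sval (lam.2 x)) &
        forall x : {x | D x},
          [/\ sval (lam.1 x) + sval (lam.2 x) = sval x,
              [set y | lspan span_cone y /\ D (sval x - y)]
                = set_add [set sval (lam.1 x)] (set_opp span_cone) &
              set_add [set sval x] (lspan span_cone) `&` D
                = set_add [set sval (lam.2 x)] span_cone]].
Proof.
have val_inj (a b : {x | D x}) : sval a = sval b -> a = b.
  by case: a b => [a Da] [b Db] /= ab; apply: eq_exist.
have D_comb c : (forall k, 0 <= c k) -> D (comb c).
  move=> c0; apply/D_forms => i; rewrite lcomb; apply: sumr_ge0 => k _.
  exact: mulr_ge0.
have cap_ge0 x k : D x -> 0 <= cap x k.
  move=> Dx; suff : forall k, (fun=> 0) k <= cap x k by apply.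
  apply/(cap_max _ Dx); rewrite /comb big1 ?subr0 // => k' _; exact: scale0r.
pose lam1 (x : {x | D x}) : {x | D x} :=
  exist _ (comb (cap (sval x))) (D_comb _ (fun k => cap_ge0 _ k (svalP x))).
have D_lam2 (x : {x | D x}) : D (sval x - comb (cap (sval x))).
  by apply/cap_max => //; exact: svalP.
pose lam2 (x : {x | D x}) : {x | D x} := exist _ _ (D_lam2 x).
have /choice[L LE] : forall s : {ffun 'I_m -> 'I_p}, exists F : {linear V -> V},
    F =1 fun x => comb (fun k => bound k (s k) x).
  move=> s.
  have lf : linear (fun x => comb (fun k => bound k (s k) x)).
    move=> a x y; rewrite /comb scaler_sumr -big_split; apply: eq_bigr => k _ /=.
    by rewrite bound_linear scalerDl scalerA.
  by have [F FE] := linear_bundle lf; exists F.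
have /choice[L' LE'] : forall s : {ffun 'I_m -> 'I_p}, exists F : {linear V -> V},
    F =1 fun x => x - comb (fun k => bound k (s k) x).
  move=> s.
  have lf : linear (fun x => x - comb (fun k => bound k (s k) x)).
    by move=> a x y; rewrite -!LE linearP scalerBr opprD addrACA.
  by have [F FE] := linear_bundle lf; exists F.
have cap_comb s x : chart s x -> comb (cap x) = comb (fun k => bound k (s k) x).
  by move=> sx; apply: eq_bigr => k _; rewrite (cap_chart k sx).
exists (lam1, lam2); split; first split.
- exists _, (fun j => chart (selection j)), (fun j => L (selection j)).
  split=> // j x sx; rewrite LE /=; exact: cap_comb.
- exists _, (fun j => chart (selection j)), (fun j => L' (selection j)).
  split=> // j x sx; rewrite LE' /=; congr (_ - _); exact: cap_comb.
- move=> [x Dx] /=; split; first by rewrite addrC subrK.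
    apply/seteqP; split=> y.
      move=> [/lspan_cone[c ->]] /(cap_max _ Dx) ccap.
      exists (comb (cap x)) => //; exists (- comb (fun k => cap x k - c k)).
        exists (comb (fun k => cap x k - c k)) => //.
        by exists (fun k => cap x k - c k) => // k; rewrite subr_ge0.
      by rewrite combN combD; apply: eq_bigr => k _; rewrite opprB addrC subrK.
    move=> [_ -> [_ [_ [b b0 ->] <-] <-]].
    have -> : comb (cap x) - comb b = comb (fun k => cap x k - b k).
      by rewrite combN combD.
    split; first by apply/lspan_cone; eexists.
    by apply/cap_max => // k; rewrite lerBlDr lerDl.
  apply/seteqP; split=> y.
    move=> [[_ -> [_ /lspan_cone[c ->] <-]]] Dxc.
    have ccap k : - c k <= cap x k.
      move: k; apply/(cap_max _ Dx); rewrite -combN opprK //.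
    exists (x - comb (cap x)) => //; exists (comb (fun k => cap x k + c k)).
      by exists (fun k => cap x k + c k) => // k; rewrite -[c k]opprK subr_ge0.
    by rewrite -addrA combN combD; congr (_ + _); apply: eq_bigr => k _; rewrite addKr.
  move=> [_ -> [_ [b b0 ->] <-]].
  have E : x - comb (cap x) + comb b = x - comb (fun k => cap x k - b k).
    by rewrite -combD -combN opprD opprK addrA.
  split.
    exists x => //; exists (- comb (fun k => cap x k - b k)); last by rewrite -E.
    by apply/lspan_cone; rewrite combN; eexists.
  rewrite -[_ + \sum_k _]/(_ + comb b) E.
  by apply/cap_max => // k; rewrite lerBlDr lerDl.
- move=> [mu1 mu2] [_ _ mu] /=.
  have E1 x : lam1 x = mu1 x.
    have [_ h _] := mu x; case: x h => x Dx /=; set x' := exist _ _ _ => h.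
    have lam_in : set_add [set sval (mu1 x')] (set_opp span_cone) (comb (cap x)).
      rewrite -h /=; split; first by apply/lspan_cone; eexists.
      by apply/cap_max.
    have mu_in : lspan span_cone (sval (mu1 x')) /\ D (x - sval (mu1 x')).
      have : set_add [set sval (mu1 x')] (set_opp span_cone) (sval (mu1 x')).
        exists (sval (mu1 x')) => //; exists 0; last by rewrite addr0.
        exists 0; last by rewrite oppr0.
        by exists (fun=> 0) => //; rewrite big1 // => k _; rewrite scale0r.
      by rewrite -h.
    have [/lspan_cone[c cE] Dc] := mu_in.
    have ccap : forall k, c k <= cap x k by apply/(cap_max _ Dx); rewrite -cE.
    have [_ -> [_ [y yC <-] yE]] := lam_in.
    have y0 : y = 0.
      apply: span_cone_pointed => //; exists (fun k => cap x k - c k) => [k|].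
        by rewrite subr_ge0.
      rewrite -[RHS]/(comb _) -combD -combN -yE cE.
      by rewrite addrAC subrr add0r.
    by apply: val_inj; rewrite /= -yE y0 oppr0 addr0.
  congr (_, _); apply/funext => x; first exact: E1.
  have [e _ _] := mu x; apply: val_inj.
  by move: e; rewrite /= -(E1 x) /= => h; apply/eqP; rewrite subr_eq addrC h.
Qed.

End DecoupledCone.

(** * Finitely many forms come from the factors of a module *)

Section FiniteForms.
Variables (R : realType) (K : fieldType) (A : falgType K).
Implicit Types (M N X Y Z : fdmod A).

Lemma euler_additive (theta : K0R R A) : additive_fun (euler theta).
Proof. by move=> X Y Z i p; apply: euler_exact. Qed.

(** By induction on the dimension: a proper nonzero submodule W of [M] cuts each
    factor of [M] into a factor of W and a factor of M / W. *)
Lemma finite_factor_forms M : exists n (f : 'I_n -> K0R R A -> R),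
  forall X, is_factor M X -> exists i, forall theta : K0R R A, euler theta X = f i theta.
Proof.
have [d] := ubnP (\dim {: M}); elim: d M => // d IH M ltMd.
have zX X : is_factor M X -> ~ nonzero X -> forall theta : K0R R A, euler theta X = 0.
  by move=> _ nX theta; exact: (additive_zero (@euler_additive theta) nX).
have [[W [stW [W0 W1]]]|simple] := pselect (exists W : {vspace M},
    is_submod W /\ W <> 0%VS /\ W <> fullv); last first.
  exists 2%N, (fun i theta => if i == 0 then euler theta M else 0) => X fX.
  have [q hq sq] := fX.
  have [V [v ex]] := ker_exact hq sq; have [hv _ kv vq _] := ex.
  have [q0|/eqP q0] := pselect (lker q = 0%VS).
    have nV : ~ nonzero V.
      move=> [x /negP]; apply; apply/eqP/(iffLR (lker_inj v) kv).
      by apply/eqP; rewrite -memv0 -q0 -vq mem_limg.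
    exists 0 => theta; have := euler_exact theta ex.
    by rewrite (additive_zero (@euler_additive theta) nV) add0r.
  exists 1 => theta; apply: zX => //= - [x]; have [y <-] := (limg_full q).1 sq x.
  rewrite -memv_ker; have [->|/eqP q1] := pselect (lker q = fullv); first by rewrite memvf.
  case: simple; exists (lker q); split; first exact: lker_submod.
  by split; apply/eqP.
have [i hi iE] := sub_inclP stW; have [c hc cE] := quot_projP stW.
have dW : (0 < \dim W < \dim {: M})%N.
  rewrite lt0n dimv_eq0; apply/andP; split; first exact/eqP.
  rewrite ltnNge; apply/negP => le; apply: W1; apply/eqP.
  by rewrite eqEdim subvf.
have dimS (V : {vspace M}) : \dim {: subvs_of V} = \dim V by rewrite dimvf.
have [|n1 [f1 F1]] := IH (sub_mod stW); first by rewrite dimS; lia.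
have [|n2 [f2 F2]] := IH (quot_mod stW).
  rewrite dimS dimv_compl; lia.
exists #|{: 'I_n1 * 'I_n2}|, (fun j theta => f1 (enum_val j).1 theta + f2 (enum_val j).2 theta).
move=> X [q hq sq].
have hqi : is_modhom (q \o i)%VF by apply: modhom_comp.
have [I [p [k [hp hk sp kk kp]]]] := image_exact hqi.
have [Z [r [hr kr sr]]] := coker_exact hk.
have [|i1 E1] := F1 I; first by exists p.
have [|i2 E2] := F2 Z.
  have [|h hh hE] := quot_factor stW (modhom_comp hr hq).
    apply/subvP => x xW; rewrite memv_ker comp_lfunE -memv_ker -kr.
    have -> : x = i (vsproj W x) by rewrite iE vsprojK.
    by rewrite -comp_lfunE -kp comp_lfunE mem_limg.
  exists h => //; apply/limg_full => z; have [x <-] := (limg_full r).1 sr z.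
  by have [y <-] := (limg_full q).1 sq x; exists (quot_proj W y); rewrite hE comp_lfunE.
exists (enum_rank (i1, i2)) => theta; rewrite enum_rankK /= -E1 -E2.
by apply: (euler_exact theta (i := k) (p := r)); split.
Qed.

Lemma finite_factors M : exists n (X : 'I_n -> fdmod A), (forall i, is_factor M (X i)) /\
  forall Y, is_factor M Y -> exists i, forall theta : K0R R A,
    euler theta Y = euler theta (X i).
Proof.
have [n [f fE]] := finite_factor_forms M.
have M_factor : is_factor M M.
  by exists \1%VF; [exact: modhom1 | rewrite lim1g].
have /choice[X XE] : forall i : 'I_n, exists X, is_factor M X /\
    forall Y, is_factor M Y -> (forall theta : K0R R A, euler theta Y = f i theta) ->
      forall theta : K0R R A, euler theta Y = euler theta X.
  move=> i; have [[X [fX XE]]|no] := pselect (exists X, is_factor M X /\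
      forall theta : K0R R A, euler theta X = f i theta).
    by exists X; split=> // Y _ YE theta; rewrite YE XE.
  by exists M; split=> // Y fY YE; case: no; exists Y.
exists n, X; split=> [i|Y fY]; first by case: (XE i).
by have [i iE] := fE _ fY; exists i; case: (XE i) => _; apply.
Qed.

(** The class of a submodule is determined by that of its quotient. *)
Lemma finite_subobjects N : exists n (Y : 'I_n -> fdmod A),
  (forall i, is_subobject N (Y i)) /\
  forall Z, is_subobject N Z -> exists i, forall theta : K0R R A,
    euler theta Z = euler theta (Y i).
Proof.
have [n [X [fX XE]]] := finite_factors N.
have /choice[Y YE] : forall i : 'I_n, exists Y, is_subobject N Y /\
    forall theta : K0R R A, euler theta N = euler theta Y + euler theta (X i).
  move=> i; have [q hq sq] := fX i; have [Y [v ex]] := ker_exact hq sq.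
  exists Y; split; last by move=> theta; apply: euler_exact ex.
  by case: ex => hv _ kv _ _; exists v.
exists n, Y; split=> [i|Z [v hv kv]]; first by case: (YE i).
have [C [c [hc vc sc]]] := coker_exact hv.
have [|i iE] := XE C; first by exists c.
exists i => theta; have [_ /(_ theta)] := YE i.
rewrite (euler_exact theta (i := v) (p := c)) // iE.
exact: addIr.
Qed.

End FiniteForms.

(** * Duality between extensions and maps to the Nakayama functor *)

Section NakayamaDuality.
Variables (K : fieldType) (A : falgType K).
Implicit Types (M N X Y W P : fdmod A).

Section Power.
Variable r : nat.

Definition power_act (v : {ffun 'I_r -> A}) (a : A) : {ffun 'I_r -> A} :=
  [ffun b => v b * a].

Lemma power_actP : is_right_action power_act.
Proof.
split.
- by move=> a k v w; apply/ffunP => b; rewrite !ffunE mulrDl scalerAl.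
- by move=> v k a a'; apply/ffunP => b; rewrite !ffunE mulrDr scalerAr.
- by move=> v; apply/ffunP => b; rewrite !ffunE mulr1.
- by move=> v a a'; apply/ffunP => b; rewrite !ffunE mulrA.
Qed.

Definition power_mod : fdmod A := FdMod power_actP.

End Power.

Lemma act_suml M I (s : seq I) (Q : pred I) (x : I -> M) (a : A) :
  act (\sum_(i <- s | Q i) x i) a = \sum_(i <- s | Q i) act (x i) a.
Proof. by rewrite -ractE linear_sum; apply: eq_bigr => i _; rewrite /= ractE. Qed.

(** A dual basis comes from a section of the epimorphism from a free module given
    by a finite set of generators. *)
Lemma dual_basis P : is_projective P ->
  exists r (x : 'I_r -> P) (e : 'I_r -> subvs_of (modhom P (reg_mod A))),
    forall y, y = \sum_b act (x b) (vsval (e b) y).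
Proof.
move=> pP; pose r := \dim {: P}; pose x (b : 'I_r) := (vbasis {: P})`_b.
have [l1 l2 l3 l4] := actP P.
have lg : linear (fun v : power_mod r => \sum_b act (x b) (v b)).
  move=> k v w; rewrite scaler_sumr -big_split; apply: eq_bigr => b _ /=.
  by rewrite !ffunE l2.
have [g gE] := linear_lfun lg.
have hg : is_modhom g.
  move=> v a; rewrite !gE act_suml; apply: eq_bigr => b _.
  by rewrite ffunE l4.
have [|h hh gh] := pP _ _ g \1%VF hg _ (@modhom1 _ _ P).
  apply/limg_full => y; exists [ffun b => coord (vbasis {: P}) b y *: 1].
  rewrite gE [RHS](coord_vbasis (memvf y)); apply: eq_bigr => b _.
  have [L LE] := linear_bundle (l2 (x b)).
  by rewrite ffunE -LE linearZ /= LE l3.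
have ev b : exists e : subvs_of (modhom P (reg_mod A)), forall y, vsval e y = h y b.
  have le : linear (fun y : P => h y b : reg_mod A).
    by move=> k y z; rewrite linearP !ffunE.
  have [e eE] := linear_lfun le.
  have he : is_modhom e by move=> y a; rewrite !eE hh ffunE.
  by exists (vsproj _ e) => y; rewrite vsprojK ?eE //; apply/modhomP.
have [e eE] := choice ev; exists r, x, e => y.
have := congr1 (fun f : 'Hom(P, P) => f y) gh.
rewrite comp_lfunE id_lfunE gE => {1}<-; apply: eq_bigr => b _.
by rewrite eE.
Qed.

Definition orbit_map W (y : W) : 'Hom(reg_mod A, W) := linfun (act y : A -> W).

Lemma orbit_mapE W (y : W) a : orbit_map y a = act y a.
Proof.
have [_ l _ _] := actP W; have [L LE] := linear_bundle (l y).
have yL : act y = L by apply/funext => b; rewrite LE.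
by rewrite /orbit_map yL (lfunE L).
Qed.

Lemma orbit_map_modhom W (y : W) : is_modhom (orbit_map y).
Proof. by move=> a b; rewrite !orbit_mapE; have [_ _ _ h] := actP W; apply: h. Qed.

Lemma orbit_map_act W (y : W) a P (e : subvs_of (modhom P (reg_mod A))) :
  (orbit_map (act y a) \o vsval e = orbit_map y \o vsval (dual_lact a e))%VF.
Proof.
apply/lfunP => x; rewrite !comp_lfunE !orbit_mapE dual_lactE.
by have [_ _ _ ->] := actP W.
Qed.

Lemma orbit_map_comp_modhom W (y : W) P (e : subvs_of (modhom P (reg_mod A))) :
  is_modhom (orbit_map y \o vsval e)%VF.
Proof. by apply: modhom_comp; [exact: orbit_map_modhom | apply/modhomP/subvsP]. Qed.

Lemma separating_form (V : vectType K) (L : {vspace V}) u : u \notin L ->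
  exists2 xi : 'Hom(V, K^o), (L <= lker xi)%VS & xi u != 0.
Proof.
move=> uL; pose z := u - projv L u.
have z0 : z != 0.
  by apply: contraNneq uL => /eqP; rewrite subr_eq0 => /eqP ->; apply: memv_proj.
have [i ci] : exists i, coord (vbasis {: V}) i z != 0.
  apply: contrapT => no; move/eqP: z0; apply.
  rewrite (coord_vbasis (memvf z)) big1 // => i _.
  have [->|ci] := eqVneq (coord (vbasis {: V}) i z) 0; first exact: scale0r.
  by case: no; exists i.
have lx : linear (fun v => coord (vbasis {: V}) i ((\1 - projv L)%VF v) : K^o).
  by move=> k v w; rewrite !linearP.
have [xi xiE] := linear_lfun lx; exists xi; last by rewrite xiE !lfE.
by apply/subvP => v vL; rewrite memv_ker xiE !lfE projv_id // subrr linear0.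
Qed.

(** A linear form [xi] on Hom(pr1 p, W) defines a homomorphism from W to
    nu(pr1 p), sending [y] to the form [e |-> xi (y e)], where [y e] is
    [x |-> act y (e x)].  It is killed by the differential when [xi] vanishes on the
    null maps, and it is nonzero if [xi] is, because the maps [y e] span the space
    of homomorphisms, by the dual basis. *)
Lemma ext_detected_by_nu (p : presentation A) W : ~ ext_free p W ->
  exists phi : 'Hom(W, nu_mod (pr1 p)),
    [/\ is_modhom phi, (nu_map (prd p) \o phi)%VF = 0 & phi != 0].
Proof.
move=> /existsNP[u /not_implyP[hu nu]].
pose L := (linfun (@precomp _ _ _ _ W (prd p)) @: modhom (pr0 p) W)%VS.
have uL : u \notin L.
  apply/negP => /memv_imgP[s /modhomP hs us]; apply: nu; exists s => //.
  by rewrite us lfunE.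
have [xi Lxi xiu] := separating_form uL.
pose H := subvs_of (modhom (pr1 p) (reg_mod A)).
have inner (y : W) : exists f : nu_mod (pr1 p), forall e : H,
    (f : 'Hom(H, K^o)) e = xi (orbit_map y \o vsval e)%VF.
  have lf : linear (fun e : H => xi (orbit_map y \o vsval e)%VF).
    by move=> k e e'; rewrite linearP comp_lfunDr -comp_lfunZr linearP.
  by have [f fE] := linear_lfun lf; exists f.
have [phi phiE] := choice inner.
have lphi : linear phi.
  move=> k y z; apply/lfunP => e; rewrite !(lfE, phiE) -linearP; congr (xi _).
  apply/lfunP => x; rewrite !(lfE, orbit_mapE).
  by have [-> _ _ _] := actP W.
have [Phi PhiE] := linear_lfun lphi; exists Phi; split.
- move=> y a; apply/lfunP => e; rewrite nu_actE !PhiE !phiE; congr (xi _).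
  exact: orbit_map_act.
- apply/lfunP => y; apply/lfunP => e; rewrite comp_lfunE nu_mapE PhiE phiE !lfE.
  apply/eqP; rewrite -memv_ker; apply: (subvP Lxi); apply/memv_imgP.
  exists (orbit_map y \o vsval e)%VF; first exact/modhomP/orbit_map_comp_modhom.
  rewrite lfunE; apply/lfunP => x; rewrite /= /precomp !comp_lfunE.
  by rewrite dual_mapE //; apply: prd_modhom.
- apply: contraNneq xiu => Phi0.
  have [r [x [e xe]]] := dual_basis (pr1_projective p).
  have -> : u = \sum_b (orbit_map (u (x b)) \o vsval (e b))%VF.
    apply/lfunP => y; rewrite {1}(xe y) linear_sum sum_lfunE; apply: eq_bigr => b _ /=.
    by rewrite comp_lfunE orbit_mapE hu.
  rewrite linear_sum big1 //= => b _; rewrite -phiE -PhiE Phi0.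
  by rewrite !zero_lfunE.
Qed.

Lemma dual_basis_expand P r (x : 'I_r -> P)
    (e : 'I_r -> subvs_of (modhom P (reg_mod A))) (f : subvs_of (modhom P (reg_mod A))) :
  (forall y, y = \sum_b act (x b) (vsval (e b) y)) ->
  f = \sum_b dual_lact (vsval f (x b)) (e b).
Proof.
move=> xe; apply: subvs_inj; apply/lfunP => y; rewrite {1}(xe y) !linear_sum.
rewrite sum_lfunE; apply: eq_bigr => b _ /=; rewrite dual_lactE.
by have /modhomP -> := subvsP f.
Qed.

(** Conversely [phi y f] depends only on the homomorphism [u = y f], through
    [phi y f = \sum_b phi (u (x b)) (e b)] for a dual basis.  If [u] factors through
    the differential, so does this expression, and it vanishes. *)
Lemma ext_free_no_nu_map (p : presentation A) Y (phi : 'Hom(Y, nu_mod (pr1 p))) :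
  ext_free p Y -> is_modhom phi -> (nu_map (prd p) \o phi)%VF = 0 -> phi = 0.
Proof.
move=> ext hphi dphi.
have [r [x [e xe]]] := dual_basis (pr1_projective p).
have [r' [x' [e' xe']]] := dual_basis (pr0_projective p).
have phi_act y a f : (phi (act y a) : 'Hom(_, K^o)) f = (phi y : 'Hom(_, K^o)) (dual_lact a f).
  by rewrite hphi nu_actE.
apply/lfunP => y; apply/lfunP => f; rewrite !zero_lfunE.
have [s hs sE] := ext _ (orbit_map_comp_modhom y f).
have yfs b : act y (vsval f (x b)) = s (prd p (x b)).
  by have /lfunP/(_ (x b)) := sE; rewrite !comp_lfunE orbit_mapE.
rewrite (dual_basis_expand f xe) linear_sum /=.
under eq_bigr => b _.
  rewrite -phi_act yfs {1}(xe' (prd p (x b))).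
  rewrite (linear_sum s) (linear_sum phi) sum_lfunE; under eq_bigr do rewrite /= hs phi_act.
  over.
rewrite exchange_big big1 // => c _; rewrite -linear_sum /=.
have hd := prd_modhom p.
have -> : \sum_b dual_lact (vsval (e' c) (prd p (x b))) (e b) = dual_map (prd p) (e' c).
  rewrite [RHS](dual_basis_expand _ xe); apply: eq_bigr => b _.
  by rewrite dual_mapE.
by rewrite -nu_mapE -[nu_map _ _]comp_lfunE dphi !zero_lfunE.
Qed.

End NakayamaDuality.

(** * Homotopy classes of chain maps *)

Section Homotopy.
Variables (K : fieldType) (A : falgType K).
Implicit Types (X Y Z : cplx A).

Lemma grmapP X Y (f g : grmap X Y) : (forall i, f i = g i) -> f = g.
Proof. exact: functional_extensionality_dep. Qed.

Lemma chain_map1 X : is_chain_map (gr1 X).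
Proof.
by split=> [i|i j]; [exact: modhom1 | rewrite comp_lfun1l comp_lfun1r].
Qed.

Lemma chain_map_comp X Y Z (g : grmap Y Z) (f : grmap X Y) :
  is_chain_map g -> is_chain_map f -> is_chain_map (grcomp g f).
Proof.
move=> [hg gd] [hf fd]; split=> [i|i j]; first exact: modhom_comp.
by rewrite /grcomp -comp_lfunA fd !comp_lfunA gd.
Qed.

Lemma homotopic_refl X Y (f : grmap X Y) : homotopic f f.
Proof.
exists (fun i j => 0) => [i j|i]; first exact: modhom0.
by rewrite subrr comp_lfun0l comp_lfun0r addr0.
Qed.

Lemma homotopicD X Y (f g f' g' : grmap X Y) : homotopic f g -> homotopic f' g' ->
  homotopic (fun i => f i + f' i) (fun i => g i + g' i).
Proof.
move=> [s hs sE] [t ht tE]; exists (fun i j => s i j + t i j) => [i j|i].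
  exact: modhomD.
rewrite opprD addrACA sE tE comp_lfunDl comp_lfunDr.
by rewrite addrACA.
Qed.

Lemma homotopicN X Y (f g : grmap X Y) :
  homotopic f g -> homotopic (fun i => - f i) (fun i => - g i).
Proof.
move=> [s hs sE]; exists (fun i j => - s i j) => [i j|i]; first exact: modhomN.
by rewrite -opprD sE comp_lfunNr comp_lfunNl opprD.
Qed.

Lemma homotopic_sym X Y (f g : grmap X Y) : homotopic f g -> homotopic g f.
Proof.
move=> /homotopicN[s hs sE]; exists s => // i.
by rewrite -sE opprK addrC.
Qed.

Lemma homotopic_trans X Y (g f h : grmap X Y) :
  homotopic f g -> homotopic g h -> homotopic f h.
Proof.
move=> [s hs sE] [t ht tE]; exists (fun i j => s i j + t i j) => [i j|i].
  exact: modhomD.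
by rewrite -(subrKA (g i)) sE tE comp_lfunDl comp_lfunDr addrACA.
Qed.

Lemma homotopic_compl X Y Z (g : grmap Y Z) (f f' : grmap X Y) :
  is_chain_map g -> homotopic f f' -> homotopic (grcomp g f) (grcomp g f').
Proof.
move=> [hg gd] [s hs sE]; exists (fun i j => g j \o s i j)%VF => [i j|i].
  exact: modhom_comp.
rewrite /grcomp -comp_lfunNr -comp_lfunDr sE comp_lfunDr !comp_lfunA.
by rewrite gd.
Qed.

Lemma homotopic_compr X Y Z (g g' : grmap Y Z) (f : grmap X Y) :
  is_chain_map f -> homotopic g g' -> homotopic (grcomp g f) (grcomp g' f).
Proof.
move=> [hf fd] [s hs sE]; exists (fun i j => s i j \o f i)%VF => [i j|i].
  exact: modhom_comp.
rewrite /grcomp -comp_lfunNl -comp_lfunDl sE comp_lfunDl -!comp_lfunA.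
by rewrite fd.
Qed.

Lemma homotopic_sum X Y m (f g : 'I_m -> grmap X Y) :
  (forall k, homotopic (f k) (g k)) -> homotopic (grsum f) (grsum g).
Proof.
move=> fg; suff H (r : seq 'I_m) : homotopic (fun i => \sum_(k <- r) f k i)
    (fun i => \sum_(k <- r) g k i) by apply: H.
elim: r => [|k r IH].
  rewrite (_ : (fun i => _) = gr0 X Y); last by apply: grmapP => i; rewrite big_nil.
  rewrite (_ : (fun i => _) = gr0 X Y); last by apply: grmapP => i; rewrite big_nil.
  exact: homotopic_refl.
rewrite (_ : (fun i => _) = fun i => f k i + \sum_(k <- r) f k i); last first.
  by apply: grmapP => i; rewrite big_cons.
rewrite (_ : (fun i => \sum_(j <- k :: r) g j i) =
    fun i => g k i + \sum_(k <- r) g k i); last first.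
  by apply: grmapP => i; rewrite big_cons.
exact: homotopicD.
Qed.

(** The degrees are variables, so that in concrete degrees the objects are those
    named by literals and not by [i - 1] and [i + 1]. *)
Lemma homotopic_at X Y (f g : grmap X Y) : homotopic f g ->
  exists2 s : forall i j, 'Hom(X i, Y j), forall i j, is_modhom (s i j) &
    forall h i j, h + 1 = i -> i + 1 = j ->
      f i - g i = ((cdiff Y h i \o s i h) + (s j i \o cdiff X i j))%VF.
Proof.
move=> [s hs sE]; exists s => // h i j hi <-.
have -> : h = i - 1 by rewrite -hi addrK.
exact: sE.
Qed.

Definition grpow X (f : grmap X X) n : grmap X X :=
  fun i => iter n (comp_lfun (f i)) \1%VF.

Lemma chain_map_pow X (f : grmap X X) n : is_chain_map f -> is_chain_map (grpow f n).
Proof.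
move=> hf; elim: n => [|n IH]; first exact: chain_map1.
exact: chain_map_comp hf IH.
Qed.

Lemma grpowSr X (f : grmap X X) n : grpow f n.+1 = grcomp (grpow f n) f.
Proof. by apply: grmapP => i; rewrite /grcomp iter_comp_lfun. Qed.

Lemma homotopic_powl X Y (f : grmap X X) (g : grmap X Y) n :
  is_chain_map f -> is_chain_map g ->
  homotopic (grcomp g f) g -> homotopic (grcomp g (grpow f n)) g.
Proof.
move=> hf hg gf; elim: n => [|n IH].
  rewrite (_ : grcomp _ _ = g); first exact: homotopic_refl.
  by apply: grmapP => i; rewrite /grcomp comp_lfun1r.
rewrite grpowSr (_ : grcomp _ _ = grcomp (grcomp g (grpow f n)) f); last first.
  by apply: grmapP => i; rewrite /grcomp comp_lfunA.
by apply: homotopic_trans gf; apply: homotopic_compr.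
Qed.

Lemma Kiso_sym X Y : Kiso X Y -> Kiso Y X.
Proof. by move=> [f [g [hf hg gf fg]]]; exists g, f. Qed.

Lemma Kdsum_iso m X X' (Y Y' : 'I_m -> cplx A) :
  Kiso X X' -> (forall k, Kiso (Y k) (Y' k)) -> Kdsum X Y -> Kdsum X' Y'.
Proof.
move=> [f [f' [hf hf' ff fi]]] YY [io [pi [hio hpi pio pio0 sum1]]].
have gP k := cid (YY k); pose g k := sval (gP k).
have g'P k := cid (svalP (gP k)); pose g' k := sval (g'P k).
have hg k : is_chain_map (g k) by case: (svalP (g'P k)).
have hg' k : is_chain_map (g' k) by case: (svalP (g'P k)).
have g'g k : homotopic (grcomp (g' k) (g k)) (gr1 _) by case: (svalP (g'P k)).
have gg' k : homotopic (grcomp (g k) (g' k)) (gr1 _) by case: (svalP (g'P k)).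
have pfi k l (h : grmap (Y k) (Y l)) : homotopic (grcomp (pi l) (io k)) h ->
    homotopic (grcomp (grcomp (g l) (grcomp (pi l) f')) (grcomp f (grcomp (io k) (g' k))))
      (grcomp (g l) (grcomp h (g' k))).
  move=> ph; rewrite (_ : grcomp _ _ =
    grcomp (grcomp (g l) (pi l)) (grcomp (grcomp f' f) (grcomp (io k) (g' k)))); last first.
    by apply: grmapP => i; rewrite /grcomp !comp_lfunA.
  have hgp : is_chain_map (grcomp (g l) (pi l)) by apply: chain_map_comp.
  have hig : is_chain_map (grcomp (io k) (g' k)) by apply: chain_map_comp.
  apply: homotopic_trans (homotopic_compl hgp (homotopic_compr hig ff)) _.
  rewrite (_ : grcomp _ _ = grcomp (g l) (grcomp (grcomp (pi l) (io k)) (g' k))).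
    by apply: homotopic_compl => //; apply: homotopic_compr.
  by apply: grmapP => i; rewrite /grcomp !comp_lfunA comp_lfun1r.
exists (fun k => grcomp f (grcomp (io k) (g' k))).
exists (fun k => grcomp (g k) (grcomp (pi k) f')); split.
- by move=> k; do 2![apply: chain_map_comp => //].
- by move=> k; do 2![apply: chain_map_comp => //].
- move=> k; apply: homotopic_trans (pfi _ _ _ (pio k)) _.
  rewrite (_ : grcomp _ _ = grcomp (g k) (g' k)) //.
  by apply: grmapP => i; rewrite /grcomp comp_lfun1l.
- move=> k l kl; apply: homotopic_trans (pfi _ _ _ (pio0 _ _ kl)) _.
  rewrite (_ : grcomp _ _ = gr0 _ _); first exact: homotopic_refl.
  by apply: grmapP => i; rewrite /grcomp comp_lfun0l comp_lfun0r.
- apply: homotopic_trans fi.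
  apply: (@homotopic_trans _ _ (grsum (fun k => grcomp f (grcomp (grcomp (io k) (pi k)) f')))).
    apply: homotopic_sum => k.
    rewrite (_ : grcomp _ _ =
      grcomp (grcomp f (io k)) (grcomp (grcomp (g' k) (g k)) (grcomp (pi k) f'))); last first.
      by apply: grmapP => i; rewrite /grcomp !comp_lfunA.
    rewrite (_ : grcomp f _ =
      grcomp (grcomp f (io k)) (grcomp (gr1 _) (grcomp (pi k) f'))); last first.
      by apply: grmapP => i; rewrite /grcomp !comp_lfunA comp_lfun1r.
    by apply: homotopic_compl; [|apply: homotopic_compr => //]; apply: chain_map_comp.
  rewrite (_ : grsum _ = grcomp f (grcomp (grsum (fun k => grcomp (io k) (pi k))) f')).
    rewrite [X in homotopic _ X](_ : _ = grcomp f (grcomp (gr1 _) f')); last first.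
      by apply: grmapP => i; rewrite /grcomp comp_lfun1l.
    by apply: homotopic_compl => //; apply: homotopic_compr.
  apply: grmapP => i; rewrite /grcomp /grsum; apply/lfunP => x.
  rewrite !(comp_lfunE, sum_lfunE) linear_sum; apply: eq_bigr => k _ /=.
  by rewrite !comp_lfunE.
Qed.

Lemma Kiso_refl X : Kiso X X.
Proof.
have E : grcomp (gr1 X) (gr1 X) = gr1 X.
  by apply: grmapP => i; rewrite /grcomp comp_lfun1l.
exists (gr1 X), (gr1 X); rewrite E.
by split; [exact: chain_map1|exact: chain_map1|exact: homotopic_refl|exact: homotopic_refl].
Qed.

Lemma Kzero_iso X Y : Kiso X Y -> Kzero X -> Kzero Y.
Proof.
move=> [f [g [hf hg gf fg]]] X0; apply: homotopic_trans (homotopic_sym fg) _.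
rewrite (_ : grcomp _ _ = grcomp f (grcomp (gr1 X) g)); last first.
  by apply: grmapP => i; rewrite /grcomp comp_lfun1l.
rewrite (_ : gr0 _ _ = grcomp f (grcomp (gr0 X X) g)); last first.
  by apply: grmapP => i; rewrite /grcomp comp_lfun0l comp_lfun0r.
by apply: homotopic_compl => //; apply: homotopic_compr.
Qed.

Lemma Kzero_retract X Y (s : grmap Y X) (c : grmap X Y) : is_chain_map s ->
  is_chain_map c -> Kzero Y -> homotopic (grcomp s c) (gr0 X X).
Proof.
move=> hs hc Y0; rewrite (_ : grcomp _ _ = grcomp s (grcomp (gr1 Y) c)); last first.
  by apply: grmapP => i; rewrite /grcomp comp_lfun1l.
rewrite (_ : gr0 _ _ = grcomp s (grcomp (gr0 Y Y) c)); last first.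
  by apply: grmapP => i; rewrite /grcomp comp_lfun0l comp_lfun0r.
by apply: homotopic_compl => //; apply: homotopic_compr.
Qed.

(** ** Splitting idempotent chain maps *)

Lemma retract_projective (P Q : fdmod A) (s : 'Hom(Q, P)) (c : 'Hom(P, Q)) :
  is_modhom s -> is_modhom c -> (c \o s = \1)%VF -> is_projective P -> is_projective Q.
Proof.
move=> hs hc cs pP M N g f hg sg hf.
have [h hh gh] := pP M N g (f \o c)%VF hg sg (modhom_comp hf hc).
exists (h \o s)%VF; first exact: modhom_comp.
by rewrite comp_lfunA gh -comp_lfunA cs comp_lfun1r.
Qed.

(** The image of an idempotent chain map, taken in each degree. *)
Lemma split_idempotent (X : Kbproj A) (e : grmap X X) :
  is_chain_map e -> (forall i, (e i \o e i = e i)%VF) ->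
  exists (Y : Kbproj A) (s : grmap Y X) (c : grmap X Y),
    [/\ is_chain_map s, is_chain_map c, forall i, (c i \o s i = \1)%VF,
        forall i, (s i \o c i = e i)%VF &
        forall i, is_zero_mod (X i) -> is_zero_mod (Y i)].
Proof.
move=> [he ed] ee.
pose Y i := sub_mod (limg_submod (he i)).
have sP i := cid2 (sub_inclP (limg_submod (he i))); pose s i : 'Hom(Y i, X i) := s2val (sP i).
have hs i : is_modhom (s i) := s2valP (sP i).
have sE i (y : Y i) : s i y = vsval y by exact: (s2valP' (sP i)).
have cP i := cid2 (sub_factor (limg_submod (he i)) (he i) (subvv _)).
pose c i : 'Hom(X i, Y i) := s2val (cP i).
have hc i : is_modhom (c i) := s2valP (cP i).
have cE i (x : X i) : vsval (c i x) = e i x by exact: (s2valP' (cP i)).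
have sc i : (s i \o c i = e i)%VF by apply/lfunP => x; rewrite comp_lfunE sE cE.
have cs i : (c i \o s i = \1)%VF.
  apply/lfunP => y; rewrite comp_lfunE id_lfunE; apply: subvs_inj.
  have /memv_imgP[x _ xE] := subvsP y.
  by rewrite cE sE xE -comp_lfunE ee.
pose d i j := (c j \o cdiff X i j \o s i)%VF.
have hd i j : is_modhom (d i j).
  by do 2![apply: modhom_comp => //]; apply: cdiff_modhom.
have sh i j : j != i + 1 -> d i j = 0.
  by move=> ij; rewrite /d cdiff_shape // comp_lfun0r comp_lfun0l.
have sd i j : (s j \o d i j = cdiff X i j \o s i)%VF.
  rewrite /d !comp_lfunA sc ed -comp_lfunA.
  by rewrite -sc -comp_lfunA cs comp_lfun1r.
have dc i j : (c j \o cdiff X i j = d i j \o c i)%VF.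
  rewrite /d -!comp_lfunA sc -ed -sc !comp_lfunA.
  by rewrite cs comp_lfun1l.
have dd i j k : (d j k \o d i j)%VF = 0.
  rewrite {1}/d -!comp_lfunA sd (comp_lfunA (cdiff X j k)) cdiff_comp.
  by rewrite comp_lfun0l comp_lfun0r.
pose CY := Cplx hd sh dd.
have zY i : is_zero_mod (X i) -> is_zero_mod (Y i).
  move=> /zero_space z; apply/eqP; rewrite dimv_eq0 -subv0; apply/subvP => y _.
  by rewrite memv0; apply/eqP/subvs_inj; rewrite [LHS](z (vsval y)).
have pY i : is_projective (CY i).
  exact: (retract_projective (hs i) (hc i) (cs i) (kb_projective X i)).
have bY : exists n : nat, forall i, (n < `|i|)%N -> is_zero_mod (CY i).
  by have [n nX] := kb_bounded X; exists n => i ni; apply/zY/nX.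
by exists (KbProj pY bY), s, c; split.
Qed.

End Homotopy.

(** * Fitting decompositions *)

Section Fitting.
Variable K : fieldType.
Implicit Types V W : vectType K.

Definition stable_img V (f : 'End(V)) := limg (f \o f) = limg f.

Definition fit_proj V (f : 'End(V)) : 'End(V) := daddv_pi (limg f) (lker f).

(** The Drazin inverse of [f], when the image of [f] is stable. *)
Definition fit_inv V (f : 'End(V)) : 'End(V) := (fit_proj f \o f^-1 \o fit_proj f)%VF.

Lemma stable_img_cap V (f : 'End(V)) : stable_img f -> (limg f :&: lker f = 0)%VS.
Proof.
move=> st; apply/eqP; rewrite -dimv_eq0; apply/eqP.
have := limg_ker_dim f (limg f); rewrite -limg_comp st.
by rewrite -[RHS]add0n => /addIn.
Qed.

Lemma stable_img_add V (f : 'End(V)) : stable_img f -> (limg f + lker f = fullv)%VS.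
Proof.
move=> st; apply/eqP; rewrite eqEdim subvf dimv_disjoint_sum ?stable_img_cap //=.
by rewrite -(limg_ker_dim f fullv) capfv addnC.
Qed.

Lemma fit_proj_img V (f : 'End(V)) x : fit_proj f x \in limg f.
Proof. exact: memv_pi. Qed.

Lemma fit_proj_id V (f : 'End(V)) x : stable_img f -> x \in limg f -> fit_proj f x = x.
Proof. by move=> st; apply: daddv_pi_id; apply: stable_img_cap. Qed.

Lemma fit_proj_ker V (f : 'End(V)) x : stable_img f -> x - fit_proj f x \in lker f.
Proof.
move=> st; have : x \in (limg f + lker f)%VS by rewrite stable_img_add ?memvf.
move=> /(daddv_pi_add (stable_img_cap st)) xE.
by rewrite -{1}xE /fit_proj addrC addKr memv_pi.
Qed.

Lemma fit_comp V (f : 'End(V)) : stable_img f -> (f \o fit_proj f)%VF = f.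
Proof.
move=> st; apply/lfunP => x; have := fit_proj_ker x st.
by rewrite comp_lfunE memv_ker linearB subr_eq0 => /eqP.
Qed.

(** The decomposition into image and kernel is functorial.  This makes the Fitting
    projection of a chain map both a module homomorphism and a chain map. *)
Lemma fit_proj_natural V W (f : 'End(V)) (g : 'End(W)) (phi : 'Hom(V, W)) :
  stable_img f -> stable_img g -> (phi \o f = g \o phi)%VF ->
  (phi \o fit_proj f = fit_proj g \o phi)%VF.
Proof.
move=> sf sg E; apply/lfunP => x; rewrite !comp_lfunE.
have img : phi (fit_proj f x) \in limg g.
  have /memv_imgP[y _ ->] := fit_proj_img f x.
  by rewrite -comp_lfunE E comp_lfunE mem_limg.
have ker : phi x - phi (fit_proj f x) \in lker g.
  have := fit_proj_ker x sf; rewrite !memv_ker -linearB /= => /eqP fx.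
  by rewrite -comp_lfunE -E comp_lfunE fx linear0.
rewrite -{1}(fit_proj_id sg img); apply/eqP; rewrite eq_sym -subr_eq0 -linearB.
rewrite -memv0 -(stable_img_cap sg) memv_cap fit_proj_img /=.
set z := phi x - _ in ker *.
by rewrite memv_ker -comp_lfunE fit_comp // -memv_ker.
Qed.

Lemma fit_projE V (f : 'End(V)) : stable_img f -> (fit_proj f \o f)%VF = f.
Proof. by move=> st; rewrite -(fit_proj_natural (f := f)) // fit_comp. Qed.

Lemma fit_proj_idem V (f : 'End(V)) : stable_img f ->
  (fit_proj f \o fit_proj f)%VF = fit_proj f.
Proof.
move=> st; apply/lfunP => x; rewrite comp_lfunE fit_proj_id //.
exact: fit_proj_img.
Qed.

Lemma fit_invr V (f : 'End(V)) : stable_img f -> (f \o fit_inv f)%VF = fit_proj f.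
Proof.
move=> st; rewrite /fit_inv !comp_lfunA fit_comp //; apply/lfunP => x.
by rewrite !comp_lfunE limg_lfunVK // fit_proj_img.
Qed.

Lemma fit_proj_inv V (f : 'End(V)) : stable_img f ->
  (fit_proj f \o fit_inv f)%VF = fit_inv f.
Proof. by move=> st; rewrite /fit_inv !comp_lfunA fit_proj_idem. Qed.

Lemma fit_inv_natural V W (f : 'End(V)) (g : 'End(W)) (phi : 'Hom(V, W)) :
  stable_img f -> stable_img g -> (phi \o f = g \o phi)%VF ->
  (phi \o fit_inv f = fit_inv g \o phi)%VF.
Proof.
move=> sf sg E; have Ep := fit_proj_natural sf sg E.
have left : (phi \o fit_inv f = fit_proj g \o (phi \o fit_inv f))%VF.
  by rewrite comp_lfunA -Ep -comp_lfunA fit_proj_inv.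
have right : (fit_inv g \o phi = fit_proj g \o (fit_inv g \o phi))%VF.
  by rewrite comp_lfunA fit_proj_inv.
have E2 : (g \o (phi \o fit_inv f) = g \o (fit_inv g \o phi))%VF.
  rewrite (comp_lfunA g phi) -E -(comp_lfunA phi f) fit_invr //.
  by rewrite (comp_lfunA g (fit_inv g)) fit_invr.
have inj a b : a \in limg g -> b \in limg g -> g a = g b -> a = b.
  move=> ga gb gab; apply/eqP; rewrite -subr_eq0 -memv0 -(stable_img_cap sg) memv_cap.
  by rewrite memvB //= memv_ker linearB /= gab subrr.
apply/lfunP => x; apply: inj.
- by rewrite left comp_lfunE fit_proj_img.
- by rewrite right comp_lfunE fit_proj_img.
- by have /lfunP/(_ x) := E2; rewrite ![(g \o (_ \o _))%VF x]comp_lfunE.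
Qed.

Lemma fit_invl V (f : 'End(V)) : stable_img f -> (fit_inv f \o f)%VF = fit_proj f.
Proof. by move=> st; rewrite -(fit_inv_natural (f := f)) // fit_invr. Qed.

Lemma iter_comp_lfunD V (f : 'End(V)) n k :
  iter (n + k) (comp_lfun f) \1%VF =
  (iter n (comp_lfun f) \1 \o iter k (comp_lfun f) \1)%VF.
Proof.
elim: n => [|n IH] /=; first by rewrite comp_lfun1l.
by rewrite IH comp_lfunA.
Qed.

Lemma stable_img_pow V (f : 'End(V)) : exists n0, forall n, (n0 <= n)%N ->
  stable_img (iter n (comp_lfun f) \1%VF).
Proof.
pose F n := limg (iter n (comp_lfun f) \1%VF).
have le n k : (F (n + k)%N <= F n)%VS.
  by rewrite /F iter_comp_lfunD limg_comp limgS // subvf.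
have ex : exists d, `[< exists n, \dim (F n) = d >].
  by exists (\dim (F 0%N)); apply/asboolP; exists 0%N.
have [d /asboolP[n0 n0E] dmin] := ex_minnP ex.
have stab n : (n0 <= n)%N -> F n = F n0.
  move=> /subnKC <-; apply/eqP; rewrite eqEdim le n0E /=; apply: dmin.
  by apply/asboolP; eexists.
exists n0 => n le0; rewrite /stable_img -iter_comp_lfunD -/(F n) -/(F (n + n)%N).
by rewrite !stab // (leq_trans le0) // leq_addr.
Qed.

Variable A : falgType K.

(** A bounded complex has only finitely many nonzero terms, whence one exponent
    [n.+1] that is large enough in all degrees. *)
Lemma fitting (X : Kbproj A) (f : grmap X X) : is_chain_map f ->
  exists n (e g : grmap X X),
    [/\ is_chain_map e, is_chain_map g & forall i, (e i \o e i = e i)%VF] /\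
    [/\ grcomp (grpow f n.+1) e = grpow f n.+1, grcomp e (grpow f n.+1) = grpow f n.+1,
        grcomp (grpow f n.+1) g = e & grcomp g (grpow f n.+1) = e].
Proof.
move=> cf; have [n0 st0] := choice (fun i => stable_img_pow (f i)).
have [b bX] := kb_bounded X.
pose n := (\sum_(k < b.+1) (n0 k%:Z + n0 (- k%:Z)))%N.
have st i : stable_img (grpow f n.+1 i).
  have [ib|bi] := leqP `|i| b.
    apply: st0; apply: leqW; rewrite /n.
    have lt : (`|i| < b.+1)%N by rewrite ltnS.
    rewrite (bigD1 (Ordinal lt)) //= -addnA.
    have [i0|i0] := leP 0 i; first by rewrite gez0_abs // leq_addr.
    by rewrite ltz0_abs // opprK addnCA leq_addr.
  have z := zero_space (bX i bi); congr lfun_img; apply/lfunP => x.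
  by rewrite [LHS]z [RHS]z.
have [hF Fd] := chain_map_pow n.+1 cf.
pose e i := fit_proj (grpow f n.+1 i); pose g i := fit_inv (grpow f n.+1 i).
have nat_mod i (h : 'End(X i)) : (forall a, (ract _ a \o h = h \o ract _ a)%VF) -> is_modhom h.
  move=> ha x a; have /lfunP/(_ x) := ha a; rewrite !comp_lfunE !ractE.
  by move->.
have ra i a : (ract (X i) a \o grpow f n.+1 i = grpow f n.+1 i \o ract (X i) a)%VF.
  by apply/lfunP => x; rewrite [LHS]comp_lfunE [RHS]comp_lfunE !ractE hF.
exists n, e, g; split; last first.
  split; apply: grmapP => i.
  - exact: fit_comp.
  - exact: fit_projE.
  - exact: fit_invr.
  - exact: fit_invl.
split; last by move=> i; apply: fit_proj_idem.
- split=> [i|i j]; first by apply: nat_mod => a; apply: fit_proj_natural.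
  by apply/esym/fit_proj_natural.
- split=> [i|i j]; first by apply: nat_mod => a; apply: fit_inv_natural.
  by apply/esym/fit_inv_natural.
Qed.

End Fitting.

(** * Indecomposable complexes *)

Section Indecomposable.
Variables (K : fieldType) (A : falgType K).
Implicit Types (X Y T : Kbproj A).

Lemma ord2 (k : 'I_2) : k = 0 \/ k = 1.
Proof. by case: k => [[|[|//]]] h; [left|right]; apply: val_inj. Qed.

(** The complementary idempotents [e] and [1 - e] split [X] into two summands, one
    of which is contractible. *)
Lemma indecomposable_idempotent X (e : grmap X X) : indecomposable X ->
  is_chain_map e -> (forall i, (e i \o e i = e i)%VF) ->
  homotopic e (gr0 X X) \/ homotopic e (gr1 X).
Proof.
move=> [_ ind] ce ee; have [he ed] := ce.
pose e' : grmap X X := fun i => \1%VF - e i.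
have ce' : is_chain_map e'.
  split=> [i|i j]; first by apply: modhomB => //; apply: modhom1.
  by rewrite /e' comp_lfunDl comp_lfunDr comp_lfunNl comp_lfunNr ed comp_lfun1l comp_lfun1r.
have e'e i : (e' i \o e i)%VF = 0.
  by rewrite /e' comp_lfunDl comp_lfunNl comp_lfun1l ee subrr.
have ee'0 i : (e i \o e' i)%VF = 0.
  by rewrite /e' comp_lfunDr comp_lfunNr comp_lfun1r ee subrr.
have e'e' i : (e' i \o e' i = e' i)%VF.
  by rewrite {1}/e' comp_lfunDl comp_lfunNl comp_lfun1l ee'0 subr0.
pose E (k : 'I_2) : grmap X X := if k == 0 then e else e'.
have cE k : is_chain_map (E k) by rewrite /E; case: ifP.
have EE k i : (E k i \o E k i = E k i)%VF by rewrite /E; case: ifP.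
have E0 k l i : k != l -> (E k i \o E l i)%VF = 0.
  by case: (ord2 k) => ->; case: (ord2 l) => ->.
have splitP k := cid (split_idempotent (cE k) (EE k)).
pose Y k : Kbproj A := sval (splitP k).
have sP k := cid (svalP (splitP k)); pose s k : grmap (Y k) X := sval (sP k).
have cP k := cid (svalP (sP k)); pose c k : grmap X (Y k) := sval (cP k).
have hs k : is_chain_map (s k) by case: (svalP (cP k)).
have hc k : is_chain_map (c k) by case: (svalP (cP k)).
have cs k i : (c k i \o s k i = \1)%VF by case: (svalP (cP k)).
have sc k i : (s k i \o c k i = E k i)%VF by case: (svalP (cP k)).
have [k Yk0] : exists k, Kzero (Y k).
  apply: ind; exists s, c; split=> //.
  - move=> k; rewrite (_ : grcomp _ _ = gr1 _); first exact: homotopic_refl.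
    by apply: grmapP => i; apply: cs.
  - move=> k l kl; rewrite (_ : grcomp _ _ = gr0 _ _); first exact: homotopic_refl.
    apply: grmapP => i; rewrite /grcomp -[c l i]comp_lfun1l -(cs l i).
    rewrite -[s k i]comp_lfun1r -(cs k i) -!comp_lfunA (comp_lfunA (s l i)) sc.
    rewrite (comp_lfunA (s k i)) sc (comp_lfunA (E l i)) E0 1?eq_sym //.
    by rewrite comp_lfun0l comp_lfun0r.
  - rewrite (_ : grsum _ = gr1 _); first exact: homotopic_refl.
    apply: grmapP => i; rewrite /grsum !big_ord_recl big_ord0 /grcomp !sc /E /=.
    by rewrite addr0 addrC subrK.
have := Kzero_retract (hs k) (hc k) Yk0.
rewrite (_ : grcomp _ _ = E k); last by apply: grmapP => i; apply: sc.
case: (ord2 k) => ->; rewrite /E /= => h; [by left | right].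
have := homotopicD h (homotopic_refl e) => /homotopic_sym.
rewrite (_ : (fun i => _) = e); last by apply: grmapP => i; rewrite add0r.
by rewrite (_ : (fun i => _) = gr1 X) // ; apply: grmapP => i; rewrite subrK.
Qed.

Lemma indecomposable_fitting X (f : grmap X X) : indecomposable X -> is_chain_map f ->
  exists n, homotopic (grpow f n.+1) (gr0 X X) \/
    exists g, [/\ is_chain_map g, homotopic (grcomp (grpow f n.+1) g) (gr1 X) &
      homotopic (grcomp g (grpow f n.+1)) (gr1 X)].
Proof.
move=> indX cf; have [n [e [g [[ce cg ee] [fe _ fg gf]]]]] := fitting cf.
exists n; have [e0|e1] := indecomposable_idempotent indX ce ee; last first.
  by right; exists g; rewrite fg gf.
left; rewrite -fe (_ : gr0 X X = grcomp (grpow f n.+1) (gr0 X X)).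
  by apply: homotopic_compl => //; apply: chain_map_pow.
by apply: grmapP => i; rewrite /grcomp comp_lfun0r.
Qed.

(** By Fitting, [b a] is nilpotent or invertible up to homotopy.  If it is
    invertible, [X] is a retract of [Y], and the corresponding idempotent of [Y] is
    nilpotent or invertible: then [X] is contractible or isomorphic to [Y]. *)
Lemma indecomposable_radical X Y (a : grmap X Y) (b : grmap Y X) :
  indecomposable X -> indecomposable Y -> ~ Kiso X Y ->
  is_chain_map a -> is_chain_map b ->
  exists n, homotopic (grpow (grcomp b a) n) (gr0 X X).
Proof.
move=> indX indY nXY ca cb; have cba := chain_map_comp cb ca.
have [n [h0|[g [cg _ gh]]]] := indecomposable_fitting indX cba; first by exists n.+1.
pose a' := grcomp a (grpow (grcomp b a) n); pose b' := grcomp g b.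
have ca' : is_chain_map a' by apply: chain_map_comp => //; apply: chain_map_pow.
have cb' : is_chain_map b' by apply: chain_map_comp.
have b'a' : homotopic (grcomp b' a') (gr1 X).
  rewrite (_ : grcomp b' a' = grcomp g (grpow (grcomp b a) n.+1)) //.
  by apply: grmapP => i; rewrite /grcomp /= !comp_lfunA.
pose r := grcomp a' b'; have cr : is_chain_map r by apply: chain_map_comp.
have rr : homotopic (grcomp r r) r.
  rewrite (_ : grcomp r r = grcomp (grcomp a' (grcomp b' a')) b'); last first.
    by apply: grmapP => i; rewrite /grcomp !comp_lfunA.
  apply: homotopic_compr => //.
  rewrite [X in homotopic _ X](_ : _ = grcomp a' (gr1 X)); first exact: homotopic_compl.
  by apply: grmapP => i; rewrite /grcomp comp_lfun1r.
exfalso; have [k] := indecomposable_fitting indY cr.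
have rk : homotopic (grpow r k.+1) r by apply: (homotopic_powl k cr cr rr).
have ck : is_chain_map (grpow r k.+1) by apply: chain_map_pow.
case=> [r0|[g' [cg' rg' _]]].
  have {}r0 : homotopic r (gr0 _ _) := homotopic_trans (homotopic_sym rk) r0.
  case: indX => nX _; apply: nX.
  apply: homotopic_trans (homotopic_sym b'a') _.
  apply: (@homotopic_trans _ _ _ _ (grcomp (grcomp b' a') (grcomp b' a'))).
    rewrite [X in homotopic X _](_ : _ = grcomp (gr1 X) (grcomp b' a')); last first.
      by apply: grmapP => i; rewrite /grcomp comp_lfun1l.
    apply: homotopic_compr; last exact: homotopic_sym.
    exact: chain_map_comp.
  rewrite (_ : grcomp _ _ = grcomp (grcomp b' r) a'); last first.
    by apply: grmapP => i; rewrite /grcomp !comp_lfunA.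
  rewrite (_ : gr0 X X = grcomp (grcomp b' (gr0 _ _)) a'); last first.
    by apply: grmapP => i; rewrite /grcomp comp_lfun0r comp_lfun0l.
  by apply: homotopic_compr => //; apply: homotopic_compl.
apply: nXY; exists a', b'; split=> //; rewrite -/r.
have r1 : homotopic (grcomp r (grcomp (grpow r k.+1) g')) r.
  rewrite [X in homotopic _ X](_ : _ = grcomp r (gr1 _)); first exact: homotopic_compl.
  by apply: grmapP => i; rewrite /grcomp comp_lfun1r.
apply: homotopic_trans (homotopic_sym r1) _; apply: homotopic_trans rg'.
rewrite (_ : grcomp _ _ = grcomp (grcomp r (grpow r k.+1)) g'); last first.
  by apply: grmapP => i; rewrite /grcomp !comp_lfunA.
apply: homotopic_compr => //.
apply: (@homotopic_trans _ _ _ _ r); last exact: homotopic_sym.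
exact: (homotopic_powl k.+1 cr cr rr).
Qed.

(** The endomorphism [io pi] of [T] is idempotent only up to homotopy.  Its Fitting
    projection is an idempotent chain map homotopic to it, whose image is a summand
    of [T] in each degree. *)
Lemma retract_model X T (io : grmap X T) (pi : grmap T X) :
  is_chain_map io -> is_chain_map pi -> homotopic (grcomp pi io) (gr1 X) ->
  exists2 Y : Kbproj A, Kiso X Y & forall i, is_zero_mod (T i) -> is_zero_mod (Y i).
Proof.
move=> cio cpi pio; pose E := grcomp io pi.
have cE : is_chain_map E by apply: chain_map_comp.
have [n [e [g [[ce cg ee] [fe ef fg gf]]]]] := fitting cE.
have [Y [s [c [hs hc cs sc zY]]]] := split_idempotent ce ee.
exists Y => //.
have pE : homotopic (grcomp pi E) pi.
  rewrite (_ : grcomp _ _ = grcomp (grcomp pi io) pi); last first.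
    by apply: grmapP => i; rewrite /grcomp !comp_lfunA.
  rewrite [X in homotopic _ X](_ : _ = grcomp (gr1 _) pi); first exact: homotopic_compr.
  by apply: grmapP => i; rewrite /grcomp comp_lfun1l.
have EE : homotopic (grcomp E E) E.
  rewrite (_ : grcomp _ _ = grcomp io (grcomp pi E)); first exact: homotopic_compl.
  by apply: grmapP => i; rewrite /grcomp !comp_lfunA.
have EF : homotopic E (grpow E n.+1).
  by apply: homotopic_sym; apply: (homotopic_powl n cE cE EE).
have pF : homotopic pi (grcomp pi (grpow E n.+1)).
  exact/homotopic_sym/homotopic_powl.
have cF := chain_map_pow n.+1 cE.
have cgi : is_chain_map (grcomp g io) by apply: chain_map_comp.
exists (grcomp c (grcomp g io)), (grcomp pi s); split.
- exact: chain_map_comp.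
- exact: chain_map_comp.
- apply: homotopic_trans pio.
  rewrite (_ : grcomp _ _ = grcomp pi (grcomp (grcomp e g) io)); last first.
    by apply: grmapP => i; rewrite /grcomp !comp_lfunA -(comp_lfunA _ (s i)) sc.
  have ceg : is_chain_map (grcomp (grcomp e g) io).
    by apply: chain_map_comp => //; apply: chain_map_comp.
  apply: homotopic_trans (homotopic_compr ceg pF) _.
  rewrite (_ : grcomp _ _ =
    grcomp pi (grcomp (grcomp (grcomp (grpow E n.+1) e) g) io)); last first.
    by apply: grmapP => i; rewrite /grcomp !comp_lfunA.
  rewrite fe fg; have cei : is_chain_map (grcomp e io) by apply: chain_map_comp.
  apply: homotopic_trans (homotopic_compr cei pF) _.
  rewrite (_ : grcomp _ _ = grcomp (grcomp pi (grcomp (grpow E n.+1) e)) io); last first.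
    by apply: grmapP => i; rewrite /grcomp !comp_lfunA.
  by rewrite fe; apply: homotopic_compr => //; apply: homotopic_sym.
- rewrite (_ : grcomp _ _ = grcomp (grcomp c g) (grcomp E s)); last first.
    by apply: grmapP => i; rewrite /grcomp !comp_lfunA.
  have ccg : is_chain_map (grcomp c g) by apply: chain_map_comp.
  apply: homotopic_trans (homotopic_compl ccg (homotopic_compr hs EF)) _.
  rewrite (_ : grcomp _ _ = grcomp c (grcomp (grcomp g (grpow E n.+1)) s)); last first.
    by apply: grmapP => i; rewrite /grcomp !comp_lfunA.
  rewrite gf (_ : grcomp _ _ = gr1 _); first exact: homotopic_refl.
  apply: grmapP => i; rewrite /grcomp -sc !comp_lfunA cs comp_lfun1l.
  exact: cs.
Qed.

End Indecomposable.

(** * The Euler form on the class of a complex *)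

(** The map from Z / B to Z' / B' induced by [psi] is injective. *)
Lemma subquotient_dim (K : fieldType) (V W : vectType K)
    (Z B : {vspace V}) (Z' B' : {vspace W}) (psi : 'Hom(V, W)) :
  (B' <= Z')%VS -> (forall v, v \in Z -> psi v \in Z') ->
  (forall v, v \in Z -> psi v \in B' -> v \in B) ->
  (\dim Z + \dim B' <= \dim Z' + \dim B)%N.
Proof.
move=> BZ' psiZ psiB.
have le1 : (\dim (psi @: Z + B') <= \dim Z')%N.
  apply: dimvS; rewrite subv_add BZ' andbT; apply/subvP => _ /memv_imgP[v vZ ->].
  exact: psiZ.
pose C := (Z :&: psi @^-1: B')%VS.
have le2 : (\dim C <= \dim B)%N.
  apply/dimvS/subvP => v; rewrite memv_cap -memv_preim => /andP[vZ vB].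
  exact: psiB.
have kerE : (C :&: lker psi = Z :&: lker psi)%VS.
  apply/vspaceP => v; rewrite !memv_cap -memv_preim memv_ker.
  by case: eqP => [->|]; rewrite ?mem0v ?andbT // !andbF.
have imgE : (psi @: C = psi @: Z :&: B')%VS.
  apply/vspaceP => w; rewrite memv_cap; apply/memv_imgP/andP.
    move=> [v]; rewrite memv_cap -memv_preim => /andP[vZ vB] ->.
    by split=> //; apply: memv_img.
  move=> [/memv_imgP[v vZ ->] vB]; exists v => //.
  by rewrite memv_cap vZ -memv_preim.
have := limg_ker_dim psi Z; have := limg_ker_dim psi C; rewrite kerE imgE.
have := dimv_sum_cap (psi @: Z)%VS B'; lia.
Qed.

Section EulerComplex.
Variables (K : fieldType) (A : falgType K) (R : realType).
Implicit Types (X Y : cplx A) (M : fdmod A).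

Definition hom_cocycles X M i : {vspace 'Hom(X i, M)} :=
  (modhom (X i) M :&: lker (linfun (@precomp _ _ _ _ M (cdiff X (i - 1)%R i))))%VS.

Definition hom_coboundaries X M i : {vspace 'Hom(X i, M)} :=
  (linfun (@precomp _ _ _ _ M (cdiff X i (i + 1)%R)) @: modhom (X (i + 1)%R) M)%VS.

Lemma hom_cocyclesP X M i (f : 'Hom(X i, M)) :
  reflect (is_modhom f /\ (f \o cdiff X (i - 1)%R i)%VF = 0) (f \in hom_cocycles X M i).
Proof.
rewrite memv_cap memv_ker lfunE /=.
by apply: (iffP andP) => [[/modhomP hf /eqP]|[/modhomP hf /eqP]].
Qed.

Lemma hom_coboundariesP X M i (f : 'Hom(X i, M)) :
  reflect (exists2 g : 'Hom(X (i + 1), M), is_modhom g & f = (g \o cdiff X i (i + 1)%R)%VF)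
    (f \in hom_coboundaries X M i).
Proof.
apply: (iffP memv_imgP) => [[g /modhomP hg ->]|[g hg ->]]; exists g => //.
- by rewrite lfunE.
- exact/modhomP.
- by rewrite lfunE.
Qed.

(** Composition with [g] is injective from the cohomology of Hom(X, M) to that of
    Hom(Y, M), since composing further with [f] gives the identity. *)
Lemma hom_cohomology_le X Y M i (f : grmap X Y) (g : grmap Y X) :
  is_chain_map f -> is_chain_map g -> homotopic (grcomp g f) (gr1 X) ->
  (\dim (hom_cocycles X M i) + \dim (hom_coboundaries Y M i) <=
   \dim (hom_cocycles Y M i) + \dim (hom_coboundaries X M i))%N.
Proof.
move=> [hf fd] [hg gd] [s hs sE].
pose psi := linfun (@precomp _ _ _ _ M (g i)).
have psiE u : psi u = (u \o g i)%VF by rewrite lfunE.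
apply: (@subquotient_dim _ _ _ _ _ _ _ psi).
- apply/subvP => u /hom_coboundariesP[v hv ->]; apply/hom_cocyclesP; split.
    exact: modhom_comp hv (@cdiff_modhom _ _ Y i (i + 1)).
  by rewrite -comp_lfunA cdiff_comp comp_lfun0r.
- move=> u /hom_cocyclesP[hu ud]; apply/hom_cocyclesP; rewrite psiE; split.
    exact: modhom_comp.
  by rewrite -comp_lfunA gd comp_lfunA ud comp_lfun0l.
- move=> u /hom_cocyclesP[hu ud] /hom_coboundariesP[v hv]; rewrite psiE => uv.
  apply/hom_coboundariesP.
  exists ((v \o f (i + 1)%R) - (u \o s (i + 1)%R i))%VF.
    by apply: modhomB; apply: modhom_comp.
  rewrite comp_lfunDl comp_lfunNl -!comp_lfunA fd comp_lfunA -uv.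
  have := congr1 (fun h => u \o h)%VF (sE i); rewrite /grcomp /gr1.
  rewrite !comp_lfunDr comp_lfunNr comp_lfun1r !comp_lfunA ud comp_lfun0l add0r.
  by rewrite -!comp_lfunA => <-; rewrite subKr.
Qed.

Lemma dim_hom_term X M i j : i + 1 = j ->
  \dim (modhom (X j) M) = (\dim (hom_cocycles X M j) + \dim (hom_coboundaries X M i))%N.
Proof.
move=> <-; pose F := linfun (@precomp _ _ _ _ M (cdiff X i (i + 1))).
rewrite -(limg_ker_dim F) /hom_cocycles; congr (_ + _)%N; congr (\dim _).
apply/vspaceP => f; rewrite !memv_cap !memv_ker !lfunE /= /precomp.
by rewrite addrK.
Qed.

Lemma signrS (i : int) : (-1) ^+ `|(i + 1)%R|%N = - (-1) ^+ `|i|%N :> R.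
Proof.
case: i => n; first by rewrite -PoszD addn1 absz_nat exprS mulN1r.
have -> : Negz n + 1 = - n%:Z by rewrite NegzE -addn1 PoszD opprD addrNK.
by rewrite abszN absz_nat NegzE abszN absz_nat exprS mulN1r opprK.
Qed.

Definition int_range (n : nat) : seq int :=
  [seq k%:Z - n%:Z | k <- iota 0 (n + n).+1].

Lemma mem_int_range n (i : int) : (i \in int_range n) = (`|i| <= n)%N.
Proof.
apply/mapP/idP => [[k]|le]; first by rewrite mem_iota => /andP[_ kn] ->; lia.
exists `|(i + n%:Z)%R|%N; last by rewrite gez0_abs; lia.
by rewrite mem_iota; lia.
Qed.

Lemma uniq_int_range n : uniq (int_range n).
Proof. by rewrite map_inj_uniq ?iota_uniq // => a b /addIr []. Qed.

Lemma int_range_sum (V : nmodType) n (F : int -> V) :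
  (forall i, (n < `|i|)%N -> F i = 0) ->
  \sum_(i \in [set: int]) F i = \sum_(i <- int_range n) F i.
Proof.
move=> F0; rewrite (bigfs _ (uniq_int_range n)).
  by apply: eq_fsbigl; apply/seteqP; split.
by move=> i _; rewrite mem_int_range -ltnNge; apply: F0.
Qed.

Lemma dim_modhom_zero (P M : fdmod A) : is_zero_mod P -> \dim (modhom P M) = 0%N.
Proof.
move=> P0; apply/eqP; rewrite dimv_eq0 -subv0; apply/subvP => f _.
rewrite memv0; apply/eqP/lfunP => x.
by rewrite (zero_space P0 x) !linear0.
Qed.

Lemma euler_sum M (I : Type) (r : seq I) (x : I -> K0R R A) :
  euler (\sum_(i <- r) x i) M = \sum_(i <- r) euler (x i) M.
Proof.
have [F FE] := linear_bundle (@euler_is_linear R K A M).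
by rewrite -FE linear_sum; apply: eq_bigr => i _; rewrite FE.
Qed.

Lemma eulerZ M c (x : K0R R A) : euler (c *: x) M = c * euler x M.
Proof.
have [F FE] := linear_bundle (@euler_is_linear R K A M).
by rewrite -!FE linearZ.
Qed.

Lemma euler_Kb_class_sum n (X : Kbproj A) M :
  (forall i, (n < `|i|)%N -> is_zero_mod (X i)) ->
  euler (Kb_class R X) M =
    \sum_(i <- int_range n) (-1) ^+ `|i|%N * (\dim (modhom (X i) M))%:R :> R.
Proof.
move=> nX; rewrite /Kb_class (@int_range_sum _ n) => [|i /nX Xi0].
  by rewrite euler_sum; apply: eq_bigr => i _; rewrite eulerZ euler_class.
by rewrite K0_class_zero ?scaler0.
Qed.

(** The Euler characteristic, with the contributions of the coboundaries in
    adjacent degrees cancelled. *)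
Lemma euler_Kb_class (X : Kbproj A) M : euler (Kb_class R X) M =
  \sum_(i \in [set: int]) (-1 : R) ^+ `|i|%N *
    ((\dim (hom_cocycles X M i))%:R - (\dim (hom_coboundaries X M i))%:R) :> R.
Proof.
have [n nX] := kb_bounded X; rewrite (@euler_Kb_class_sum n.+1); last first.
  by move=> i ni; apply: nX; apply: ltnW.
have z0 i : (n < `|i|)%N -> \dim (hom_cocycles X M i) = 0%N.
  move=> ni; apply/eqP; rewrite -leqn0 -(dim_modhom_zero M (nX i ni)).
  exact/dimvS/capvSl.
have b0 i : (n < `|i|)%N -> \dim (hom_coboundaries X M i) = 0%N.
  move=> ni; apply/eqP; rewrite -leqn0 -(dim_modhom_zero M (nX i ni)).
  apply/dimvS/subvP => f /hom_coboundariesP[g hg ->].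
  exact/modhomP/modhom_comp/cdiff_modhom.
have b0' i : (n < `|i|)%N -> \dim (hom_coboundaries X M (i - 1)) = 0%N.
  move=> ni; have := dim_hom_term X M (subrK 1 i).
  by rewrite (dim_modhom_zero M (nX i ni)) => /esym/eqP; rewrite addn_eq0 => /andP[_ /eqP].
rewrite (@int_range_sum _ n.+1) => [|i ni]; last first.
  by rewrite z0 ?b0 ?subrr ?mulr0 //; apply: ltnW.
under eq_bigr => i _ do rewrite (dim_hom_term X M (subrK 1 i)) natrD mulrDr.
under [RHS]eq_bigr => i _ do rewrite mulrBr.
rewrite !big_split /=; congr (_ + _).
rewrite -(@int_range_sum _ n.+1) => [|i ni]; last first.
  by rewrite b0' ?mulr0 //; apply: ltnW.
rewrite -(@int_range_sum _ n.+1) => [|i ni]; last first.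
  by rewrite b0 ?mulr0 ?oppr0 //; apply: ltnW.
rewrite (@reindex_fsbigT _ _ _ _ _ (fun i : int => i + 1)).
  by apply: eq_fsbigr => i _; rewrite addrK signrS mulNr.
by exists (fun i => i - 1) => i; rewrite ?addrK ?subrK.
Qed.

Lemma euler_Kb_class_iso (X Y : Kbproj A) M : Kiso X Y ->
  euler (Kb_class R X) M = euler (Kb_class R Y) M.
Proof.
move=> [f [g [cf cg gf fg]]]; rewrite !euler_Kb_class; apply: eq_fsbigr => i _.
congr (_ * _); apply/eqP; rewrite subr_eq addrAC eq_sym subr_eq -!natrD eqr_nat.
rewrite eqn_leq; apply/andP; split.
  exact: hom_cohomology_le cg cf fg.
exact: hom_cohomology_le cf cg gf.
Qed.

End EulerComplex.

(** * Complexes concentrated in degrees -1 and 0 *)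

Section Concentrated.
Variables (K : fieldType) (A : falgType K).
Implicit Types (X Y : cplx A).

(** Equalities between degrees occur in the types of such families; they are
    eliminated here once and for all. *)
Lemma graded_at X Y i0 j0 (h : 'Hom(X i0, Y j0)) : is_modhom h ->
  exists s : forall i j, 'Hom(X i, Y j),
    [/\ forall i j, is_modhom (s i j), s i0 j0 = h &
        forall i j, (i != i0) || (j != j0) -> s i j = 0].
Proof.
move=> hh; pose Q i j (g : 'Hom(X i, Y j)) := [/\ is_modhom g,
  forall (ei : i0 = i) (ej : j0 = j), g =
    match ei in _ = i', ej in _ = j' return 'Hom(X i', Y j') with
    | erefl, erefl => h end &
  (i != i0) || (j != j0) -> g = 0].
have ex i j : exists g, Q i j g.
  have [ij|] := boolP ((i != i0) || (j != j0)).
    exists 0; split=> //; first exact: modhom0.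
    by move=> ei ej; rewrite -ei -ej !eqxx in ij.
  rewrite negb_or !negbK => /andP[/eqP -> /eqP ->].
  exists h; split=> //; last by rewrite !eqxx.
  by move=> ei ej; rewrite (eq_irrelevance ei erefl) (eq_irrelevance ej erefl).
pose s i j := sval (cid (ex i j)).
have sP i j : Q i j (s i j) by exact: svalP (cid (ex i j)).
exists s; split=> [i j||i j].
- by case: (sP i j).
- by have [_ /(_ erefl erefl) -> _] := sP i0 j0.
- by case: (sP i j).
Qed.

Definition concentrated X : Prop :=
  forall i : int, i != -1 -> i != 0 -> is_zero_mod (X i).

Lemma hom_from_zero (P Q : fdmod A) (f g : 'Hom(P, Q)) : is_zero_mod P -> f = g.
Proof. by move=> P0; apply/lfunP => x; rewrite (zero_space P0 x) !linear0. Qed.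

Lemma hom_to_zero (P Q : fdmod A) (f g : 'Hom(P, Q)) : is_zero_mod Q -> f = g.
Proof. by move=> Q0; apply/lfunP => x; rewrite (zero_space Q0 (f x)) [RHS](zero_space Q0). Qed.

Definition pres (T : Kbproj A) : presentation A :=
  Presentation (kb_projective T (-1)) (kb_projective T 0) (@cdiff_modhom _ _ T (-1) 0).

Lemma pres_chain_map (S T : Kbproj A) b1 b0 : concentrated S -> concentrated T ->
  @is_pres_map _ _ (pres S) (pres T) b1 b0 ->
  exists f : grmap S T, [/\ is_chain_map f, f (-1) = b1 & f 0 = b0].
Proof.
move=> cS cT [hb1 hb0 bd].
have [s1 [hs1 s1E s10]] := @graded_at S T (-1) (-1) b1 hb1.
have [s0 [hs0 s0E s00]] := @graded_at S T 0 0 b0 hb0.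
pose f : grmap S T := fun i => s1 i i + s0 i i.
have f1 : f (-1) = b1 by rewrite /f s1E s00 // addr0.
have f0 : f 0 = b0 by rewrite /f s0E s10 // add0r.
exists f; split=> //; split=> [i|i j]; first exact: modhomD.
have [->|ij] := eqVneq j (i + 1); last by rewrite !cdiff_shape // comp_lfun0l comp_lfun0r.
have [->|i1] := eqVneq i (-1).
  have -> : (-1 + 1 = 0 :> int) by [].
  by rewrite f0 f1.
have [->|i0] := eqVneq i 0; first by apply/hom_to_zero/cT.
exact/hom_from_zero/cS.
Qed.

Lemma grpow_comp_at X Y (a : grmap X Y) (b : grmap Y X) n i :
  grpow (grcomp b a) n i = iter n (comp_lfun (b i \o a i)) \1%VF.
Proof. by []. Qed.

Lemma hom_nilpotent_pres (S T : Kbproj A) : concentrated S -> concentrated T ->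
  (forall (a : grmap S T) (b : grmap T S), is_chain_map a -> is_chain_map b ->
    exists n, homotopic (grpow (grcomp b a) n) (gr0 S S)) ->
  hom_nilpotent (pres S) (pres T).
Proof.
move=> cS cT nil a1 a0 b1 b0 ha hb.
have [a [ca aE1 aE0]] := pres_chain_map cS cT ha.
have [b [cb bE1 bE0]] := pres_chain_map cT cS hb.
have [n /homotopic_at[s hs sE]] := nil a b ca cb; exists n, (s 0 (-1)).
split; first exact: (hs 0 (-1)).
  have := sE (-1) 0 1 erefl erefl; rewrite /gr0 subr0 grpow_comp_at aE0 bE0 => E.
  apply: (etrans E).
  by rewrite (hom_to_zero (cdiff S 0 1) 0) ?comp_lfun0r ?addr0 //; apply: cS.
have := sE (-2) (-1) 0 erefl erefl; rewrite /gr0 subr0 grpow_comp_at aE1 bE1 => E.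
apply: (etrans E).
by rewrite (hom_from_zero (cdiff S (-2) (-1)) 0) ?comp_lfun0l ?add0r //; apply: cS.
Qed.

Lemma Kzero_pres (T : Kbproj A) (s : 'Hom(T 0, T (-1))) : concentrated T ->
  is_modhom s -> (s \o cdiff T (-1) 0 = \1)%VF -> (cdiff T (-1) 0 \o s = \1)%VF ->
  Kzero T.
Proof.
move=> cT hs sd ds; have [t [ht tE t0]] := @graded_at T T 0 (-1) s hs.
exists t => // i; rewrite /gr1 /gr0 subr0.
have [->|i1] := eqVneq i (-1).
  have -> : (-1 + 1 = 0 :> int) by [].
  rewrite tE sd (hom_from_zero (cdiff T (-1 - 1) (-1)) 0) ?comp_lfun0l ?add0r //.
  exact: cT.
have [->|i0] := eqVneq i 0; last exact/hom_from_zero/cT.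
have -> : (0 - 1 = -1 :> int) by [].
by rewrite tE ds (hom_to_zero (cdiff T 0 (0 + 1)) 0) ?comp_lfun0r ?addr0 //; apply: cT.
Qed.

(** A map [v] to the cycles of U in degree 0 is a chain map from T to U[1]; the
    homotopies that trivialise it are read off in degrees -1 and 0. *)
Lemma Khom_zero_shift (T U : Kbproj A) (v : 'Hom(T (-1), U 0)) : concentrated T ->
  Khom_zero T (shift U 1) -> is_modhom v -> (cdiff U 0 1 \o v)%VF = 0 ->
  exists (s0 : 'Hom(T 0, U 0)) (s1 : 'Hom(T (-1), U (-1))),
    [/\ is_modhom s0, is_modhom s1, (cdiff U 0 1 \o s0)%VF = 0 &
        v = ((s0 \o cdiff T (-1) 0) + (cdiff U (-1) 0 \o s1))%VF].
Proof.
move=> cT TU hv dv.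
have [f [hf fE f0]] := @graded_at T (shift U 1) (-1) (-1) v hv.
have cf : is_chain_map (fun i => f i i : 'Hom(T i, shift U 1 i)).
  split=> // i j; have [->|ij] := eqVneq j (i + 1); last first.
    by rewrite !cdiff_shape // comp_lfun0l comp_lfun0r.
  have [->|i1] := eqVneq i (-1); last first.
    rewrite (f0 i i) ?i1 // comp_lfun0r.
    have [e|ne] := eqVneq (i + 1) (-1); last by rewrite f0 ?ne // comp_lfun0l.
    by apply/hom_from_zero/cT => //; apply/eqP => i0; rewrite i0 in e.
  have -> : (-1 + 1 = 0 :> int) by [].
  rewrite (f0 0 0) // comp_lfun0l fE; symmetry.
  rewrite /= /shift_diff -comp_lfunZl.
  have -> : (cdiff U (-1 + 1) (0 + 1) \o v)%VF = 0 by exact: dv.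
  by rewrite scaler0.
have [s hs sE] := homotopic_at (TU _ cf).
have E0 := sE (-2) (-1) 0 erefl erefl; have E1 := sE (-1) 0 1 erefl erefl.
exists (s 0 (-1)), (- s (-1) (-2)); split.
- exact: (hs 0 (-1)).
- exact: (modhomN (hs (-1) (-2))).
- move: E1; rewrite (f0 0 0) // /gr0 subr0.
  rewrite (hom_to_zero (cdiff T 0 1) 0) ?comp_lfun0r ?addr0 //; last exact: cT.
  rewrite /= /shift_diff expr1 scaleN1r comp_lfunNl => /eqP.
  by rewrite eq_sym oppr_eq0 => /eqP.
- move: E0; rewrite fE /gr0 subr0 /= /shift_diff expr1 scaleN1r comp_lfunNl.
  move=> E; apply: (etrans E); apply: (etrans (addrC _ _)); congr (_ + _).
  exact/esym/comp_lfunNr.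
Qed.

End Concentrated.

(** * Cohomology and the Nakayama functor on complexes *)

Section CohomologyMaps.
Variables (K : fieldType) (A : falgType K).

(** Cohomology as the quotient of the cycles by the boundaries, without the
    complements on which factor modules are realised. *)
Lemma cohomologyP (X : cplx A) i h j : h + 1 = i -> i + 1 = j ->
  exists (Z : fdmod A) (z : 'Hom(Z, X i)) (q : 'Hom(Z, cohomology X i)),
    [/\ is_modhom z, is_modhom q, lker z = 0%VS, limg q = fullv &
        limg z = lker (cdiff X i j)] /\
    forall x, q x = 0 <-> z x \in limg (cdiff X h i).
Proof.
move=> hi <-; have -> : h = i - 1 by rewrite -hi addrK.
have [z hz zE] := sub_inclP (@cycles_submod _ _ X i).
have [q hq qE] := quot_projP (@boundaries_submod _ _ X i).
exists (cycles X i), z, q; split; first split=> //.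
- by apply/lker_inj => x; rewrite zE => x0; apply: subvs_inj.
- by apply/limg_full => y; exists (vsval y); rewrite qE quot_projK.
- apply/vspaceP => x; apply/memv_imgP/idP => [[y _ ->]|xk].
    by rewrite zE subvsP.
  by exists (vsproj _ x); rewrite ?memvf // zE vsprojK.
- move=> x; rewrite qE zE -boundariesE -quot_proj_eq0.
  by split=> /eqP.
Qed.

Lemma nu_mapD (P Q : fdmod A) (f g : 'Hom(P, Q)) : is_modhom f -> is_modhom g ->
  nu_map (f + g) = nu_map f + nu_map g.
Proof.
move=> hf hg; apply/lfunP => phi; apply/lfunP => e.
rewrite !add_lfunE !nu_mapE -linearD; congr (phi _).
apply: subvs_inj; apply/lfunP => x; rewrite linearD add_lfunE !dual_mapE //.
  by rewrite add_lfunE linearD.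
exact: modhomD.
Qed.

Lemma nu_map1 (P : fdmod A) : nu_map (\1%VF : 'Hom(P, P)) = \1%VF.
Proof.
apply/lfunP => phi; apply/lfunP => e; rewrite nu_mapE id_lfunE; congr (phi _).
apply: subvs_inj; apply/lfunP => x; rewrite dual_mapE ?id_lfunE //.
exact: modhom1.
Qed.

Lemma nu_map_sum (P Q : fdmod A) I (r : seq I) (f : I -> 'Hom(P, Q)) :
  (forall i, is_modhom (f i)) -> nu_map (\sum_(i <- r) f i) = \sum_(i <- r) nu_map (f i).
Proof.
move=> hf; elim: r => [|i r IH]; first by rewrite !big_nil nu_map0.
by rewrite !big_cons nu_mapD ?IH //; apply: modhom_sum.
Qed.

Definition nu_gr (X Y : cplx A) (f : grmap X Y) : grmap (nu_cplx X) (nu_cplx Y) :=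
  fun i => nu_map (f i).

Lemma nu_chain_map (X Y : cplx A) (f : grmap X Y) :
  is_chain_map f -> is_chain_map (nu_gr f).
Proof.
move=> [hf fd]; split=> [i|i j]; first exact/nu_map_modhom.
rewrite /nu_gr /= -!nu_map_comp // ?fd //; exact: cdiff_modhom.
Qed.

Lemma nu_homotopic (X Y : cplx A) (f g : grmap X Y) :
  (forall i, is_modhom (f i)) -> (forall i, is_modhom (g i)) ->
  homotopic f g -> homotopic (nu_gr f) (nu_gr g).
Proof.
move=> hf hg [s hs sE]; exists (fun i j => nu_map (s i j)) => [i j|i].
  exact/nu_map_modhom.
have hd i' j := @cdiff_modhom _ _ X i' j; have hd' i' j := @cdiff_modhom _ _ Y i' j.
have -> : nu_gr f i - nu_gr g i = nu_map (f i - g i).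
  apply/eqP; rewrite subr_eq -nu_mapD ?subrK //; exact: modhomB.
rewrite sE nu_mapD; try exact: modhom_comp.
by rewrite !nu_map_comp.
Qed.

Lemma nu_grcomp (X Y Z : cplx A) (g : grmap Y Z) (f : grmap X Y) :
  is_chain_map g -> is_chain_map f -> nu_gr (grcomp g f) = grcomp (nu_gr g) (nu_gr f).
Proof.
by move=> [hg _] [hf _]; apply: grmapP => i; rewrite /nu_gr nu_map_comp.
Qed.

Lemma nu_gr1 (X : cplx A) : nu_gr (gr1 X) = gr1 (nu_cplx X).
Proof. by apply: grmapP => i; rewrite /nu_gr nu_map1. Qed.

Lemma nu_zero_mod (P : fdmod A) : is_zero_mod P -> is_zero_mod (nu_mod P).
Proof.
move=> P0; apply/eqP; rewrite dimv_eq0 -subv0; apply/subvP => phi _.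
rewrite memv0; apply/eqP/lfunP => e; rewrite zero_lfunE.
have -> : e = 0; last exact: linear0.
by apply: subvs_inj; apply: hom_from_zero.
Qed.

Lemma nu_concentrated (X : cplx A) : concentrated X -> concentrated (nu_cplx X).
Proof. by move=> cX i i1 i0; apply/nu_zero_mod/cX. Qed.

Lemma nu_Kdsum m (X : cplx A) (Y : 'I_m -> cplx A) :
  Kdsum X Y -> Kdsum (nu_cplx X) (fun k => nu_cplx (Y k)).
Proof.
move=> [io [pi [hio hpi pio pio0 sum1]]].
have h1 (Z : cplx A) i : is_modhom (gr1 Z i) by exact: modhom1.
exists (fun k => nu_gr (io k)), (fun k => nu_gr (pi k)); split.
- by move=> k; apply: nu_chain_map.
- by move=> k; apply: nu_chain_map.
- move=> k; rewrite -nu_grcomp // -nu_gr1; apply: nu_homotopic => //.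
  by move=> i; case: (chain_map_comp (hpi k) (hio k)).
- move=> k l kl; rewrite -nu_grcomp //.
  rewrite (_ : gr0 _ _ = nu_gr (gr0 (Y k) (Y l))); last first.
    by apply: grmapP => i; rewrite /nu_gr nu_map0.
  apply: nu_homotopic => //; last exact: pio0.
    by move=> i; case: (chain_map_comp (hpi l) (hio k)).
  by move=> i; apply: modhom0.
- rewrite -nu_gr1 (_ : grsum _ = nu_gr (grsum (fun k => grcomp (io k) (pi k)))).
    apply: nu_homotopic => // i; apply: modhom_sum => k _.
    by case: (chain_map_comp (hio k) (hpi k)).
  apply: grmapP => i; rewrite /nu_gr /grsum nu_map_sum => [|k]; last first.
    by case: (chain_map_comp (hio k) (hpi k)).
  by apply: eq_bigr => k _; rewrite -nu_grcomp.
Qed.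

End CohomologyMaps.

(** * Cohomology of sums of complexes concentrated in degrees -1 and 0 *)

Section CohomologyOfSum.
Variables (K : fieldType) (A : falgType K) (m : nat).
Variables (V : cplx A) (S : 'I_m -> cplx A).
Hypothesis concS : forall k, concentrated (S k).
Hypothesis dsumVS : Kdsum V S.
Implicit Types (W X : fdmod A).

(** H^0 of a complex concentrated in degrees -1 and 0 is the cokernel of its
    differential.  By the last two properties, each of these cokernels is a direct
    summand of H^0(V), and together they generate it. *)
Lemma cohomology_top : exists pr : forall k, 'Hom(S k 0, cohomology V 0),
  [/\ forall k, is_modhom (pr k),
      forall k, (pr k \o cdiff (S k) (-1) 0)%VF = 0,
      forall X k (f : 'Hom(S k 0, X)), is_modhom f -> (f \o cdiff (S k) (-1) 0)%VF = 0 ->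
        exists2 f' : 'Hom(cohomology V 0, X), is_modhom f' & (f' \o pr k)%VF = f &
      forall X (f : 'Hom(cohomology V 0, X)), (forall k, (f \o pr k)%VF = 0) -> f = 0].
Proof.
have [io [pi [hio hpi pio _ sum1]]] := dsumVS.
have [Z [z [q [[hz hq kz sq zE] qE]]]] := @cohomologyP _ _ V 0 (-1) 1 erefl erefl.
have S1 k (f : 'Hom(S k 1, S k 0)) : (f \o cdiff (S k) 0 1)%VF = 0.
  by rewrite (hom_to_zero (cdiff (S k) 0 1) 0) ?comp_lfun0r //; apply: concS.
have jP k : exists2 j : 'Hom(S k 0, Z), is_modhom j & (z \o j)%VF = io k 0.
  have [hk dk] := hio k; apply: mono_factor => //.
  rewrite zE; apply/subvP => _ /memv_imgP[x _ ->]; rewrite memv_ker -comp_lfunE -dk.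
  by rewrite (hom_to_zero (cdiff (S k) 0 1) 0) ?comp_lfun0r ?zero_lfunE //; apply: concS.
pose j k := s2val (cid2 (jP k)).
have hj k : is_modhom (j k) := s2valP (cid2 (jP k)).
have zj k : (z \o j k)%VF = io k 0 := s2valP' (cid2 (jP k)).
have hd := @cdiff_modhom _ _ V (-1) 0.
exists (fun k => q \o j k)%VF; split.
- by move=> k; apply: modhom_comp.
- move=> k; apply/lfunP => x; rewrite !comp_lfunE zero_lfunE; apply/qE.
  have [_ dk] := hio k; rewrite -comp_lfunE zj -comp_lfunE dk comp_lfunE.
  exact: mem_limg.
- move=> X k f hf fd; have [hk dk] := hpi k.
  have hfp : is_modhom (f \o (pi k 0 \o z))%VF.
    by apply: modhom_comp => //; apply: modhom_comp.
  have [|f' hf' f'q] := epi_factor hq sq hfp.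
    apply/subvP => x; rewrite !memv_ker => /eqP/qE/memv_imgP[y _ zy].
    rewrite !comp_lfunE zy -(comp_lfunE (pi k 0)) dk comp_lfunE -(comp_lfunE f) fd.
    by rewrite zero_lfunE.
  exists f' => //; rewrite comp_lfunA f'q -!comp_lfunA zj.
  have [s _ sE] := homotopic_at (pio k); have := sE (-1) 0 1 erefl erefl.
  rewrite S1 addr0 /grcomp /gr1 => /eqP; rewrite subr_eq => /eqP ->.
  by rewrite comp_lfunDr comp_lfun1r comp_lfunA fd comp_lfun0l add0r.
- move=> X f f0; apply/lfunP => y; rewrite zero_lfunE.
  have [x <-] := (limg_full q).1 sq y.
  have [s _ sE] := homotopic_at sum1; have /lfunP/(_ (z x)) := sE (-1) 0 1 erefl erefl.
  rewrite !lfE; have /eqP -> : cdiff V 0 1 (z x) == 0 by rewrite -memv_ker -zE mem_limg.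
  rewrite linear0 addr0 /grsum sum_lfunE => E.
  have qx : q (x - \sum_k j k (pi k 0 (z x))) = 0.
    apply/qE; rewrite linearB linear_sum /=.
    have -> : z x - \sum_k z (j k (pi k 0 (z x))) = - cdiff V (-1) 0 (s 0 (-1) (z x)).
      rewrite -E opprB; congr (_ - _); apply: eq_bigr => k _.
      by rewrite -comp_lfunE zj /grcomp comp_lfunE.
    by rewrite memvN mem_limg.
  have -> : q x = \sum_k q (j k (pi k 0 (z x))).
    by apply/eqP; rewrite -subr_eq0 -linear_sum -linearB; apply/eqP.
  rewrite linear_sum big1 //= => k _.
  by rewrite -(comp_lfunE q) -(comp_lfunE f) f0 zero_lfunE.
Qed.

(** In the same way H^-1(V) is cogenerated by the kernels of the differentials. *)
Lemma cohomology_bottom : exists pr : forall k, 'Hom(cohomology V (-1), S k (-1)),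
  [/\ forall k, is_modhom (pr k),
      forall k, (cdiff (S k) (-1) 0 \o pr k)%VF = 0,
      forall X k (f : 'Hom(X, S k (-1))), is_modhom f -> (cdiff (S k) (-1) 0 \o f)%VF = 0 ->
        exists2 f' : 'Hom(X, cohomology V (-1)), is_modhom f' & (pr k \o f')%VF = f &
      forall X (f : 'Hom(X, cohomology V (-1))), (forall k, (pr k \o f)%VF = 0) -> f = 0].
Proof.
have [io [pi [hio hpi pio _ sum1]]] := dsumVS.
have [Z [z [q [[hz hq kz sq zE] qE]]]] := @cohomologyP _ _ V (-1) (-2) 0 erefl erefl.
have S0 k : cdiff (S k) (-2) (-1) = 0 by apply/hom_from_zero/concS.
have bP k : exists2 b : 'Hom(cohomology V (-1), S k (-1)), is_modhom b &
    (b \o q)%VF = (pi k (-1) \o z)%VF.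
  have [hk dk] := hpi k; apply: epi_factor => //; first exact: modhom_comp.
  apply/subvP => x; rewrite !memv_ker => /eqP/qE/memv_imgP[y _ zy].
  by rewrite comp_lfunE zy -comp_lfunE dk S0 comp_lfun0l zero_lfunE.
pose b k := s2val (cid2 (bP k)).
have hb k : is_modhom (b k) := s2valP (cid2 (bP k)).
have bq k : (b k \o q)%VF = (pi k (-1) \o z)%VF := s2valP' (cid2 (bP k)).
have dz x : cdiff V (-1) 0 (z x) = 0 by apply/eqP; rewrite -memv_ker -zE mem_limg.
exists b; split=> //.
- move=> k; have [_ dk] := hpi k; apply/lfunP => y.
  have [x <-] := (limg_full q).1 sq y; rewrite comp_lfunE -(comp_lfunE (b k)) bq.
  by rewrite comp_lfunE -comp_lfunE -dk comp_lfunE dz linear0 zero_lfunE.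
- move=> X k f hf df; have [hk dk] := hio k.
  have hiof : is_modhom (io k (-1) \o f)%VF by apply: modhom_comp.
  have [|j hj zj] := mono_factor hz kz hiof.
    rewrite zE; apply/subvP => _ /memv_imgP[x _ ->]; rewrite memv_ker -comp_lfunE.
    by rewrite comp_lfunA -dk -comp_lfunA df comp_lfun0r zero_lfunE.
  exists (q \o j)%VF; first exact: modhom_comp.
  rewrite comp_lfunA bq -comp_lfunA zj comp_lfunA.
  have [s _ sE] := homotopic_at (pio k); have := sE (-2) (-1) 0 erefl erefl.
  rewrite S0 comp_lfun0l add0r /grcomp /gr1 => /eqP; rewrite subr_eq => /eqP ->.
  by rewrite comp_lfunDl comp_lfun1l -comp_lfunA df comp_lfun0r add0r.
- move=> X f f0; apply/lfunP => y; rewrite zero_lfunE.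
  have [x xE] := (limg_full q).1 sq (f y); rewrite -xE; apply/qE.
  have [s _ sE] := homotopic_at sum1; have /lfunP/(_ (z x)) := sE (-2) (-1) 0 erefl erefl.
  rewrite !lfE dz linear0 addr0 /grsum sum_lfunE big1 => [|k _].
    by rewrite sub0r => /eqP; rewrite eqr_oppLR => /eqP ->; rewrite memvN mem_limg.
  rewrite /grcomp comp_lfunE -(comp_lfunE (pi k _)) -bq comp_lfunE xE -(comp_lfunE (b k)).
  by rewrite f0 zero_lfunE linear0.
Qed.

End CohomologyOfSum.

(** * Presilting complexes *)

Lemma Kiso_trans (K : fieldType) (A : falgType K) (X Y Z : cplx A) :
  Kiso X Y -> Kiso Y Z -> Kiso X Z.
Proof.
move=> [f [f' [cf cf' ff' f'f]]] [g [g' [cg cg' gg' g'g]]].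
exists (grcomp g f), (grcomp f' g'); split; try exact: chain_map_comp.
- rewrite (_ : grcomp _ _ = grcomp f' (grcomp (grcomp g' g) f)); last first.
    by apply: grmapP => i; rewrite /grcomp !comp_lfunA.
  apply: homotopic_trans ff'.
  rewrite [X in homotopic _ X](_ : _ = grcomp f' (grcomp (gr1 _) f)); last first.
    by apply: grmapP => i; rewrite /grcomp comp_lfun1l.
  by apply: homotopic_compl => //; apply: homotopic_compr.
- rewrite (_ : grcomp _ _ = grcomp g (grcomp (grcomp f f') g')); last first.
    by apply: grmapP => i; rewrite /grcomp !comp_lfunA.
  apply: homotopic_trans g'g.
  rewrite [X in homotopic _ X](_ : _ = grcomp g (grcomp (gr1 _) g')); last first.
    by apply: grmapP => i; rewrite /grcomp comp_lfun1l.
  by apply: homotopic_compl => //; apply: homotopic_compr.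
Qed.

Lemma indecomposable_iso (K : fieldType) (A : falgType K) (X Y : Kbproj A) :
  Kiso X Y -> indecomposable X -> indecomposable Y.
Proof.
move=> XY [nX ind]; split=> [Y0|Z dsum]; first exact: nX (Kzero_iso (Kiso_sym XY) Y0).
apply: ind; apply: Kdsum_iso (Kiso_sym XY) _ dsum => k; exact: Kiso_refl.
Qed.

Lemma Khom_zero_retract (K : fieldType) (A : falgType K) (X T V : cplx A)
    (io : grmap X T) (pi : grmap T X) : is_chain_map io -> is_chain_map pi ->
  homotopic (grcomp pi io) (gr1 X) -> Khom_zero T V -> Khom_zero X V.
Proof.
move=> cio cpi pio TV f cf; have cfpi := chain_map_comp cf cpi.
apply: homotopic_trans (_ : homotopic (grcomp (grcomp f pi) io) _).
  rewrite (_ : grcomp _ _ = grcomp f (grcomp pi io)); last first.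
    by apply: grmapP => i; rewrite /grcomp comp_lfunA.
  rewrite [X in homotopic X _](_ : f = grcomp f (gr1 _)); last first.
    by apply: grmapP => i; rewrite /grcomp comp_lfun1r.
  by apply: homotopic_compl => //; apply: homotopic_sym.
rewrite (_ : gr0 X V = grcomp (gr0 T V) io).
  exact: homotopic_compr cio (TV _ cfpi).
by apply: grmapP => i; rewrite /grcomp comp_lfun0l.
Qed.

(** A summand of a two-term complex is a retract up to homotopy of a complex
    concentrated in degrees -1 and 0, and [retract_model] keeps the zero terms. *)
Lemma two_term_summands (K : fieldType) (A : falgType K) (U : Kbproj A) m
    (Us : 'I_m -> Kbproj A) : two_term U -> Kdsum U Us ->
  exists T : 'I_m -> Kbproj A,
    [/\ Kdsum U T, forall k, Kiso (Us k) (T k) & forall k, concentrated (T k)].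
Proof.
move=> [V UV cV] dsum.
have [io [pi [hio hpi pio _ _]]] := Kdsum_iso UV (fun k => Kiso_refl (Us k)) dsum.
have /choice[T TP] k : exists T : Kbproj A, Kiso (Us k) T /\ concentrated T.
  have [T UT zT] := retract_model (hio k) (hpi k) (pio k).
  by exists T; split=> // i i1 i0; apply/zT/cV.
exists T; split=> [|k|k]; try by case: (TP k).
by apply: Kdsum_iso dsum => [|k]; [exact: Kiso_refl | case: (TP k)].
Qed.

Section Presilting.
Variables (R : realType) (K : fieldType) (A : falgType K).
Variables (U : Kbproj A) (m : nat) (T : 'I_m -> Kbproj A).
Hypothesis presU : presilting U.
Hypothesis dsumUT : Kdsum U T.
Hypothesis concT : forall k, concentrated (T k).
Hypothesis indT : forall k, indecomposable (T k).
Hypothesis distinctT : forall k l, Kiso (T k) (T l) -> k = l.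
Implicit Types (X Y W : fdmod A).

Let M := cohomology U 0.
Let N := cohomology (nu_cplx U) (-1).
Let p k := pres (T k).

(** A map from [T k (-1)] to a factor of H^0(U) lifts to the cycles of U in degree
    0, and is then a chain map from [T k] to U[1], hence null-homotopic. *)
Lemma presilting_factor_ext_free X k : is_factor M X -> ext_free (p k) X.
Proof.
move=> [g hg sg] u hu.
have [Z [z [q [[hz hq kz sq zE] qE]]]] := @cohomologyP _ _ U 0 (-1) 1 erefl erefl.
have hgq : is_modhom (g \o q)%VF by apply: modhom_comp.
have [|v hv vE] := proj_lift (pr1_projective (p k)) hgq hu.
  by rewrite limg_comp sq sg subvf.
have dz : (cdiff U 0 1 \o z)%VF = 0.
  by apply/lfunP => x; rewrite comp_lfunE zero_lfunE; apply/eqP; rewrite -memv_ker -zE mem_limg.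
have TU : Khom_zero (T k) (shift U 1).
  have [io [pi [hio hpi pio _ _]]] := dsumUT.
  by apply: Khom_zero_retract (hio k) (hpi k) (pio k) (presU _).
have hzv : is_modhom (z \o v)%VF by apply: modhom_comp.
have [|s0 [s1 [hs0 _ ds0 E]]] := Khom_zero_shift (concT k) TU hzv.
  by rewrite comp_lfunA dz comp_lfun0l.
have [|t ht tE] := mono_factor hz kz hs0.
  rewrite zE; apply/subvP => _ /memv_imgP[x _ ->].
  by rewrite memv_ker -comp_lfunE ds0 zero_lfunE.
exists (g \o (q \o t))%VF; first by do 2![apply: modhom_comp => //].
apply/lfunP => x; rewrite -vE !comp_lfunE; congr (g _).
apply/eqP; rewrite -subr_eq0 -linearB; apply/eqP/qE.
have /lfunP/(_ x) := E; rewrite add_lfunE !comp_lfunE linearB /= => ->.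
have /lfunP/(_ (cdiff (T k) (-1) 0 x)) := tE; rewrite comp_lfunE => ->.
by rewrite addrC addKr mem_limg.
Qed.

Lemma presilting_coker_factor X k (f : 'Hom(pr0 (p k), X)) : is_modhom f ->
  limg f = fullv -> (f \o prd (p k))%VF = 0 -> is_factor M X.
Proof.
move=> hf sf fd; have [pr [_ _ univ _]] := cohomology_top concT dsumUT.
have [f' hf' fE] := univ _ _ _ hf fd; exists f' => //.
apply/limg_full => x; have [y <-] := (limg_full f).1 sf x.
by exists (pr k y); rewrite -comp_lfunE fE.
Qed.

Lemma presilting_factor_generated X (q : 'Hom(M, X)) : is_modhom q -> q != 0 ->
  exists k (f : 'Hom(pr0 (p k), X)),
    [/\ is_modhom f, (f \o prd (p k))%VF = 0 & f != 0].
Proof.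
move=> hq q0; have [pr [hpr prd0 _ gen]] := cohomology_top concT dsumUT.
have [k qk] : exists k, (q \o pr k)%VF != 0.
  apply: contrapT => no; move/eqP: q0; apply; apply: gen => k.
  by apply/eqP; apply: contrapT => /negP qk; apply: no; exists k.
exists k, (q \o pr k)%VF; split; [exact: modhom_comp (hpr k) | | exact: qk].
by rewrite -comp_lfunA [(pr k \o _)%VF]prd0 comp_lfun0r.
Qed.

Let nu_bottom := cohomology_bottom (fun k => nu_concentrated (concT k)) (nu_Kdsum dsumUT).

Lemma presilting_ext_detects Y (i : 'Hom(Y, N)) : is_modhom i -> i != 0 ->
  exists k, ~ ext_free (p k) Y.
Proof.
move=> hi i0; have [pr [hpr dpr _ gen]] := nu_bottom.
apply: contrapT => no; move/eqP: i0; apply; apply: gen => k.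
have ext : ext_free (p k) Y by apply: contrapT => nk; apply: no; exists k.
apply: (ext_free_no_nu_map ext); first exact: modhom_comp (hpr k) hi.
by rewrite comp_lfunA [(_ \o pr k)%VF]dpr comp_lfun0l.
Qed.

Lemma presilting_ext_detected W k : ~ ext_free (p k) W ->
  exists2 i : 'Hom(W, N), is_modhom i & i != 0.
Proof.
move=> /ext_detected_by_nu[phi [hphi dphi phi0]].
have [pr [_ _ univ _]] := nu_bottom.
have [i hi iE] := univ _ _ phi hphi dphi; exists i => //.
by apply: contraNneq phi0 => i0; rewrite -iE i0 comp_lfun0r.
Qed.

Lemma presilting_nilpotent i j : i != j -> hom_nilpotent (p j) (p i).
Proof.
move=> ij; apply: hom_nilpotent_pres => // a b ca cb.
apply: indecomposable_radical => // /distinctT ji.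
by rewrite ji eqxx in ij.
Qed.

(** Otherwise the differential of [T k] would be invertible.  If Hom(T k, N[1]) = 0
    then [N] has no nonzero map to the kernel of nu(d_k).  As every map from a module
    W to this kernel factors through [N], it follows that Hom(T k, W[1]) = 0 for all
    W, and [d_k] is a split monomorphism; if Hom(T k, M) = 0 then [d_k] is onto. *)
Lemma presilting_summand_seen k : ~ (hom_free (p k) M /\ ext_free (p k) N).
Proof.
move=> [homM extN]; case: (indT k) => nT _; apply: nT.
have extW W : ext_free (p k) W.
  apply: contrapT => /ext_detected_by_nu[phi [hphi dphi /eqP]]; apply.
  have [pr [hpr dpr univ _]] := nu_bottom.
  have [i _ <-] := univ _ _ phi hphi dphi.
  by rewrite (ext_free_no_nu_map extN (hpr k) (dpr k)) comp_lfun0l.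
have [s hs sd] := extW _ _ (@modhom1 _ _ (pr1 (p k))).
apply: (@Kzero_pres _ _ _ s) => //.
have [pr [hpr prd0 univ _]] := cohomology_top concT dsumUT.
have pr0 : pr k = 0 by apply: homM (hpr k) (prd0 k).
have [C [c [hc dc sc]]] := coker_exact (prd_modhom (p k)).
have c0 : c = 0.
  have [|f' _ <-] := univ _ k c hc; last by rewrite pr0 comp_lfun0r.
  apply/lfunP => x; rewrite comp_lfunE zero_lfunE; apply/eqP.
  by rewrite -memv_ker -dc mem_limg.
apply/lfunP => y; have : y \in limg (prd (p k)) by rewrite dc c0 memv_ker zero_lfunE.
move=> /memv_imgP[x _ ->]; rewrite comp_lfunE id_lfunE /=; congr (cdiff _ _ _ _).
by have /lfunP/(_ x) := sd; rewrite id_lfunE comp_lfunE.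
Qed.

(** The inequalities only depend on the isomorphism classes of the modules. *)
Lemma coneDP theta : coneD R U theta <->
  (forall X, is_factor M X -> 0 <= euler theta X) /\
  (forall Y, is_subobject N Y -> euler theta Y <= 0).
Proof.
split=> [[tM fN]|[tM fN]]; split.
- move=> X [q hq sq]; have [i hi iE] := sub_inclP (lker_submod hq).
  have [c hc cE] := quot_projP (lker_submod hq).
  have ki : lker i = 0%VS by apply/lker_inj => x; rewrite iE => x0; apply: subvs_inj.
  have iq : limg i = lker q.
    apply/vspaceP => y; apply/memv_imgP/idP => [[x _ ->]|yk]; first by rewrite iE subvsP.
    by exists (vsproj _ y); rewrite ?memvf // iE vsprojK.
  have ic : limg i = lker c.
    by rewrite iq; apply/vspaceP => y; rewrite [RHS]memv_ker cE quot_proj_eq0.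
  have sc : limg c = fullv.
    by apply/limg_full => y; exists (vsval y); rewrite cE quot_projK.
  have e1 := euler_exact theta (And5 hi hq ki iq sq).
  have e2 := euler_exact theta (And5 hi hc ki ic sc).
  have := tM _ (lker_submod hq); move: e1; rewrite e2 => /addrI.
  by move=> ->.
- move=> Y [i hi ki]; have st := limg_submod hi.
  have [j hj jE] := sub_factor st hi (subvv _).
  have kj : lker j = 0%VS.
    apply/lker_inj => x jx; apply: (iffLR (lker_inj i) ki).
    by rewrite -jE jx linear0.
  have sj : limg j = fullv.
    apply/limg_full => y; have /memv_imgP[x _ xE] := subvsP y.
    by exists x; apply: subvs_inj; rewrite jE -xE.
  have [C [c [hc jc sc]]] := coker_exact hj.
  have C0 : euler theta C = 0.
    apply: (additive_zero (@euler_additive _ _ _ theta)) => -[x].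
    have [y <-] := (limg_full c).1 sc x.
    by rewrite -memv_ker -jc sj memvf.
  have := fN _ st; rewrite (euler_exact theta (And5 hj hc kj jc sc)) C0.
  by rewrite addr0.
- move=> W st; apply: tM; have [c hc cE] := quot_projP st; exists c => //.
  by apply/limg_full => y; exists (vsval y); rewrite cE quot_projK.
- move=> W st; apply: fN; have [i hi iE] := sub_inclP st; exists i => //.
  by apply/lker_inj => x; rewrite iE => x0; apply: subvs_inj.
Qed.

Lemma euler_Kb_class_pres k X : euler (Kb_class R (T k)) X = (gdim (p k) X)%:~R.
Proof.
rewrite (@euler_Kb_class_sum _ _ _ 1) => [|i i1]; last by apply: concT; lia.
rewrite /int_range /= !big_cons big_nil.
rewrite (dim_modhom_zero X (concT k (i := 2%:Z - 1%:Z) _ _)) //.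
rewrite mulr0 !addr0 /gdim intrB mulN1r mul1r addrC //.
Qed.

Variable Us : 'I_m -> Kbproj A.
Hypothesis isoT : forall k, Kiso (Us k) (T k).

Let g k : K0R R A := Kb_class R (Us k).

Let gE k X : euler (g k) X = (gdim (p k) X)%:~R.
Proof. by rewrite (euler_Kb_class_iso _ _ (isoT k)) euler_Kb_class_pres. Qed.

Theorem presilting_cone_retractions :
  exists! lam : ({x | coneD R U x} -> {x | coneD R U x}) *
                ({x | coneD R U x} -> {x | coneD R U x}),
    [/\ piecewise_linear (fun x => sval (lam.1 x)),
        piecewise_linear (fun x => sval (lam.2 x)) &
        forall x : {x | coneD R U x},
          [/\ sval (lam.1 x) + sval (lam.2 x) = sval x,
              [set y | lspan (coneC R Us) y /\ coneD R U (sval x - y)]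
                = set_add [set sval (lam.1 x)] (set_opp (coneC R Us)) &
              set_add [set sval x] (lspan (coneC R Us)) `&` coneD R U
                = set_add [set sval (lam.2 x)] (coneC R Us)]].
Proof.
have [n1 [X [fX XE]]] := finite_factors R M.
have [n2 [Y [sY YE]]] := finite_subobjects R N.
have /choice[l lE] (i : 'I_(n1 + n2)) : exists F : {linear K0R R A -> R^o}, forall theta,
    F theta = match fintype.split i with inl a => euler theta (X a)
                               | inr b => - euler theta (Y b) end.
  case: (fintype.split i) => [a|b]; first exact: linear_bundle (@euler_is_linear _ _ _ (X a)).
  apply: linear_bundle => c x y /=; rewrite (@euler_is_linear _ _ _ (Y b)) opprD.
  by rewrite scalerN.
have lX a theta : l (unsplit (inl a)) theta = euler theta (X a).
  by rewrite lE unsplitK.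
have lY b theta : l (unsplit (inr b)) theta = - euler theta (Y b).
  by rewrite lE unsplitK.
have ext_free_factor := presilting_factor_ext_free.
have gdim_ge0 := factor_gdim_ge0 ext_free_factor.
have gdim_le0 := subobject_gdim_le0 ext_free_factor presilting_coker_factor
  presilting_ext_detects.
have M_factor : is_factor M M by exists \1%VF; [exact: modhom1 | rewrite lim1g].
have N_sub : is_subobject N N.
  by exists \1%VF; [exact: modhom1 | apply/lker_inj => x; rewrite id_lfunE].
apply: (@decoupled_cone_retractions R (K0R R A) m (n1 + n2) g l (coneD R U)).
- move=> theta; split=> [/coneDP[tM fN] i|l0].
    rewrite lE; case: (fintype.split i) => [a|b]; first exact: tM.
    by rewrite oppr_ge0; apply: fN.
  apply/coneDP; split=> [Z /XE[a ->]|Z /YE[b ->]]; first by rewrite -lX.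
  by rewrite -oppr_ge0 -lY.
- move=> theta l0; apply/coneDP.
  apply: (dissection ext_free_factor presilting_coker_factor
    presilting_factor_generated presilting_ext_detects presilting_ext_detected
    presilting_nilpotent (@euler_additive _ _ _ theta)).
    move=> Z fZ simpleZ; have [a aE] := XE _ fZ; rewrite aE -lX; apply: l0.
    by move=> k k'; rewrite !lX -!aE !gE !intr_eq0; apply: simpleZ.
  move=> Z sZ simpleZ; have [b bE] := YE _ sZ; rewrite bE -oppr_ge0 -lY; apply: l0.
  by move=> k k'; rewrite !lY -!bE !gE !oppr_eq0 !intr_eq0; apply: simpleZ.
- move=> i k; rewrite lE; case: (fintype.split i) => [a|b]; rewrite gE ?oppr_ge0.
    by rewrite ler0z; apply: gdim_ge0.
  by rewrite lerz0; apply: gdim_le0.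
- move=> k; apply: contrapT => no; apply: (@presilting_summand_seen k).
  have [a aE] := XE _ M_factor; have [b bE] := YE _ N_sub.
  have M0 : gdim (p k) M = 0.
    apply/eqP; rewrite eq_le gdim_ge0 // andbT leNgt; apply/negP => gt0; apply: no.
    by exists (unsplit (inl a)); rewrite lX -aE gE ltr0z.
  have N0 : gdim (p k) N = 0.
    apply/eqP; rewrite eq_le gdim_le0 //= leNgt; apply/negP => lt0; apply: no.
    by exists (unsplit (inr b)); rewrite lY -bE gE oppr_gt0 ltrz0.
  split; first by apply/(gdim_ext_free (ext_free_factor M k M_factor)).2.
  have hom_free_N := subobject_hom_free ext_free_factor presilting_coker_factor
    presilting_ext_detects (k := k) N_sub.
  exact/(gdim_hom_free hom_free_N).2.
Qed.

End Presilting.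

Theorem proposition1p6 (R : realType) (K : fieldType) (A : falgType K)
    (U : Kbproj A) (m : nat) (Us : 'I_m -> Kbproj A)
    (hU : two_psilt U) (hUs : is_decomposition U Us) :
  exists! lam : ({theta | coneD R U theta} -> {theta | coneD R U theta}) *
                ({theta | coneD R U theta} -> {theta | coneD R U theta}),
    [/\ piecewise_linear (fun theta => sval (lam.1 theta)),
        piecewise_linear (fun theta => sval (lam.2 theta)) &
        forall theta : {theta | coneD R U theta},
          [/\ sval (lam.1 theta) + sval (lam.2 theta) = sval theta,
              [set eta | lspan (coneC R Us) eta /\ coneD R U (sval theta - eta)]
                = set_add [set sval (lam.1 theta)] (set_opp (coneC R Us)) &
              set_add [set sval theta] (lspan (coneC R Us)) `&` coneD R U
                = set_add [set sval (lam.2 theta)] (coneC R Us)]].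
Proof.
have [two pre bas] := hU; have [dsum ind] := hUs.
have [T [dsumT isoT concT]] := two_term_summands two dsum.
apply: (presilting_cone_retractions R pre dsumT concT _ _ isoT) => [k|k l Tkl].
  exact: indecomposable_iso (isoT k) (ind k).
apply: (bas m Us hUs); apply: Kiso_trans (isoT k) _.
exact: Kiso_trans Tkl (Kiso_sym (isoT l)).
Qed.
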